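(* Let $G$ be a connected complex Lie group with Lie algebra $\mathfrak g$, let $s\in (S^2\mathfrak g)^{\mathfrak g}$, let $(\Sigma,V)$ be a marked surface, and let $\Gamma$ be an oriented skeleton of $(\Sigma,V)$. For every $v\in V$ let $\Lambda_v\in\wedge^2\mathfrak g$ be such that $r_v=s+\Lambda_v$ is a quasitriangular $r$-matrix on $\mathfrak g$. Let $r_\Gamma\in\mathfrak g^{\Gamma_{1/2}}\otimes\mathfrak g^{\Gamma_{1/2}}$ be the element built from the $r_v$'s and let $\sigma_\Gamma:\mathfrak g^{\Gamma_{1/2}}\to\mathfrak X^1(G^{\Gamma_1})$ be the Lie algebra action, both as defined in the context. Then the 2-tensor field $$\pi_\Gamma=\sigma_\Gamma(r_\Gamma)$$ is a bivector field on $G^{\Gamma_1}$ and is a Poisson structure on $G^{\Gamma_1}$.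
   Context: Conventions: $x\wedge y=x\otimes y-y\otimes x$ (and similarly for triple wedges, as alternating sums). For a finite set $S$, $j\in S$ and $u\in\mathfrak g^{\otimes k}$, $(u)_j$ is the image of $u$ under the embedding of $\mathfrak g^{\otimes k}$ into $(\mathfrak g^{S})^{\otimes k}$ via the $j$-th component; more generally, for $\bigoplus_v W_v$ and $u\in W_v^{\otimes k}$, $(u)_v$ is its image in $(\bigoplus_v W_v)^{\otimes k}$. Quasitriangular $r$-matrices: the Schouten bracket on $\wedge^\bullet\mathfrak g$ is $[x_1\wedge\dots\wedge x_k,\,y_1\wedge\dots\wedge y_l]=\sum_{i,j}(-1)^{i+j}[x_i,y_j]\wedge x_1\wedge\cdots\widehat{x_i}\cdots\wedge x_k\wedge y_1\wedge\cdots\widehat{y_j}\cdots\wedge y_l$. For $s\in(S^2\mathfrak g)^{\mathfrak g}$, $\phi_s\in\wedge^3\mathfrak g$ is $\phi_s(\xi,\eta,\zeta)=2\langle\xi,[s^\#(\eta),s^\#(\zeta)]\rangle$, where $s^\#:\mathfrak g^*\to\mathfrak g$, $\langle s^\#(\xi),\eta\rangle=s(\xi,\eta)$. An element $r=s+\Lambda$, with $s\in(S^2\mathfrak g)^{\mathfrak g}$, $\Lambda\in\wedge^2\mathfrak g$, is a quasitriangular $r$-matrix if $[\Lambda,\Lambda]+\phi_s=0$ (equivalently, $r$ satisfies the classical Yang–Baxter equation $[r_{12},r_{13}]+[r_{12},r_{23}]+[r_{13},r_{23}]=0$). For $r=\sum_i x_i\otimes y_i=s+\Lambda\in\mathfrak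 g\otimes\mathfrak g$ ($s$ symmetric, $\Lambda$ skew), $n\ge1$ and a sign function $\varepsilon:\{1,\dots,n\}\to\{1,-1\}$, put $\mathrm{Mix}^n(r)=\sum_{1\le j<k\le n}\sum_i (y_i)_j\wedge(x_i)_k\in\wedge^2(\mathfrak g^n)$ and $r^{(\varepsilon,n)}=\sum_{j=1}^n\big(\varepsilon(j)(s)_j+(\Lambda)_j\big)-\mathrm{Mix}^n(r)\in\mathfrak g^n\otimes\mathfrak g^n$ (it is $0$ for $n=0$). Marked surfaces: a marked surface $(\Sigma,V)$ is a compact oriented surface $\Sigma$ with boundary (a compact Riemann surface with boundary) together with a nonempty finite set $V\subset\partial\Sigma$. A skeleton is a graph $\Gamma$ embedded in $\Sigma$ with vertex set $V$ such that $\Sigma$ deformation retracts onto $\Gamma$; it is oriented if each edge is given an orientation. $\Gamma_1$ is the set of edges, $\Gamma_{1/2}$ the set of half edges, $\alpha\mapsto\check\alpha$ the involution sending a half edge to the opposite half edge of the same edge, and $\Gamma_v\subset\Gamma_{1/2}$ the set of half edges incident to $v\in V$, so $\Gamma_{1/2}=\bigsqcup_{v\in V}\Gamma_v$. Each $\Gamma_v$ is linearly ordered by the orientation of $\Sigma$: half edges at $v$ are ordered counterclockwise, starting from the boundary arc leaving $v$ and ending at the boundary arc arriving at $v$ (the boundary being oriented with $\Sigma$ on its left). This gives $\mathfrak g^{\Gamma_v}\cong\mathfrak g^{|\Gamma_v|}$. For $\gamma\in\Gamma_1$, $\alpha_\gamma$ denotes its source half edge and $\check\alpha_\gamma$ its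 end half edge. The right action $\sigma_\Gamma:G^{\Gamma_1}\times G^{\Gamma_{1/2}}\to G^{\Gamma_1}$ is $\sigma_\Gamma(g,h)_\gamma=h_{\alpha_\gamma}^{-1}g_\gamma h_{\check\alpha_\gamma}$; the same symbol denotes the induced right Lie algebra action $\mathfrak g^{\Gamma_{1/2}}\to\mathfrak X^1(G^{\Gamma_1})$, $\sigma_\Gamma(x)(g)=\frac{d}{dt}|_{t=0}\sigma_\Gamma(g,\exp(tx))$, extended to tensors by $\sigma_\Gamma(\sum_i a_i\otimes b_i)=\sum_i\sigma_\Gamma(a_i)\otimes\sigma_\Gamma(b_i)$. Let $\varepsilon_v:\Gamma_v\to\{1,-1\}$ be $1$ on source half edges and $-1$ on end half edges, let $r_v^{(\varepsilon_v,\Gamma_v)}\in\mathfrak g^{\Gamma_v}\otimes\mathfrak g^{\Gamma_v}$ be the element $r_v^{(\varepsilon_v,|\Gamma_v|)}$ under $\mathfrak g^{\Gamma_v}\cong\mathfrak g^{|\Gamma_v|}$, and set $r_\Gamma=\sum_{v\in V}\big(r_v^{(\varepsilon_v,\Gamma_v)}\big)_v\in\mathfrak g^{\Gamma_{1/2}}\otimes\mathfrak g^{\Gamma_{1/2}}$, using $\mathfrak g^{\Gamma_{1/2}}=\bigoplus_{v\in V}\mathfrak g^{\Gamma_v}$. A Poisson structure is a bivector field with vanishing Schouten bracket with itself. *)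

(* Defs.v *)
From HB Require Import structures.
From mathcomp Require Import all_boot all_order all_algebra.
From mathcomp Require Import finmap.
From mathcomp Require Import all_classical all_reals all_analysis.
From mathcomp Require Import complex.
Import numFieldNormedType.Exports.

Set Implicit Arguments.
Unset Strict Implicit.
Unset Printing Implicit Defensive.

Import Order.TTheory GRing.Theory Num.Theory.
Local Open Scope ring_scope.
Local Open Scope classical_set_scope.

Definition Cplx (R : realType) : numFieldType := R[i].

(* [holomorphic f U]: U is open and f is infinitely K-differentiable on U. For
   K = Cplx R this is the usual notion of holomorphic map, complex
   differentiable functions being automatically infinitely differentiable. *)
Fixpoint holomorphic_upto (K : numFieldType) (E F : normedModType K) (k : nat)
    (f : E -> F) (U : set E) : Prop :=
  if k is k'.+1 then
    (forall x, U x -> differentiable f x) /\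
    (forall v, holomorphic_upto k' (fun x => 'D_v f x) U)
  else forall x, U x -> {for x, continuous f}.

Definition holomorphic (K : numFieldType) (E F : normedModType K)
    (f : E -> F) (U : set E) : Prop :=
  open U /\ forall k, holomorphic_upto k f U.

(* Charts with values in relatively open subsets of H `<=` E: H is the whole
   space for manifolds without boundary, and the closed upper half plane for
   surfaces with boundary. *)
Record chart (K : numFieldType) (T : topologicalType) (E : normedModType K)
    (H : set E) := Chart {
  chart_dom : set T;
  chart_map :> T -> E;
  chart_inv : E -> T;
  open_chart_dom : open chart_dom;
  open_chart_img :
    exists2 W : set E, open W & chart_map @` chart_dom = W `&` H;
  chart_mapK : forall p, chart_dom p -> chart_inv (chart_map p) = p;
  chart_map_continuous : {within chart_dom, continuous chart_map};
  chart_inv_continuous :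
    {within chart_map @` chart_dom, continuous chart_inv} }.

Definition chart_img (K : numFieldType) (T : topologicalType)
    (E : normedModType K) (H : set E) (c : chart T H) : set E :=
  c @` chart_dom c.

(* The change of charts is locally the restriction to H of a holomorphic map
   defined on an open subset of E. *)
Definition holomorphically_compatible (K : numFieldType) (T : topologicalType)
    (E : normedModType K) (H : set E) (c d : chart T H) : Prop :=
  forall p, chart_dom c p -> chart_dom d p ->
  exists (U : set E) (f : E -> E), [/\ U (c p), holomorphic f U &
    forall q, chart_dom c q -> chart_dom d q -> U (c q) -> d q = f (c q)].

(* [chart_at] only serves to represent tangent vectors by coordinates; it is
   an arbitrary choice of a chart around each point. *)
HB.mixin Record isManifold (R : realType) (E : normedModType (Cplx R))
    (H : set E) T of Topological T := {
  atlas : set (chart T H);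
  chart_at : T -> chart T H;
  atlas_chart_at : forall p, atlas (chart_at p);
  mem_chart_at : forall p, chart_dom (chart_at p) p;
  atlas_compatible : forall c d, atlas c -> atlas d ->
    holomorphically_compatible c d;
  manifold_hausdorff : hausdorff_space T;
  manifold_second_countable : @second_countable T }.

#[short(type="manifoldType")]
HB.structure Definition Manifold (R : realType) (E : normedModType (Cplx R))
  (H : set E) := { T of Topological T & isManifold R E H T }.

Notation complexManifoldType R n :=
  (@manifoldType R 'rV[Cplx R]_n [set: 'rV[Cplx R]_n]).

Definition closed_half_plane (R : realType) : set (Cplx R) :=
  [set z | 0 <= complex.Im z].
Arguments closed_half_plane : clear implicits.

(* The orientation is the one given by the complex structure. *)
Notation borderedRiemannSurfaceType R :=
  (@manifoldType R (Cplx R) (closed_half_plane R)).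

HB.mixin Record isLieGroup (R : realType) (n : nat) G
    of @Manifold R 'rV[Cplx R]_n [set: 'rV[Cplx R]_n] G & Group G := {
  mulg_continuous : continuous (fun p : G * G => (p.1 * p.2)%g);
  invg_continuous : continuous (fun x : G => (x^-1)%g);
  mulg_holomorphic : forall c1 c2 d : chart G [set: 'rV[Cplx R]_n],
    atlas c1 -> atlas c2 -> atlas d ->
    holomorphic
      (fun z : 'rV[Cplx R]_n * 'rV[Cplx R]_n =>
         d (chart_inv c1 z.1 * chart_inv c2 z.2)%g)
      [set z | [/\ chart_img c1 z.1, chart_img c2 z.2 &
                   chart_dom d (chart_inv c1 z.1 * chart_inv c2 z.2)%g]];
  invg_holomorphic : forall c d : chart G [set: 'rV[Cplx R]_n],
    atlas c -> atlas d ->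
    holomorphic (fun z : 'rV[Cplx R]_n => d (chart_inv c z)^-1%g)
      [set z | chart_img c z /\ chart_dom d (chart_inv c z)^-1%g] }.

#[short(type="complexLieGroupType")]
HB.structure Definition LieGroup (R : realType) (n : nat) :=
  { G of @Manifold R 'rV[Cplx R]_n [set: 'rV[Cplx R]_n] G & Group G
       & isLieGroup R n G }.

Section holomorphic_facts.
Variables (K : numFieldType) (E F : normedModType K).

Lemma differentiable_near_eq (f g : E -> F) x :
  {near x, f =1 g} -> differentiable f x -> differentiable g x.
Proof.
move=> fg /[dup] df /diff_locallyP[cdf dfE].
have fgx : f x = g x := nbhs_singleton fg.
have gE : g \o shift x = cst (g x) + 'd f x +o_ 0 id.
  apply/eqaddoP => e e0; move/eqaddoP: dfE => /(_ e e0).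
  have fg0 : \forall y \near (0 : E), f (y + x) = g (y + x).
    have h : (fun y => y + x) @ (0 : E) --> x.
      by rewrite -[X in _ --> X]add0r; apply: cvgD; [exact: cvg_id|exact: cvg_cst].
    exact: (h _ fg).
  by apply: filterS2 fg0 => y /=; rewrite !fctE /= => -> ; rewrite fgx.
by apply/diff_locallyP; rewrite (diff_unique cdf gE).
Qed.

Lemma holomorphic_upto_ext k (f g : E -> F) (U : set E) : open U ->
  (forall x, U x -> f x = g x) ->
  holomorphic_upto k f U -> holomorphic_upto k g U.
Proof.
move=> oU; elim: k f g => [|k IH] f g fg /=.
  move=> cf x Ux; rewrite /prop_for /continuous_at -(fg _ Ux).
  apply: cvg_trans (cf x Ux); apply: near_eq_cvg.
  by have := open_nbhs_nbhs (conj oU Ux); apply: filterS => y /fg.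
have nfg x : U x -> {near x, f =1 g}.
  by move=> Ux; have := open_nbhs_nbhs (conj oU Ux); apply: filterS => y /fg.
move=> [df Df]; split=> [x Ux|v].
  by apply: differentiable_near_eq (df x Ux); exact: nfg.
apply: IH (Df v) => x Ux; apply: near_eq_derive; exact: nfg.
Qed.

Lemma holomorphic_upto_sub k (f : E -> F) (U V : set E) : V `<=` U ->
  holomorphic_upto k f U -> holomorphic_upto k f V.
Proof.
move=> VU; elim: k f => [|k IH] f /=; first by move=> h x /VU /h.
by move=> [df Df]; split=> [x /VU /df//|v]; exact: IH.
Qed.

Lemma holomorphic_upto_sum k n (f : 'I_n -> E -> F) (U : set E) : open U ->
  (forall i, holomorphic_upto k (f i) U) ->
  holomorphic_upto k (\sum_(i < n) f i) U.
Proof.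
move=> oU; elim: k f => [|k IH] f /= hf.
  move=> x Ux; elim/big_ind: _ => [|g h cg ch|i _].
  - exact: cvg_cst.
  - exact: continuousD.
  - exact: hf.
split=> [x Ux|v]; first by apply: differentiable_sum => i; have [/(_ x Ux)] := hf i.
apply: (@holomorphic_upto_ext k (\sum_(i < n) (fun x => 'D_v (f i) x))) => //.
  move=> x Ux; rewrite derive_sum ?fct_sumE// => i.
  by apply/diff_derivable; have [/(_ x Ux)] := hf i.
by apply: IH => i; have [] := hf i.
Qed.
End holomorphic_facts.

Lemma holomorphic_upto_linear (K : numFieldType) (E F E' F' : normedModType K)
    (P : {linear E' -> E}) (L : {linear F -> F'}) :
    continuous P -> continuous L -> forall k (f : E -> F) (U : set E), open U ->
  holomorphic_upto k f U ->
  holomorphic_upto k (L \o f \o P) (P @^-1` U).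
Proof.
move=> cP cL k f U oU.
have oPU : open (P @^-1` U) by apply: open_comp => // x _; exact: cP.
elim: k f => [|k IH] f /=.
  move=> cf x Ux; apply: continuous_comp; first exact: cP.
  by apply: continuous_comp; [exact: cf|exact: cL].
move=> [df Df]; split=> [x Ux|v].
  apply: differentiable_comp; first exact: linear_differentiable.
  by apply: differentiable_comp; [exact: df|exact: linear_differentiable].
apply: (@holomorphic_upto_ext _ _ _ k (L \o (fun x => 'D_(P v) f x) \o P)) => //.
  move=> x Ux /=.
  have dP := linear_differentiable x cP.
  have dL := linear_differentiable (f (P x)) cL.
  rewrite [RHS]deriveE; last first.
    by apply: differentiable_comp => //; apply: differentiable_comp => //; exact: df.
  rewrite diff_comp//=; last by apply: differentiable_comp => //; exact: df.
  rewrite diff_comp//=; last exact: df.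
  by rewrite !diff_lin// deriveE//; exact: df.
exact: IH.
Qed.

Lemma rV_linear_continuous (K : numFieldType) m (F : normedModType K)
    (f : {linear 'rV[K]_m -> F}) : continuous f.
Proof.
have -> : f = (\sum_(i < m) (fun z : 'rV[K]_m => z 0 i *: f (delta_mx 0 i)))
    :> (_ -> _).
  apply/funext => z; rewrite fct_sumE {1}[z]row_sum_delta linear_sum.
  by apply: eq_bigr => i _; rewrite linearZ.
apply: (big_ind (fun g : 'rV[K]_m -> F => continuous g)).
- by move=> z; exact: (@cvg_cst F 0 _ (nbhs z) _).
- by move=> g h cg ch z; exact: (cvgD (cg z) (ch z)).
- by move=> i _ z; exact: (cvgZr_tmp (@coord_continuous K 1 m 0 i z)).
Qed.

Section power.
Variables (R : realType) (n : nat) (E : finType).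
Notation K := (Cplx R).
Notation N := (#|E| * n)%N.

(* The product manifold M^E, with the product topology, is modelled on
   (K^n)^E = K^N; [mxvec] identifies E-indexed families of vectors of K^n with
   vectors of K^N. *)
Definition join_coords (v : E -> 'rV[K]_n) : 'rV[K]_N :=
  mxvec (\matrix_(i < #|E|) v (enum_val i)).

Definition coords_at (e : E) (z : 'rV[K]_N) : 'rV[K]_n :=
  row (enum_rank e) (vec_mx z).

Lemma join_coordsK v e : coords_at e (join_coords v) = v e.
Proof. by rewrite /coords_at mxvecK rowK enum_rankK. Qed.

Lemma coords_atK z : join_coords (coords_at^~ z) = z.
Proof.
rewrite -[RHS]vec_mxK; congr mxvec; apply/row_matrixP => i.
by rewrite rowK /coords_at enum_valK.
Qed.

Lemma coords_at_is_linear e : linear (coords_at e).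
Proof. by move=> a u v; rewrite /coords_at !linearP. Qed.
HB.instance Definition _ e :=
  GRing.isLinear.Build K 'rV[K]_N 'rV[K]_n _ (coords_at e)
    (coords_at_is_linear e).

Definition single_coords (e : E) (v : 'rV[K]_n) : 'rV[K]_N :=
  join_coords (fun e' => if e' == e then v else 0).

Lemma single_coords_is_linear e : linear (single_coords e).
Proof.
move=> a u v; rewrite /single_coords /join_coords -linearP; congr mxvec.
by apply/matrixP => i j; rewrite !mxE; case: ifP => _; rewrite !mxE ?mulr0 ?addr0.
Qed.
HB.instance Definition _ e :=
  GRing.isLinear.Build K 'rV[K]_n 'rV[K]_N _ (single_coords e)
    (single_coords_is_linear e).

Lemma join_coords_sum v : join_coords v = \sum_(e : E) single_coords e (v e).
Proof.
rewrite -[RHS]coords_atK; congr mxvec; apply/row_matrixP => i; rewrite !rowK.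
rewrite linear_sum/= (bigD1 (enum_val i))//= join_coordsK eqxx big1 ?addr0//.
by move=> e ne; rewrite join_coordsK eq_sym (negPf ne).
Qed.

Variable M : complexManifoldType R n.
Variable c : E -> chart M [set: 'rV[K]_n].

Definition power_map (p : {ptws E -> M}) : 'rV[K]_N :=
  join_coords (fun e => c e (p e)).
Definition power_inv (z : 'rV[K]_N) : {ptws E -> M} :=
  fun e => chart_inv (c e) (coords_at e z).
Definition power_dom : set {ptws E -> M} :=
  [set p | forall e, chart_dom (c e) (p e)].

Lemma ptws_proj_continuous e : continuous (fun p : {ptws E -> M} => p e).
Proof. exact: (@proj_continuous E (fun=> M) e). Qed.

Lemma open_forall (T : topologicalType) (A : E -> set T) :
  (forall e, open (A e)) -> open [set p | forall e, A e p].
Proof.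
move=> oA; rewrite openE => p Ap; apply: filter_forall => e.
by apply: open_nbhs_nbhs; split.
Qed.

Lemma open_power_dom : open power_dom.
Proof.
apply: (@open_forall {ptws E -> M} (fun e => [set p | chart_dom (c e) (p e)])) => e.
apply: (@open_comp _ _ (fun p : {ptws E -> M} => p e)).
  by move=> p _; exact: ptws_proj_continuous.
exact: open_chart_dom.
Qed.

Lemma power_img :
  power_map @` power_dom = [set z | forall e, chart_img (c e) (coords_at e z)].
Proof.
apply/seteqP; split => [_ [p dp <-] e|z hz].
  by rewrite join_coordsK; exists (p e).
exists (power_inv z).
  by move=> e; have [q dq qE] := hz e; rewrite /power_inv -qE chart_mapK.
rewrite -[RHS]coords_atK; congr join_coords; apply/funext => e.
by have [q dq qE] := hz e; rewrite /power_inv -qE chart_mapK.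
Qed.

Lemma open_chart_imgT (d : chart M [set: 'rV[K]_n]) : open (chart_img d).
Proof. by rewrite /chart_img; have [W oW ->] := open_chart_img d; rewrite setIT. Qed.

Lemma open_power_img : open (power_map @` power_dom).
Proof.
rewrite power_img.
apply: (@open_forall 'rV[K]_N (fun e => [set z | chart_img (c e) (coords_at e z)])) => e.
apply: (@open_comp _ _ (coords_at e)); last exact: open_chart_imgT.
by move=> z _; exact: rV_linear_continuous.
Qed.

Lemma open_power_imgT : exists2 W : set 'rV[K]_N,
  open W & power_map @` power_dom = W `&` setT.
Proof. by exists (power_map @` power_dom); [exact: open_power_img|rewrite setIT]. Qed.

Lemma power_mapK p : power_dom p -> power_inv (power_map p) = p.
Proof.
by move=> dp; apply/funext => e; rewrite /power_inv join_coordsK chart_mapK.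
Qed.

Lemma power_map_continuous : {within power_dom, continuous power_map}.
Proof.
rewrite continuous_open_subspace; last exact: open_power_dom.
move=> p /set_mem dp.
have -> : power_map =
    \sum_(i < #|E|) (fun q : {ptws E -> M} =>
      single_coords (enum_val i) (c (enum_val i) (q (enum_val i)))).
  apply/funext => q; rewrite fct_sumE /power_map join_coords_sum.
  by rewrite (reindex_onto enum_val enum_rank) /=; [apply: eq_bigl => i; rewrite enum_valK eqxx|move=> e _; rewrite enum_rankK].
apply: (big_ind (fun g : {ptws E -> M} -> 'rV[K]_N => {for p, continuous g})).
- exact: (@cvg_cst 'rV[K]_N 0 _ (nbhs p) _).
- by move=> g h cg ch; exact: (cvgD cg ch).
- move=> i _; set e := enum_val i.
  have ce : {for p e, continuous (c e)}.
    have := @chart_map_continuous _ _ _ _ (c e).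
    rewrite continuous_open_subspace; last exact: open_chart_dom.
    by apply; apply/mem_set; exact: dp.
  apply: (@continuous_comp _ _ _ (fun q : {ptws E -> M} => q e)
    (fun x => single_coords e (c e x))); first exact: ptws_proj_continuous.
  by apply: continuous_comp => //; exact: rV_linear_continuous.
Qed.

Lemma cvg_ptws (T : topologicalType) (G : set_system {ptws E -> T})
    (f : {ptws E -> T}) {FG : Filter G} :
  (forall e, (fun g => g e) @ G --> f e) -> G --> f.
Proof.
move=> h; apply/cvg_sup => e A [B [[V oV VB] Bf] BA].
apply: filterS BA _; rewrite -VB.
by apply: (h e V); apply: open_nbhs_nbhs; split => //; rewrite -VB in Bf.
Qed.

Lemma power_inv_continuous :
  {within power_map @` power_dom, continuous power_inv}.
Proof.
rewrite continuous_open_subspace; last exact: open_power_img.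
move=> z /set_mem; rewrite power_img => hz.
apply: (@cvg_ptws _ _ _ (fmap_filter _ (nbhs_filter z))) => e.
apply: (@continuous_comp _ _ _ (coords_at e) (chart_inv (c e))).
  exact: rV_linear_continuous.
have := @chart_inv_continuous _ _ _ _ (c e).
rewrite continuous_open_subspace; last exact: open_chart_imgT.
by apply; apply/mem_set; exact: hz.
Qed.

Definition power_chart : chart {ptws E -> M} [set: 'rV[K]_N] :=
  Chart open_power_dom open_power_imgT power_mapK power_map_continuous
    power_inv_continuous.
End power.

Section power_manifold.
Variables (R : realType) (n : nat) (E : finType) (M : complexManifoldType R n).
Notation K := (Cplx R).
Notation N := (#|E| * n)%N.

Definition power_atlas : set (chart {ptws E -> M} [set: 'rV[K]_N]) :=
  [set power_chart c | c in [set c : E -> chart M [set: 'rV[K]_n] |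
                             forall e, atlas (c e)]].

Definition power_chart_at (p : {ptws E -> M}) :=
  power_chart (fun e => chart_at (p e)).

Lemma power_atlas_chart_at p : power_atlas (power_chart_at p).
Proof. by eexists; last reflexivity; move=> e /=; exact: atlas_chart_at. Qed.

Lemma mem_power_chart_at p : chart_dom (power_chart_at p) p.
Proof. by move=> e; exact: mem_chart_at. Qed.

Lemma power_atlas_compatible c d : power_atlas c -> power_atlas d ->
  holomorphically_compatible c d.
Proof.
move=> [{}c ac <-] [{}d ad <-] p dc dd.
have /choice[Uf Ufh] e : exists Uf : set 'rV[K]_n * ('rV[K]_n -> 'rV[K]_n),
    [/\ Uf.1 (c e (p e)), holomorphic Uf.2 Uf.1 & forall q,
     chart_dom (c e) q -> chart_dom (d e) q -> Uf.1 (c e q) -> d e q = Uf.2 (c e q)].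
  by have [U [f h]] := atlas_compatible _ _ (ac e) (ad e) (p e) (dc e) (dd e); exists (U, f).
have oU : open [set z | forall e, (Uf e).1 (coords_at e z)].
  apply: (@open_forall _ 'rV[K]_N (fun e => [set z | (Uf e).1 (coords_at e z)])) => e.
  apply: (@open_comp _ _ (@coords_at R n E e)); last by have [_ []] := Ufh e.
  by move=> z _; exact: rV_linear_continuous.
exists [set z | forall e, (Uf e).1 (coords_at e z)].
exists (fun z => join_coords (fun e => (Uf e).2 (coords_at e z))); split.
- by move=> e; rewrite join_coordsK; have [] := Ufh e.
- split=> // k.
  have -> : (fun z => join_coords (fun e => (Uf e).2 (coords_at e z))) =
    \sum_(i < #|E|) (single_coords (enum_val i) \o (Uf (enum_val i)).2 \o
      @coords_at R n E (enum_val i)).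
    apply/funext => q; rewrite fct_sumE join_coords_sum.
    by rewrite (reindex_onto enum_val enum_rank) /=; [apply: eq_bigl => i; rewrite enum_valK eqxx|move=> e _; rewrite enum_rankK].
  apply: holomorphic_upto_sum => // i; set e := enum_val i.
  have [_ [oUe hUe] _] := Ufh e.
  apply: (@holomorphic_upto_sub _ _ _ _ _ (@coords_at R n E e @^-1` (Uf e).1)).
    by move=> z; exact.
  by apply: holomorphic_upto_linear => //; exact: rV_linear_continuous.
- move=> q dcq ddq Uq; congr join_coords; apply/funext => e.
  have [_ _ h] := Ufh e; rewrite join_coordsK; apply: h => //.
  by have := Uq e; rewrite join_coordsK.
Qed.

Lemma power_hausdorff : hausdorff_space {ptws E -> M}.
Proof.
by apply: (@hausdorff_product E (fun=> M)) => _; exact: manifold_hausdorff.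
Qed.

Lemma power_second_countable : @second_countable {ptws E -> M}.
Proof.
have [B cB [oB hB]] := @manifold_second_countable R _ _ M.
have /countable_injP[f finj] := cB.
pose box (b : E -> set M) : set {ptws E -> M} := [set p | forall e, b e (p e)].
exists [set box b | b in [set b | forall e, B (b e)]].
  pose D := [set b : E -> set M | forall e, B (b e)].
  apply: (@sub_countable _ _ _ D); first exact: card_image_le.
  apply/countable_injP.
  exists (fun b : E -> set M => choice.pickle ([ffun e => f (b e)] : {ffun E -> nat})) => b b' /set_mem Db /set_mem Db'.
  move=> /(pcan_inj choice.pickleK)/ffunP h; apply/funext => e.
  by apply: finj; rewrite ?inE//; have := h e; rewrite !ffunE.
split.
  move=> _ [b Bb <-].
  apply: (@open_forall _ {ptws E -> M} (fun e => [set p | b e (p e)])) => e.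
  apply: (@open_comp _ _ (fun p : {ptws E -> M} => p e)).
    by move=> p _; exact: ptws_proj_continuous.
  exact: oB.
move=> p.
have neB e A : nbhs (p e) A -> exists b, [/\ B b, b (p e) & b `<=` A].
  by move=> /(hB (p e))[b [Bb bp] bA]; exists b.
have FF : Filter (filter_from [set U | [set box b | b in [set b | forall e, B (b e)]] U /\ U p] id).
  apply: filter_from_filter.
    have /choice[b hb] e : exists b, [/\ B b, b (p e) & b `<=` setT].
      by apply: neB; exact: filterT.
    by exists (box b); split; [exists b => // e; have [] := hb e|move=> e; have [] := hb e].
  move=> _ _ [[b Bb <-] bp] [[b' Bb' <-] bp'].
  have /choice[b2 hb2] e : exists b0, [/\ B b0, b0 (p e) & b0 `<=` b e `&` b' e].
    by apply: neB; apply: open_nbhs_nbhs; split; [apply: openI; apply: oB|split; [exact: bp|exact: bp']].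
  exists (box b2).
    by split; [exists b2 => // e; have [] := hb2 e|move=> e; have [] := hb2 e].
  by move=> q bq; split=> e; have [_ _ /(_ _ (bq e))[]] := hb2 e.
apply: cvg_ptws => e A Ae.
have /choice[b hb] e' : exists b, [/\ B b, b (p e') & e' = e -> b `<=` A].
  have [->|ne] := eqVneq e' e.
    by have [b []] := neB e A Ae; exists b.
  have [b [Bb bp _]] := neB e' setT filterT; exists b; split => // ee'.
  by rewrite ee' eqxx in ne.
exists (box b).
  by split; [exists b => // e'; have [] := hb e'|move=> e'; have [] := hb e'].
by move=> q bq; have [_ _ /(_ erefl)] := hb e; apply; exact: bq.
Qed.

HB.instance Definition _ := @isManifold.Build R 'rV[K]_N [set: 'rV[K]_N]
  {ptws E -> M} power_atlas power_chart_at power_atlas_chart_at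
  mem_power_chart_at power_atlas_compatible power_hausdorff
  power_second_countable.

End power_manifold.

Section tensors.
Variable (K : fieldType).

(* For a space V with basis (e_i)_(i < n), a matrix t : 'M_n stands for
   \sum_(i, j) t i j e_i (x) e_j in V (x) V, and a function u on triples for
   \sum_(i, j, k) u (i, j, k) e_i (x) e_j (x) e_k. *)
Definition tens2 n (x y : 'rV[K]_n) : 'M[K]_n := x^T *m y.

Definition tens3 n (x y z : 'rV[K]_n) : {ffun 'I_n * 'I_n * 'I_n -> K} :=
  [ffun p => x 0 p.1.1 * y 0 p.1.2 * z 0 p.2].

Definition wedge3 n (x y z : 'rV[K]_n) : {ffun 'I_n * 'I_n * 'I_n -> K} :=
  tens3 x y z + tens3 y z x + tens3 z x y
  - tens3 y x z - tens3 x z y - tens3 z y x.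

Definition basis_vec n (i : 'I_n) : 'rV[K]_n := delta_mx 0 i.

Definition map_tens2 m n (f : 'rV[K]_m -> 'rV[K]_n) (t : 'M[K]_m) : 'M[K]_n :=
  \sum_i \sum_j t i j *: tens2 (f (basis_vec i)) (f (basis_vec j)).
End tensors.

Section tangent.
Variables (R : realType) (n : nat).
Notation K := (Cplx R).
Implicit Types (M : complexManifoldType R n).

(* T_pM is identified with K^n through the chart [chart_at p]. *)
Definition tangent M (p : M) : Type := 'rV[K]_n.

Definition velocity M (p : M) (gamma : K -> M) : tangent p :=
  derive1 (fun t => chart_at p (gamma t)) 0.

Definition mdiff M M' (f : M -> M') (p : M)
    (v : tangent p) : tangent (f p) :=
  'd (fun z => chart_at (f p) (f (chart_inv (chart_at p) z))) (chart_at p p) v.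

Definition tangent_coords M (c : chart M [set: 'rV[K]_n]) (p : M)
    (v : tangent p) : 'rV[K]_n :=
  'd (fun z => c (chart_inv (chart_at p) z)) (chart_at p p) v.

Definition vector_field M := forall p : M, tangent p.

Definition vector_field_coords M (c : chart M [set: 'rV[K]_n])
    (X : vector_field M) (z : 'rV[K]_n) : 'rV[K]_n :=
  tangent_coords c (X (chart_inv c z)).

Definition vector_field_bracket M (X Y : vector_field M) : vector_field M :=
  fun p => let c := chart_at p in
    'D_(X p) (vector_field_coords c Y) (c p)
    - 'D_(Y p) (vector_field_coords c X) (c p).
End tangent.

Section poisson.
Variables (R : realType) (N : nat) (M : complexManifoldType R N).
Notation K := (Cplx R).

(* [pi p] is an element of T_pM (x) T_pM. *)
Definition tensor2_field := M -> 'M[K]_N.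

Definition tensor2_coords (c : chart M [set: 'rV[K]_N]) (pi : tensor2_field)
    (z : 'rV[K]_N) : 'M[K]_N :=
  map_tens2 (@tangent_coords R N M c (chart_inv c z)) (pi (chart_inv c z)).

Definition bivector_field (pi : tensor2_field) : Prop :=
  (forall p, (pi p)^T = - pi p) /\
  (forall c, atlas c -> holomorphic (tensor2_coords c pi) (chart_img c)).

(* Writing P = 1/2 \sum P^{ij} d_i /\ d_j and likewise for Q, the Schouten
   bracket, with the sign convention
   [x1 /\ x2, y1 /\ y2] = \sum (-1)^(i+j) [x_i, y_j] /\ x_{i'} /\ y_{j'},
   has (i, j, k) component the cyclic sum over (i, j, k) of
   \sum_l (P^{il} d_l Q^{jk} + Q^{il} d_l P^{jk}). *)
Definition schouten_coords (P Q : 'rV[K]_N -> 'M[K]_N) (z : 'rV[K]_N)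
    (i j k : 'I_N) : K :=
  let D (A B : 'rV[K]_N -> 'M[K]_N) (a b c : 'I_N) :=
    \sum_l A z a l * 'D_(basis_vec K l) (fun w => B w b c : K) z in
  D P Q i j k + D P Q j k i + D P Q k i j
  + (D Q P i j k + D Q P j k i + D Q P k i j).

Definition poisson_structure (pi : tensor2_field) : Prop :=
  bivector_field pi /\
  forall c, atlas c -> forall z, chart_img c z -> forall i j k,
    schouten_coords (tensor2_coords c pi) (tensor2_coords c pi) z i j k = 0.
End poisson.

Section lie_group.
Variables (R : realType) (n : nat) (G : complexLieGroupType R n).
Notation K := (Cplx R).
Notation g := (tangent (1%g : G)).

Definition left_invariant_field (x : g) : vector_field G :=
  fun a => mdiff (fun h : G => (a * h)%g) x.

Definition lie_bracket (x y : g) : g :=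
  vector_field_bracket (left_invariant_field x) (left_invariant_field y) 1%g.

(* t |-> expG (t x) is the holomorphic one-parameter subgroup with velocity x
   at the identity; this determines expG. *)
Definition exponential_map (expG : g -> G) : Prop :=
  forall x : 'rV[K]_n, [/\
    forall t u : K, expG ((t + u) *: x) = (expG (t *: x) * expG (u *: x))%g,
    continuous (fun t : K => expG (t *: x)),
    forall c : chart G [set: 'rV[K]_n], atlas c ->
      holomorphic (fun t : K => c (expG (t *: x)))
        [set t | chart_dom c (expG (t *: x))] &
    velocity 1%g (fun t : K => expG (t *: x)) = x].
End lie_group.

Section rmatrix.
Variables (K : fieldType) (n : nat) (br : 'rV[K]_n -> 'rV[K]_n -> 'rV[K]_n).
Notation g := 'rV[K]_n.
Notation e_ := (@basis_vec K n).

Definition invariant_sym2 (s : 'M[K]_n) : Prop :=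
  s^T = s /\
  forall x : g, \sum_i \sum_j s i j *:
    (tens2 (br x (e_ i)) (e_ j) + tens2 (e_ i) (br x (e_ j))) = 0.

Definition wedge2_elt (L : 'M[K]_n) : Prop := L^T = - L.

Definition schouten_decomposable (x1 x2 y1 y2 : g) :
    {ffun 'I_n * 'I_n * 'I_n -> K} :=
  wedge3 (br x1 y1) x2 y2 - wedge3 (br x1 y2) x2 y1
  - wedge3 (br x2 y1) x1 y2 + wedge3 (br x2 y2) x1 y1.

(* bilinear extension to elements of the second exterior power, which are
   A = \sum_(i < j) A i j e_i /\ e_j *)
Definition schouten2 (A B : 'M[K]_n) : {ffun 'I_n * 'I_n * 'I_n -> K} :=
  [ffun p =>
    \sum_(i < n) \sum_(j < n | (i < j)%N) \sum_(k < n) \sum_(l < n | (k < l)%N)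
      A i j * B k l * schouten_decomposable (e_ i) (e_ j) (e_ k) (e_ l) p].

(* covectors are row vectors in the dual basis *)
Definition sharp (s : 'M[K]_n) (xi : 'rV[K]_n) : g := xi *m s.

Definition phi (s : 'M[K]_n) : {ffun 'I_n * 'I_n * 'I_n -> K} :=
  [ffun p => 2%:R * br (sharp s (e_ p.1.2)) (sharp s (e_ p.2)) 0 p.1.1].

(* s + L is a quasitriangular r-matrix *)
Definition quasitriangular (s L : 'M[K]_n) : Prop :=
  [/\ invariant_sym2 s, wedge2_elt L & schouten2 L L + phi s = 0].
End rmatrix.

Section powers.
Variables (K : fieldType) (n : nat).
Notation g := 'rV[K]_n.
Notation e_ := (@basis_vec K n).

(* For a finite set S, an element t of g^S (x) g^S is given by its components
   t (a, b) in g (x) g, for a, b in S. *)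
Notation tens2S S := {ffun S * S -> 'M[K]_n}.

Definition tens2_pow (S : finType) (a b : {ffun S -> g}) : tens2S S :=
  [ffun p => tens2 (a p.1) (b p.2)].

Definition wedge_pow (S : finType) (a b : {ffun S -> g}) : tens2S S :=
  tens2_pow a b - tens2_pow b a.

Definition inj1 (S : finType) (j : S) (x : g) : {ffun S -> g} :=
  [ffun a => if a == j then x else 0].

Definition inj2 (S : finType) (j : S) (t : 'M[K]_n) : tens2S S :=
  [ffun p => if p == (j, j) then t else 0].

(* the map induced by g^S -> g^S', (x)_j |-> (x)_(h j) *)
Definition reindex_tens2 (S S' : finType) (h : S -> S') (t : tens2S S) :
    tens2S S' :=
  [ffun p => \sum_(q | (h q.1, h q.2) == p) t q].

Definition Mix (m : nat) (r : 'M[K]_n) : tens2S 'I_m :=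
  \sum_(j < m) \sum_(k < m | (j < k)%N) \sum_p \sum_q
    r p q *: wedge_pow (inj1 j (e_ q)) (inj1 k (e_ p)).

(* the sign of j is (-1) ^+ eps j *)
Definition r_pow (m : nat) (eps : 'I_m -> bool) (s L : 'M[K]_n) :
    tens2S 'I_m :=
  \sum_j (inj2 j ((-1) ^+ eps j *: s) + inj2 j L) - Mix m (s + L).
End powers.

Section marked_surface.
Variable (R : realType).
Notation K := (Cplx R).
Variable S : borderedRiemannSurfaceType R.

Definition boundary : set S :=
  [set p | exists2 c : chart S (closed_half_plane R),
     atlas c & chart_dom c p /\ complex.Im (c p) = 0].

Definition marked_surface (V : {fset S}) : Prop :=
  [/\ compact [set: S], V != fset0 & [set` V] `<=` boundary].

Section half_edges.
Variables (edge : finType) (arc : edge -> R -> S).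

(* (e, false) is the source half edge of e and (e, true) its end half edge *)
Definition half_edge_arc (a : edge * bool) (t : R) : S :=
  arc a.1 (if a.2 then 1 - t else t).

Definition first_exit (c : chart S (closed_half_plane R)) (v : S)
    (a : edge * bool) (eps t : R) : Prop :=
  [/\ 0 < t <= 1,
      forall u, 0 <= u <= t -> chart_dom c (half_edge_arc a u),
      complex.Re `|c (half_edge_arc a t) - c v| = eps &
      forall u, 0 <= u < t ->
        complex.Re `|c (half_edge_arc a u) - c v| < eps].

(* In a chart at the boundary point v with values in the closed upper half
   plane, the boundary arc leaving v is on the positive side of v and the one
   arriving at v on the negative side. For all small eps > 0 each half edge at v
   first leaves the half disc of radius eps at a well-defined point, and the
   counterclockwise order is the order of decreasing real parts of those
   points on the half circle. *)
Definition half_edge_lt (v : S) (a b : edge * bool) : Prop :=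
  \forall eps \near (0 : R)^'+, forall t u,
    first_exit (chart_at v) v a eps t -> first_exit (chart_at v) v b eps u ->
    complex.Re (chart_at v (half_edge_arc b u))
      < complex.Re (chart_at v (half_edge_arc a t)).

Definition graph_support (V : {fset S}) : set S :=
  [set` V] `|` [set p | exists e, exists2 t : R, 0 <= t <= 1 & arc e t = p].
End half_edges.

(* An oriented skeleton, with the counterclockwise enumeration of the half
   edges at each vertex; the latter is determined by the other data. *)
Record skeleton (V : {fset S}) := Skeleton {
  edge : finType;
  source : edge -> V;
  target : edge -> V;
  arc : edge -> R -> S;
  arc_continuous : forall e, {within `[0, 1], continuous (arc e)};
  arc0 : forall e, arc e 0 = val (source e);
  arc1 : forall e, arc e 1 = val (target e);
  arc_avoids_vertices :
    forall e (t : R), 0 < t < 1 -> arc e t \notin V;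
  arc_injective : forall e e' (t t' : R), 0 < t < 1 -> 0 < t' < 1 ->
    arc e t = arc e' t' -> e = e' /\ t = t';
  skeleton_retract : exists H : S * R -> S,
    [/\ {within [set p | 0 <= p.2 <= 1], continuous H},
        forall p, H (p, 0) = p,
        forall p, graph_support arc V (H (p, 1)) &
        forall p t, 0 <= t <= 1 -> graph_support arc V p -> H (p, t) = p];
  half_edges_at : V -> seq (edge * bool);
  half_edges_at_uniq : forall v, uniq (half_edges_at v);
  mem_half_edges_at : forall v (a : edge * bool),
    (a \in half_edges_at v) = ((if a.2 then target a.1 else source a.1) == v);
  half_edges_at_sorted : forall v : V,
    pairwise (fun a b => `[< half_edge_lt arc (val v) a b >])
      (half_edges_at v) }.
End marked_surface.

(* The right action of G^(Gamma_1/2) on G^(Gamma_1), for the set E = Gamma_1 of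
   edges, and the induced action of the Lie algebra. *)
Section action.
Variables (R : realType) (n : nat) (G : complexLieGroupType R n).
Variable (E : finType).
Variable expG : tangent (1%g : G) -> G.
Notation K := (Cplx R).
Notation H := (E * bool)%type.

Definition sigma_group (a : {ptws E -> G}) (h : H -> G) : {ptws E -> G} :=
  fun e => ((h (e, false))^-1 * a e * h (e, true))%g.

Definition sigma_field (x : {ffun H -> 'rV[K]_n}) :
    vector_field {ptws E -> G} :=
  fun a => velocity a
    (fun t : K => sigma_group a (fun b => expG (t *: x b))).

Definition sigma_tensor (r : {ffun H * H -> 'M[K]_n}) :
    tensor2_field {ptws E -> G} :=
  fun a => \sum_p \sum_i \sum_j r p i j *:
    tens2 (sigma_field (inj1 p.1 (basis_vec K i)) a)
          (sigma_field (inj1 p.2 (basis_vec K j)) a).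
End action.

Definition r_Gamma (R : realType) (n : nat) (S : borderedRiemannSurfaceType R)
    (V : {fset S}) (Gamma : skeleton V) (s : 'M[Cplx R]_n)
    (L : V -> 'M[Cplx R]_n) :
    {ffun (edge Gamma * bool) * (edge Gamma * bool) -> 'M[Cplx R]_n} :=
  \sum_(v : V)
    let h := tnth (in_tuple (half_edges_at Gamma v)) in
    reindex_tens2 h (r_pow (fun i => (h i).2) s (L v)).

(* Main.v *)
Require Import Defs.
From HB Require Import structures.
From mathcomp Require Import all_boot all_order all_algebra.
From mathcomp Require Import finmap.
From mathcomp Require Import all_classical all_reals all_analysis.
From mathcomp Require Import complex ring lra zify.
Import numFieldNormedType.Exports.

Set Implicit Arguments.
Unset Strict Implicit.
Unset Printing Implicit Defensive.

Import Order.TTheory GRing.Theory Num.Theory.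
Local Open Scope ring_scope.
Local Open Scope classical_set_scope.

(** Each half edge carries a copy of the Lie algebra, acting on the factor of
    its edge by right translations if it is an end half edge, and by inverse
    left translations if it is a source half edge. So pi is the contraction of
    the tensor r_Gamma with the fundamental fields of these copies. Three facts
    make it a Poisson structure.

    The fields of one copy bracket as the Lie algebra does, and the fields of
    distinct copies commute (edge_field_bracket). Inside one factor of the group
    this says that left and minus right invariant fields have the same structure
    constants, which holds because orbit maps relate both to left invariant
    fields (fund_bracket), and that left and right translations commute, which
    yields commuting fields by the symmetry of second derivatives
    (fund_commute, schwarz).

    Write r_Gamma = A + B with A skew and B the diagonal tensor with entries s
    at source half edges and - s at end half edges (r_Gamma_entry). Then B
    contributes nothing to pi. Indeed an edge contributes the difference of the
    right invariant and the left invariant tensor fields generated by s. The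
    coefficients of one of them in a frame of the other kind are locally
    constant by invariance of s, and both tensors agree at the identity, so
    they agree on the connected group (inv_tensor_eq, sym_tensor_zero). Hence
    pi is the contraction of A, and a bivector field.

    For a skew tensor A, the Schouten bracket of its contraction is twice the
    contraction of the cyclic sum of [A_12, A_23] (cyclic_contraction_zero).
    This sum has nonzero components only on triples (a, b, c) of half edges at
    a common vertex v, where the components of A are
    Lambda_v + sigma_ab s with sigma_ab the sign that compares the positions of
    a and b. The Yang-Baxter equation for s + Lambda_v turns it into
    (1 + sigma_ab sigma_bc + sigma_bc sigma_ca + sigma_ca sigma_ab) [s_12, s_23]
    (yang_baxter_signs). As positions are linearly ordered, the coefficient is 1
    if a = b = c and 0 otherwise (order_sign_transitive). So the cyclic sum is
    [B_12, B_23] (mixed_yang_baxter), whose contraction with the fields vanishes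
    since the one of B does (contracted12_23_symmetric). *)

(** * The mean value inequality over the complex numbers *)

Section complex_mean_value.
Variable R : realType.
Notation K := (Cplx R).
Notation toC := (@real_complex_def _ (Phant R)).

Lemma toCD (x y : R) : toC (x + y) = toC x + toC y :> K.
Proof. by apply/eqP; rewrite eq_complex/= addr0 !eqxx. Qed.

Lemma cplx_gt0E (e : K) : 0 < e -> 0 < complex.Re e /\ toC (complex.Re e) = e.
Proof.
by case: e => a b; rewrite ltcE/= => /andP[/eqP-> a0].
Qed.

Lemma is_derive_real_part (rho : K -> R) (f : K -> K) (t : R) :
    (forall x y, rho (x - y) = rho x - rho y) ->
    (forall (a : R) x, rho (toC a * x) = a * rho x) ->
    (forall x, toC `|rho x| <= `|x|) ->
    derivable f (toC t) 1 ->
  is_derive t 1 (fun u : R => rho (f (toC u))) (rho ('D_1 f (toC t))).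
Proof.
move=> rhoB rhoZ rho_le df.
suff h : (fun h : R => h^-1 *: (((fun u : R => rho (f (toC u))) \o shift t) (h *: 1)
   - rho (f (toC t)))) @ 0^' --> rho ('D_1 f (toC t)).
  by apply: DeriveDef; [apply/cvg_ex; eexists; exact: h|exact: cvg_lim h].
apply/cvgrPdist_lt => e e0.
have /cvgrPdist_lt/(_ (toC e)) := df.
rewrite ltcR => /(_ e0); rewrite /dnbhs /within /= => /nbhs_ballP[d /= /cplx_gt0E[d0 <-]] hd.
apply/nbhs_ballP; exists (complex.Re d) => //= u; rewrite /ball/= sub0r normrN => ud u0.
have {hd} := hd (toC u).
rewrite /ball /= sub0r normrN.
have -> : `|toC u| = toC `|u| by rewrite normc_def/= expr0n/= addr0 sqrtr_sqr.
rewrite ltcR => /(_ ud).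
have -> : toC u != 0 by apply: contra_neq u0 => /(@complexI R).
move=> /(_ isT) hlt.
rewrite -ltcR; apply: le_lt_trans hlt.
apply: le_trans (rho_le _).
rewrite lecR rhoB le_eqVlt; apply/orP; left; apply/eqP; congr `|_ - _|.
have -> : (toC u)^-1 = toC u^-1 by rewrite -fmorphV.
rewrite rhoZ rhoB /= (_ : (toC u)%:A = toC u); last exact: mulr1.
rewrite (_ : u%:A = u); last exact: mulr1.
by rewrite toCD.
Qed.

Lemma norm_toC (x : R) : `|toC x| = toC `|x| :> K.
Proof. by rewrite normc_def/= expr0n/= addr0 sqrtr_sqr. Qed.

Lemma normi1 : `|'i%C : K| = 1.
Proof. by rewrite normc_def/= expr0n expr1n add0r sqrtr1. Qed.

Lemma normRe_le (z : K) : toC `|complex.Re z| <= `|z|.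
Proof. exact: normc_ge_Re. Qed.

Lemma normIm_le (z : K) : toC `|complex.Im z| <= `|z|.
Proof.
have := normc_ge_Re (z * 'i%C).
by rewrite ReiNIm normrN normrM normi1 mulr1.
Qed.

Lemma norm_le_ReIm (z : K) : `|z| <= toC `|complex.Re z| + toC `|complex.Im z|.
Proof.
rewrite {1}[z]complexE; apply: le_trans (ler_normD _ _) _.
by rewrite normrM normi1 mul1r !norm_toC.
Qed.

(** Real and imaginary parts each satisfy the real mean value theorem, at
    different points; this costs the factor 2. *)
Lemma mean_value_le (f : K -> K) (a eps : K) :
    (forall t : R, 0 <= t <= 1 -> derivable f (toC t) 1) ->
    (forall t : R, 0 <= t <= 1 -> `|'D_1 f (toC t) - a| <= eps) ->
  `|f 1 - f 0 - a| <= eps *+ 2.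
Proof.
move=> df hf.
have main (rho : K -> R) : 
    (forall x y, rho (x - y) = rho x - rho y) ->
    (forall (b : R) x, rho (toC b * x) = b * rho x) ->
    (forall x, toC `|rho x| <= `|x|) ->
    toC `|rho (f 1 - f 0 - a)| <= eps.
  move=> rhoB rhoZ rho_le.
  have dr (t : R) : 0 <= t <= 1 ->
      is_derive t 1 (fun u : R => rho (f (toC u))) (rho ('D_1 f (toC t))).
    by move=> t01; apply: is_derive_real_part => //; exact: df.
  have [t||c] := @MVT_segment R (fun u : R => rho (f (toC u)))
     (fun u => rho ('D_1 f (toC u))) 0 1 ler01.
  - by move=> ct; apply: dr; move: ct; rewrite in_itv/= => /andP[/ltW -> /ltW ->].
  - apply: derivable_within_continuous => t; rewrite in_itv/= => t01.
    by have [] := dr t t01.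
  rewrite in_itv/= subr0 mulr1 => c01 fE.
  rewrite rhoB rhoB fE -rhoB.
  exact: le_trans (rho_le _) (hf c c01).
apply: le_trans (norm_le_ReIm _) _.
rewrite mulr2n; apply: lerD.
  apply: (main (@complex.Re R)); last exact: normRe_le.
    by move=> [? ?] [? ?].
  by move=> b [? ?] /=; rewrite mul0r subr0.
apply: (main (@complex.Im R)); last exact: normIm_le.
  by move=> [? ?] [? ?].
by move=> b [? ?] /=; rewrite mul0r addr0.
Qed.

End complex_mean_value.

(** * Germs of holomorphic maps *)

Section hol_basics.
Variables (K : numFieldType).
Implicit Types (E F G : normedModType K).

(** Holomorphy of the germ of f at x. Asking for derivatives of all orders on a
    whole neighbourhood makes it an open condition that passes to derivatives. *)
Definition hol E F (f : E -> F) (x : E) : Prop :=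
  \forall y \near x, forall k, holomorphic_upto k f [set y].

(** Derivatives refer to neighbourhoods in the ambient space, so the condition
    can be tested one point at a time. *)
Lemma holomorphic_uptoP E F k (f : E -> F) (U : set E) :
  holomorphic_upto k f U <-> forall x, U x -> holomorphic_upto k f [set x].
Proof.
split=> [h x Ux|]; first by apply: holomorphic_upto_sub h => _ ->.
elim: k f => [|k IH] f /= h; first by move=> x /h; exact.
split=> [x /h[+ _]|v]; first exact.
by apply: IH => x /h[_]; exact.
Qed.

Lemma holP E F (f : E -> F) x :
  hol f x <-> exists U, [/\ open U, U x & forall k, holomorphic_upto k f U].
Proof.
split=> [|[U [oU Ux h]]]; last first.
  have := open_nbhs_nbhs (conj oU Ux); apply: filterS => y Uy k.
  by have /holomorphic_uptoP := h k; exact.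
rewrite /hol /prop_near1 nbhsE => -[U [oU Ux] h]; exists U; split=> // k.
by apply/holomorphic_uptoP => y /h.
Qed.

Lemma holomorphicP E F (f : E -> F) (U : set E) :
  holomorphic f U <-> open U /\ forall x, U x -> hol f x.
Proof.
split=> [[oU h]|[oU h]]; split=> //.
  by move=> x Ux; apply/holP; exists U.
move=> k; apply/holomorphic_uptoP => x /h /nbhs_singleton; exact.
Qed.

Lemma hol_near E F (f : E -> F) x : hol f x -> \forall y \near x, hol f y.
Proof.
move=> /holP[U [oU Ux h]]; have := open_nbhs_nbhs (conj oU Ux).
by apply: filterS => y Uy; apply/holP; exists U.
Qed.

Lemma hol_differentiable E F (f : E -> F) x : hol f x -> differentiable f x.
Proof. by move=> /nbhs_singleton/(_ 1%N)[/(_ x erefl)]. Qed.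

Lemma hol_continuous E F (f : E -> F) x : hol f x -> {for x, continuous f}.
Proof. by move=> /hol_differentiable/differentiable_continuous. Qed.

Lemma hol_derivable E F (f : E -> F) x v : hol f x -> derivable f x v.
Proof. by move=> /hol_differentiable/diff_derivable. Qed.
Arguments hol_derivable {E F f x} v _.

Lemma hol_derive E F (f : E -> F) x v : hol f x -> hol (fun y => 'D_v f y) x.
Proof. by apply: filterS => y h k; have [_] := h k.+1; exact. Qed.

Lemma hol_ext E F (f g : E -> F) x : {near x, f =1 g} -> hol f x -> hol g x.
Proof.
move=> fg hf.
have : \forall y \near x, f y = g y /\ (forall k, holomorphic_upto k f [set y]).
  by near=> y; split; near: y.
rewrite /prop_near1 nbhsE => -[U [oU Ux] h]; apply/holP; exists U; split=> // k.
apply: (@holomorphic_upto_ext _ _ _ k f) => // [y /h[]//|].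
by apply/holomorphic_uptoP => y /h[_]; exact.
Unshelve. all: by end_near. Qed.

Lemma holomorphic_uptoW E F k (f : E -> F) (U : set E) :
  holomorphic_upto k.+1 f U -> holomorphic_upto k f U.
Proof.
elim: k f => [|k IH] f.
  by move=> [df _] x Ux; apply: differentiable_continuous; exact: df.
by move=> [df Df]; split=> // v; apply: IH; exact: Df.
Qed.

Lemma derive_linear E F (L : {linear E -> F}) : continuous L ->
  forall x v, 'D_v L x = L v.
Proof.
by move=> cL x v; rewrite deriveE ?diff_lin//; exact: linear_differentiable.
Qed.

Lemma hol_cst E F (a : F) x : hol (fun=> a : F) (x : E).
Proof.
apply/holP; exists setT; split=> //; first exact: openT.
move=> k; elim: k a => [|k IH] a /=; first by move=> y _; exact: cvg_cst.
split=> [y _|v]; first exact: differentiable_cst.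
rewrite (_ : (fun y => 'D_v (fun=> a) y) = fun=> 0); first exact: IH.
by apply/funext => y; exact: derive_cst.
Qed.

Lemma hol_linear E F (L : {linear E -> F}) x : continuous L -> hol L x.
Proof.
move=> cL; apply/holP; exists setT; split=> //; first exact: openT.
case=> [|k]; first by move=> y _; exact: cL.
split=> [y _|v]; first exact: linear_differentiable.
rewrite (_ : (fun y => 'D_v L y) = fun=> L v); last by apply/funext => y; exact: derive_linear.
by apply/holomorphic_uptoP => y _; have /nbhs_singleton := hol_cst (L v) y; exact.
Qed.

Lemma hol_lcomp E F G (L : {linear F -> G}) (f : E -> F) x : continuous L ->
  hol f x -> hol (fun y => L (f y)) x.
Proof.
move=> cL /holP[U [oU Ux h]]; apply/holP; exists U; split=> // k.
pose I : {linear E -> E} := idfun.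
have cI : continuous I by move=> y; exact: cvg_id.
by have := holomorphic_upto_linear cI cL oU (h k); rewrite preimage_id.
Qed.

Lemma hol_sum E F (I : finType) (f : I -> E -> F) x :
  (forall i, hol (f i) x) -> hol (fun y => \sum_i f i y) x.
Proof.
move=> hf.
have : \forall y \near x, forall i, hol (f i) y.
  by apply: filter_forall => i; apply: hol_near.
rewrite /prop_near1 nbhsE => -[U [oU Ux] h]; apply/holP; exists U; split=> // k.
have -> : (fun y => \sum_i f i y) = \sum_(i < #|I|) f (enum_val i).
  by apply/funext => y; rewrite fct_sumE (reindex_onto enum_val enum_rank) /=;
    [apply: eq_bigl => i; rewrite enum_valK eqxx|move=> i _; rewrite enum_rankK].
apply: holomorphic_upto_sum => // i; apply/holomorphic_uptoP => y Uy.
by have /nbhs_singleton := h y Uy (enum_val i); exact.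
Qed.

Lemma hol_add E F (f g : E -> F) x :
  hol f x -> hol g x -> hol (fun y => f y + g y) x.
Proof.
move=> hf hg.
have -> : (fun y => f y + g y) = (fun y => \sum_b (if b : bool then f y else g y)).
  by apply/funext => y; rewrite big_bool.
by apply: (@hol_sum _ _ bool (fun b y => if b then f y else g y)) => -[].
Qed.

Lemma hol_scalel E F (f : E -> K) (a : F) x :
  hol f x -> hol (fun y => f y *: a) x.
Proof.
have lin : linear (fun z : K => z *: a) by move=> b u v; rewrite scalerDl scalerA.
pose LM := GRing.isLinear.Build K K F _ _ lin.
pose L : {linear K -> F} := HB.pack (fun z : K => z *: a) LM.
have cL : continuous L by move=> z; exact: scalel_continuous.
exact: (@hol_lcomp _ _ _ L).
Qed.

Lemma holomorphic_upto_mul E k (f g : E -> K) (U : set E) : open U ->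
  holomorphic_upto k f U -> holomorphic_upto k g U ->
  holomorphic_upto k (fun y => f y * g y) U.
Proof.
move=> oU; elim: k f g => [|k IH] f g /= hf hg.
  by move=> y Uy; apply: cvgM; [exact: hf|exact: hg].
split=> [y Uy|v]; first by apply: differentiableM; [exact: hf.1|exact: hg.1].
apply: (@holomorphic_upto_ext _ _ _ k (fun y => f y * 'D_v g y + g y * 'D_v f y)) => //.
  move=> y Uy; rewrite (@deriveM _ _ f g)//; apply: diff_derivable; [exact: hf.1|exact: hg.1].
have hfk : holomorphic_upto k f U by apply: holomorphic_uptoW.
have hgk : holomorphic_upto k g U by apply: holomorphic_uptoW.
have -> : (fun y => f y * 'D_v g y + g y * 'D_v f y) =
  \sum_(i < 2) (if i == 0 then fun y => f y * 'D_v g y else fun y => g y * 'D_v f y).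
  by apply/funext => y; rewrite fct_sumE big_ord_recl big_ord1.
apply: holomorphic_upto_sum => // i; case: ifP => _; apply: IH => //.
- exact: hg.2.
- exact: hf.2.
Qed.

Lemma hol_mul E (f g : E -> K) x :
  hol f x -> hol g x -> hol (fun y => f y * g y) x.
Proof.
move=> hf hg.
have : \forall y \near x, hol f y /\ hol g y.
  by near=> y; split; near: y; exact: hol_near.
rewrite /prop_near1 nbhsE => -[U [oU Ux] h]; apply/holP; exists U; split=> // k.
by apply: holomorphic_upto_mul => //; apply/holomorphic_uptoP => y /h[
  /nbhs_singleton h1 /nbhs_singleton h2].
Unshelve. all: by end_near. Qed.

End hol_basics.
Arguments hol_derivable {K E F f x} v _.

(** * Composition of holomorphic maps *)

Section coordinates.
Variables (K : numFieldType).
Implicit Types (D E F G : normedModType K).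

(** Finite dimension, as a spanning family with continuous coordinates: this is
    the form in which vector-valued statements reduce to scalar ones. *)
Definition findim E : Prop :=
  exists (I : finType) (e : I -> E) (l : I -> {linear E -> K}),
    (forall i, continuous (l i)) /\ forall v, v = \sum_i l i v *: e i.

Lemma findim_K : findim K.
Proof.
pose I : {linear K -> K} := idfun.
exists unit, (fun=> 1), (fun=> I); split=> [_ x|v]; first exact: cvg_id.
by rewrite (big_pred1 tt)/= => [|[]//]; rewrite [_ *: _]mulr1.
Qed.

Lemma mx_entry_linear m n i j : exists l : {linear 'M[K]_(m, n) -> K},
  (forall A, l A = A i j) /\ continuous l.
Proof.
have lin : linear (fun A : 'M[K]_(m, n) => A i j) by move=> a u v; rewrite !mxE.
pose LM := GRing.isLinear.Build K _ K _ _ lin.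
pose L : {linear _ -> _} := HB.pack (fun A : 'M[K]_(m, n) => A i j) LM.
by exists L; split=> // A; exact: (@coord_continuous K m n i j A).
Qed.

Lemma findim_mx m n : findim 'M[K]_(m, n).
Proof.
have /choice[l hl] (p : 'I_m * 'I_n) := mx_entry_linear p.1 p.2.
exists ('I_m * 'I_n)%type, (fun p => delta_mx p.1 p.2), l; split=> [p|v].
  by have [] := hl p.
rewrite {1}[v]matrix_sum_delta pair_big; apply: eq_bigr => p _.
by have [-> _] := hl p.
Qed.

Lemma pairl_linear E F : exists l : {linear E -> (E * F)%type},
  (forall v, l v = (v, 0)) /\ continuous l.
Proof.
have lin : linear (fun v : E => (v, 0 : F)).
  by move=> a u v; congr pair; rewrite /= scaler0 addr0.
pose LM := GRing.isLinear.Build K _ (E * F)%type _ _ lin.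
pose L : {linear _ -> _} := HB.pack (fun v : E => (v, 0 : F)) LM.
by exists L; split=> // v; apply: cvg_pair; [exact: cvg_id|exact: cvg_cst].
Qed.

Lemma pairr_linear E F : exists l : {linear F -> (E * F)%type},
  (forall v, l v = (0, v)) /\ continuous l.
Proof.
have lin : linear (fun v : F => (0 : E, v)).
  by move=> a u v; congr pair; rewrite /= scaler0 addr0.
pose LM := GRing.isLinear.Build K _ (E * F)%type _ _ lin.
pose L : {linear _ -> _} := HB.pack (fun v : F => (0 : E, v)) LM.
by exists L; split=> // v; apply: cvg_pair; [exact: cvg_cst|exact: cvg_id].
Qed.

Lemma comp_linear E F G (f : {linear E -> F}) (g : {linear F -> G}) :
  continuous f -> continuous g ->
  exists l : {linear E -> G}, (forall v, l v = g (f v)) /\ continuous l.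
Proof.
move=> cf cg; pose L : {linear E -> G} := g \o f.
by exists L; split=> // v; apply: continuous_comp; [exact: cf|exact: cg].
Qed.

Lemma fst_linear E F : exists l : {linear (E * F)%type -> E},
  (forall v, l v = v.1) /\ continuous l.
Proof.
pose L : {linear (E * F)%type -> E} := @fst E F.
by exists L; split=> // v; exact: cvg_fst.
Qed.

Lemma snd_linear E F : exists l : {linear (E * F)%type -> F},
  (forall v, l v = v.2) /\ continuous l.
Proof.
pose L : {linear (E * F)%type -> F} := @snd E F.
by exists L; split=> // v; exact: cvg_snd.
Qed.

Lemma findim_prod E F : findim E -> findim F -> findim (E * F)%type.
Proof.
move=> [I [e [l [cl hl]]]] [J [f [m [cm hm]]]].
have [p1 [p1E cp1]] := fst_linear E F; have [p2 [p2E cp2]] := snd_linear E F.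
have /choice[l' hl'] i := comp_linear cp1 (cl i).
have /choice[m' hm'] j := comp_linear cp2 (cm j).
exists (I + J)%type, (fun k => match k with inl i => (e i, 0) | inr j => (0, f j) end),
  (fun k => match k with inl i => l' i | inr j => m' j end).
split=> [[i|j]|[v w]]; [by have [] := hl' i|by have [] := hm' j|].
rewrite big_sumType /=.
rewrite (eq_bigr (fun i => (l i v *: e i, 0 : F))); last first.
  by move=> i _; have [-> _] := hl' i; rewrite p1E/=; congr pair; rewrite /= scaler0.
rewrite [X in _ + X](eq_bigr (fun j => (0 : E, m j w *: f j))); last first.
  by move=> j _; have [-> _] := hm' j; rewrite p2E/=; congr pair; rewrite /= scaler0.
have [q1 [q1E _]] := pairl_linear E F; have [q2 [q2E _]] := pairr_linear E F.
under eq_bigr do rewrite -q1E.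
under [X in _ + X]eq_bigr do rewrite -q2E.
by rewrite -!linear_sum q1E q2E -hl -hm; congr pair; rewrite /= ?addr0 ?add0r.
Qed.

Lemma derive_lcomp E F G (L : {linear F -> G}) (f : E -> F) x v :
  continuous L -> derivable f x v -> 'D_v (fun y => L (f y)) x = L ('D_v f x).
Proof.
move=> cL df; apply: cvg_lim => //.
have -> : (fun h => h^-1 *: (((fun y => L (f y)) \o shift x) (h *: v) - L (f x))) =
  (fun h => L (h^-1 *: ((f \o shift x) (h *: v) - f x))).
  by apply/funext => h; rewrite /= [RHS]linearZ/= [X in _ = _ *: X]linearB.
exact: (cvg_comp _ _ df (cL _)).
Qed.

Lemma hol_coords E F x (f : E -> F) : findim F ->
  (forall l : {linear F -> K}, continuous l -> hol (fun y => l (f y)) x) -> hol f x.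
Proof.
move=> [I [e [l [cl hl]]]] h.
have -> : f = fun y => \sum_i l i (f y) *: e i by apply/funext => y; rewrite -hl.
by apply: hol_sum => i; apply: hol_scalel; exact: h.
Qed.

Lemma derive_comp_coords D E F (I : finType) (e : I -> E)
    (l : I -> {linear E -> K}) (f : E -> F) (g : D -> E) x v :
  (forall u, u = \sum_i l i u *: e i) -> differentiable g x ->
  differentiable f (g x) ->
  'D_v (fun y => f (g y)) x = \sum_i l i ('D_v g x) *: 'D_(e i) f (g x).
Proof.
move=> hl dg df; rewrite deriveE; last exact: differentiable_comp.
rewrite diff_comp// /= -[X in 'd f _ X]deriveE// [X in 'd f _ X]hl linear_sum.
by apply: eq_bigr => i _; rewrite linearZ/= !deriveE.
Qed.

(** Induction on the order of differentiation, for all f at once: by the chain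
    rule a derivative of f \o g is a sum of products of a derivative of g with
    the composition of a derivative of f with g. *)
Lemma hol_comp_scalar D E (f : E -> K) (g : D -> E) x : findim E ->
  hol g x -> hol f (g x) -> hol (fun y => f (g y)) x.
Proof.
move=> [I [e [l [cl hl]]]] hg hf.
have : \forall y \near x, hol g y /\ hol f (g y).
  have hf' : \forall y \near x, hol f (g y) by exact: (hol_continuous hg (hol_near hf)).
  by have hg' := hol_near hg; near=> y; split; near: y.
rewrite /prop_near1 nbhsE => -[U [oU Ux] h]; apply/holP; exists U; split=> // k.
have {h} : (forall y, U y -> hol g y) /\ (forall y, U y -> hol f (g y)).
  by split=> y /h[].
case=> hgU; elim: k f {hf} => [|k IH] f hfU.
  move=> y Uy; apply: continuous_comp; first exact: hol_continuous (hgU y Uy).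
  exact: hol_continuous (hfU y Uy).
split=> [y Uy|v].
  apply: differentiable_comp; first exact: hol_differentiable (hgU y Uy).
  exact: hol_differentiable (hfU y Uy).
apply: (@holomorphic_upto_ext _ _ _ k
  (fun y => \sum_i l i ('D_v g y) * 'D_(e i) f (g y))) => //.
  move=> y Uy; rewrite (derive_comp_coords _ hl)//.
    exact: hol_differentiable (hgU y Uy).
  exact: hol_differentiable (hfU y Uy).
have -> : (fun y => \sum_i l i ('D_v g y) * 'D_(e i) f (g y)) =
    \sum_(j < #|I|) (fun y => l (enum_val j) ('D_v g y) * 'D_(e (enum_val j)) f (g y)).
  by apply/funext => y; rewrite fct_sumE (reindex_onto enum_val enum_rank) /=;
    [apply: eq_bigl => i; rewrite enum_valK eqxx|move=> i _; rewrite enum_rankK].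
apply: holomorphic_upto_sum => // j; apply: holomorphic_upto_mul => //.
  apply/holomorphic_uptoP => y Uy.
  have : hol (fun z => l (enum_val j) ('D_v g z)) y.
    exact: (hol_lcomp (cl _) (hol_derive v (hgU y Uy))).
  by move=> /nbhs_singleton; exact.
by apply: (IH (fun z => 'D_(e (enum_val j)) f z)) => y Uy; apply: hol_derive; exact: hfU.
Unshelve. all: by end_near. Qed.

Lemma hol_comp D E F (f : E -> F) (g : D -> E) x : findim E -> findim F ->
  hol g x -> hol f (g x) -> hol (fun y => f (g y)) x.
Proof.
move=> fE fF hg hf; apply: hol_coords => // l cl.
exact: (@hol_comp_scalar _ _ (fun y => l (f y)) g x fE hg (hol_lcomp cl hf)).
Qed.

Lemma hol_id E (x : E) : hol (fun y => y) x.
Proof.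
pose I : {linear E -> E} := idfun.
by apply: (@hol_linear _ _ _ I) => y; exact: cvg_id.
Qed.

Lemma hol_pair D E F (f : D -> E) (g : D -> F) x :
  hol f x -> hol g x -> hol (fun y => (f y, g y)) x.
Proof.
move=> hf hg; have [p [pE cp]] := pairl_linear E F.
have [q [qE cq]] := pairr_linear E F.
have -> : (fun y => (f y, g y)) = (fun y => p (f y) + q (g y)).
  by apply/funext => y; rewrite pE qE; congr pair; rewrite /= ?addr0 ?add0r.
by apply: hol_add; apply: hol_lcomp.
Qed.

Lemma hol_fst E F (x : E * F) : hol fst x.
Proof.
have [p [pE cp]] := fst_linear E F.
by rewrite (_ : fst = p); [exact: hol_linear|apply/funext => v; rewrite pE].
Qed.

Lemma hol_snd E F (x : E * F) : hol snd x.
Proof.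
have [p [pE cp]] := snd_linear E F.
by rewrite (_ : snd = p); [exact: hol_linear|apply/funext => v; rewrite pE].
Qed.
End coordinates.

(** * Calculus of matrix-valued maps *)

Section matrix_calculus.
Variables (K : numFieldType) (E : normedModType K).

Lemma hol_entry m n (A : E -> 'M[K]_(m, n)) x i j :
  hol A x -> hol (fun y => A y i j) x.
Proof.
move=> hA; have [l [lE cl]] := mx_entry_linear K i j.
rewrite (_ : (fun y => A y i j) = (fun y => l (A y))); first exact: hol_lcomp.
by apply/funext => y; rewrite lE.
Qed.

Lemma hol_matrix m n (f : 'I_m -> 'I_n -> E -> K) x :
  (forall i j, hol (f i j) x) -> hol (fun y => \matrix_(i, j) f i j y) x.
Proof.
move=> hf; rewrite (_ : (fun y => \matrix_(i, j) f i j y) =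
   (fun y => \sum_(p : 'I_m * 'I_n) f p.1 p.2 y *: delta_mx p.1 p.2)).
  by apply: hol_sum => p; apply: hol_scalel.
apply/funext => y; rewrite [LHS]matrix_sum_delta pair_big.
by apply: eq_bigr => p _; rewrite mxE.
Qed.

Lemma hol_mulmx m n p (A : E -> 'M[K]_(m, n)) (B : E -> 'M[K]_(n, p)) x :
  hol A x -> hol B x -> hol (fun y => A y *m B y) x.
Proof.
move=> hA hB.
rewrite (_ : (fun y => A y *m B y) =
  (fun y => \matrix_(i, k) \sum_j A y i j * B y j k)); last first.
  by apply/funext => y; apply/matrixP => i k; rewrite !mxE.
apply: (@hol_matrix _ _ (fun i k y => \sum_j A y i j * B y j k)) => i k.
by apply: hol_sum => j; apply: hol_mul; exact: hol_entry.
Qed.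

Lemma hol_trmx m n (A : E -> 'M[K]_(m, n)) x :
  hol A x -> hol (fun y => (A y)^T) x.
Proof.
move=> hA; rewrite (_ : (fun y => (A y)^T) = (fun y => \matrix_(i, j) A y j i)).
  by apply: (@hol_matrix _ _ (fun i j y => A y j i)) => i j; exact: hol_entry.
by apply/funext => y; apply/matrixP => i k; rewrite !mxE.
Qed.

Lemma derive_entry m n (A : E -> 'M[K]_(m, n)) x v i j : derivable A x v ->
  'D_v A x i j = 'D_v (fun y => A y i j) x.
Proof.
move=> dA; have [l [lE cl]] := mx_entry_linear K i j.
rewrite -lE -derive_lcomp//; congr ('D_v _ x).
by apply/funext => y; rewrite lE.
Qed.

Lemma derive_mulmx m n p (A : E -> 'M[K]_(m, n)) (B : E -> 'M[K]_(n, p)) x v :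
  hol A x -> hol B x ->
  'D_v (fun y => A y *m B y) x = 'D_v A x *m B x + A x *m 'D_v B x.
Proof.
move=> hA hB; apply/matrixP => i k.
rewrite derive_entry; last exact/hol_derivable/hol_mulmx.
rewrite (_ : (fun y => (A y *m B y) i k) =
    \sum_j (fun y => A y i j * B y j k)); last first.
  by apply/funext => y; rewrite mxE fct_sumE.
have dA j : derivable (fun y => A y i j) x v by exact/hol_derivable/hol_entry.
have dB j : derivable (fun y => B y j k) x v by exact/hol_derivable/hol_entry.
rewrite derive_sum; last first.
  by move=> j; exact: (@derivableM _ _ (fun y => A y i j) (fun y => B y j k)).
rewrite !mxE -big_split /=; apply: eq_bigr => j _.
rewrite (@deriveM _ _ (fun y => A y i j) (fun y => B y j k))//.
rewrite !derive_entry; [|exact: hol_derivable..].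
by rewrite addrC; congr (_ + _); exact: mulrC.
Qed.

Lemma derive_trmx m n (A : E -> 'M[K]_(m, n)) x v :
  hol A x -> 'D_v (fun y => (A y)^T) x = ('D_v A x)^T.
Proof.
move=> hA; apply/matrixP => i j.
rewrite derive_entry ?mxE ?derive_entry; [|exact: hol_derivable|exact/hol_derivable/hol_trmx].
by congr ('D_v _ x); apply/funext => y; rewrite mxE.
Qed.

End matrix_calculus.

(** * Symmetry of second derivatives *)

Section line_derivative.
Variables (K : numFieldType).
Implicit Types (E F : normedModType K).

Lemma derive_line E F (f : E -> F) (y w : E) (s : K) :
  derivable f (y + s *: w) w ->
  derivable (fun z : K => f (y + z *: w)) s 1 /\
  'D_1 (fun z : K => f (y + z *: w)) s = 'D_w f (y + s *: w).
Proof.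
rewrite /derivable /derive.
suff -> : (fun h : K => h^-1 *: (((fun z : K => f (y + z *: w)) \o shift s) (h *: 1)
     - f (y + s *: w))) =
   (fun h => h^-1 *: ((f \o shift (y + s *: w)) (h *: w) - f (y + s *: w))) by [].
apply/funext => h /=; congr (_ *: (f _ - _)).
by rewrite [h *: 1]mulr1 scalerDl addrCA.
Qed.

Lemma derive_translate E F (f : E -> F) (x u v : E) :
  'D_u (fun y => f (y + v)) x = 'D_u f (x + v).
Proof.
rewrite /derive.
suff -> : (fun h : K => h^-1 *: (((fun y => f (y + v)) \o shift x) (h *: u)
    - f (x + v))) =
  (fun h => h^-1 *: ((f \o shift (x + v)) (h *: u) - f (x + v))) by [].
by apply/funext => h /=; rewrite addrA.
Qed.

Lemma derive_dirZ E F (f : E -> F) x v (t : K) : differentiable f x ->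
  'D_(t *: v) f x = t *: 'D_v f x.
Proof. by move=> df; rewrite !deriveE// linearZ. Qed.

Lemma derive_dirD E F (f : E -> F) x u v : differentiable f x ->
  'D_(u + v) f x = 'D_u f x + 'D_v f x.
Proof. by move=> df; rewrite !deriveE// linearD. Qed.

Lemma derive_dir_sum E F (f : E -> F) x (I : finType) (v : I -> E) :
  differentiable f x -> 'D_(\sum_i v i) f x = \sum_i 'D_(v i) f x.
Proof.
by move=> df; rewrite deriveE// linear_sum; apply: eq_bigr => i _; rewrite deriveE.
Qed.

Lemma derive2_dirZ E F (f : E -> F) x u v (t : K) : hol f x ->
  'D_(t *: v) (fun y => 'D_(t *: u) f y) x = (t * t) *: 'D_v (fun y => 'D_u f y) x.
Proof.
move=> hf; rewrite derive_dirZ; last exact/hol_differentiable/hol_derive.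
rewrite -scalerA; congr (_ *: _).
rewrite -deriveZ; last exact/hol_derivable/hol_derive.
apply: near_eq_derive; move/hol_near: hf; apply: filterS => y hy.
by rewrite derive_dirZ//; exact: hol_differentiable.
Qed.

End line_derivative.

Section schwarz.
Variable R : realType.
Notation K := (Cplx R).
Notation toC := (@real_complex_def _ (Phant R)).
Variable E : normedModType K.

Lemma increment_le (f : E -> K) (y w : E) (a eps : K) :
  (forall s : R, 0 <= s <= 1 -> differentiable f (y + toC s *: w)) ->
  (forall s : R, 0 <= s <= 1 -> `|'D_w f (y + toC s *: w) - a| <= eps) ->
  `|f (y + w) - f y - a| <= eps *+ 2.
Proof.
move=> df hf; have := @mean_value_le R (fun s => f (y + s *: w)) a eps.
rewrite scale1r scale0r addr0; apply=> s s01.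
  by have [] := derive_line (diff_derivable (df s s01) (v := w)).
have [_ ->] := derive_line (diff_derivable (df s s01) (v := w)).
exact: hf.
Qed.

(** The mean value inequality is used once in each direction, whence 4 eps. *)
Lemma second_difference_le (f : E -> K) (x u v : E) (a eps : K) :
  (forall s r : R, 0 <= s <= 1 -> 0 <= r <= 1 ->
    hol f (x + toC s *: u + toC r *: v)) ->
  (forall s r : R, 0 <= s <= 1 -> 0 <= r <= 1 ->
    `|'D_v (fun y => 'D_u f y) (x + toC s *: u + toC r *: v) - a| <= eps) ->
  `|f (x + u + v) - f (x + u) - (f (x + v) - f x) - a| <= eps *+ 2 *+ 2.
Proof.
move=> hf ha.
have i0 : ((0 : R) <= (0 : R)) && ((0 : R) <= (1 : R)).
  by apply/andP; split; [exact: lexx|exact: ler01].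
have i1 : ((0 : R) <= (1 : R)) && ((1 : R) <= (1 : R)).
  by apply/andP; split; [exact: ler01|exact: lexx].
have hf0 (s : R) : 0 <= s <= 1 -> hol f (x + toC s *: u).
  by move=> s01; have := hf s 0 s01 i0; rewrite scale0r addr0.
have hf1 (s : R) : 0 <= s <= 1 -> hol f (x + toC s *: u + v).
  by move=> s01; have := hf s 1 s01 i1; rewrite scale1r.
have hfv (s : R) : 0 <= s <= 1 -> differentiable (fun y => f (y + v)) (x + toC s *: u).
  move=> s01; apply: (@differentiable_comp _ _ _ _ (fun y => y + v) f); last first.
    exact/hol_differentiable/hf1.
  by apply: differentiableD; [exact: hol_differentiable (hol_id _)|exact: differentiable_cst].
pose g y := f (y + v) - f y.
suff : `|g (x + u) - g x - a| <= eps *+ 2 *+ 2 by [].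
apply: increment_le => s s01.
  by apply: differentiableB; [exact: hfv|exact: (hol_differentiable (hf0 s s01))].
have dfs := @hol_derivable _ _ _ _ _ u (hf0 s s01).
rewrite (@deriveB _ _ _ (fun y => f (y + v)) f); [|exact/diff_derivable/hfv|exact: dfs].
rewrite derive_translate.
apply: (@increment_le (fun y => 'D_u f y)) => r r01.
  exact: hol_differentiable (hol_derive u (hf s r s01 r01)).
exact: ha.
Qed.

Lemma continuous_near_le (g : E -> K) x (e : K) : {for x, continuous g} -> 0 < e ->
  nbhs x [set y | `|g y - g x| <= e].
Proof.
move=> cg e0; have /cvgrPdist_le/(_ _ e0) := cg.
by apply: filterS => y; rewrite /= distrC.
Qed.

Lemma close_of_quotients (t a b D1 D2 e : K) : 0 < t ->
  `|D1 - t * t * a| <= (t * t * (e / 8%:R)) *+ 2 *+ 2 ->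
  `|D2 - t * t * b| <= (t * t * (e / 8%:R)) *+ 2 *+ 2 ->
  D1 = D2 -> `|a - b| <= e.
Proof.
move=> t0 A B D12; rewrite -(ler_pM2l (mulr_gt0 t0 t0)).
rewrite -[X in X * `|_|]gtr0_norm ?mulr_gt0// -normrM.
rewrite (_ : t * t * (a - b) = (D2 - t * t * b) - (D1 - t * t * a)); last first.
  by rewrite D12; ring.
apply: le_trans (ler_normB _ _) _; apply: le_trans (lerD B A) _.
by rewrite le_eqVlt; apply/orP; left; apply/eqP; field.
Qed.

Lemma scaled_close (t p q P e : K) : 0 < t -> P = (t * t) *: p ->
  `|p - q| <= e -> `|P - t * t * q| <= t * t * e.
Proof.
move=> t0 -> h; rewrite -[_ *: p]/(_ * p) -mulrBr normrM.
by rewrite (gtr0_norm (mulr_gt0 t0 t0)) (ler_pM2l (mulr_gt0 t0 t0)).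
Qed.

(** Both mixed derivatives are compared with the second difference of f over a
    parallelogram with sides t *: u and t *: v. If they vary by at most e / 8
    there, each comparison costs t ^+ 2 * e / 2. *)
Lemma schwarz_scalar (f : E -> K) x u v : hol f x ->
  'D_v (fun y => 'D_u f y) x = 'D_u (fun y => 'D_v f y) x.
Proof.
move=> hf.
have hc u1 v1 : {for x, continuous (fun y => 'D_v1 (fun y => 'D_u1 f y) y)}.
  by apply: hol_continuous; do 2 apply: hol_derive.
apply/eqP; rewrite -subr_eq0 -normr_le0; apply/ler_addgt0Pr => e e0; rewrite add0r.
have e80 : 0 < e / 8%:R by rewrite divr_gt0.
have hh : nbhs x ([set y | hol f y] `&`
    ([set y | `|'D_v (fun z => 'D_u f z) y - 'D_v (fun z => 'D_u f z) x| <= e / 8%:R] `&`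
     [set y | `|'D_u (fun z => 'D_v f z) y - 'D_u (fun z => 'D_v f z) x| <= e / 8%:R])).
  apply: filterI; first exact: hol_near hf.
  by apply: filterI; apply: continuous_near_le => //; exact: hc.
move: hh => /nbhs_ballP[d /= d0 hd].
(* With this t the parallelogram stays in the ball of radius d. *)
pose t := d / (`|u| + `|v| + 1).
have uv0 : 0 < `|u| + `|v| + 1 by rewrite ltr_wpDl// addr_ge0.
have t0 : 0 < t by rewrite divr_gt0.
have tuv : t * (`|u| + `|v|) < d.
  by rewrite /t -mulrA gtr_pMr// mulrC ltr_pdivrMr// mul1r ltrDl.
clearbody t.
have small (s r : R) : 0 <= s <= 1 -> 0 <= r <= 1 ->
    ball x d (x + toC s *: (t *: u) + toC r *: (t *: v)).
  move=> /andP[s0 s1] /andP[r0 r1].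
  rewrite -ball_normE /ball_/= -addrA opprD addNKr normrN.
  apply: le_lt_trans (ler_normD _ _) _; rewrite !normrZ !norm_toC.
  rewrite (ger0_norm s0) (ger0_norm r0) (gtr0_norm t0).
  apply: (@le_lt_trans _ _ (t * `|u| + t * `|v|)).
    by apply: lerD; apply: ler_piMl; rewrite ?mulr_ge0 ?lecR// ltW.
  by rewrite -mulrDr.
have A : `|f (x + t *: u + t *: v) - f (x + t *: u) - (f (x + t *: v) - f x)
      - t * t * 'D_v (fun y => 'D_u f y) x|
    <= (t * t * (e / 8%:R)) *+ 2 *+ 2.
  apply: second_difference_le => s r s01 r01.
    exact: (hd _ (small _ _ s01 r01)).1.
  have [hy [h _]] := hd _ (small _ _ s01 r01).
  exact: (scaled_close t0 (derive2_dirZ u v t hy) h).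
have B : `|f (x + t *: v + t *: u) - f (x + t *: v) - (f (x + t *: u) - f x)
      - t * t * 'D_u (fun y => 'D_v f y) x|
    <= (t * t * (e / 8%:R)) *+ 2 *+ 2.
  apply: second_difference_le => s r s01 r01.
    by rewrite addrAC; exact: (hd _ (small _ _ r01 s01)).1.
  rewrite addrAC; have [hy [_ h]] := hd _ (small _ _ r01 s01).
  exact: (scaled_close t0 (derive2_dirZ v u t hy) h).
apply: (close_of_quotients t0 A B).
by rewrite [in LHS](addrAC x); ring.
Qed.

Lemma derive2_lcomp (F : normedModType K) (l : {linear F -> K}) (f : E -> F) x u v :
  continuous l -> hol f x ->
  l ('D_v (fun y => 'D_u f y) x) = 'D_v (fun y => 'D_u (fun z => l (f z)) y) x.
Proof.
move=> cl hf.
rewrite -(derive_lcomp cl (hol_derivable v (hol_derive u hf))).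
apply: near_eq_derive; have := hol_near hf; apply: filterS => y hy.
by rewrite (derive_lcomp cl (hol_derivable u hy)).
Qed.

Lemma schwarz (F : normedModType K) (f : E -> F) x u v : findim F -> hol f x ->
  'D_v (fun y => 'D_u f y) x = 'D_u (fun y => 'D_v f y) x.
Proof.
move=> [I [e [l [cl hl]]]] hf.
have lE i : l i ('D_v (fun y => 'D_u f y) x) = l i ('D_u (fun y => 'D_v f y) x).
  apply: etrans (derive2_lcomp u v (cl i) hf) _.
  apply: etrans _ (esym (derive2_lcomp v u (cl i) hf)).
  exact: schwarz_scalar (hol_lcomp (cl i) hf).
apply: etrans (hl _) _; apply: etrans _ (esym (hl _)).
by apply: eq_bigr => i _; rewrite lE.
Qed.

Lemma derive0_ball_cst_scalar (f : E -> K) x (d : K) :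
  (forall y, ball x d y -> differentiable f y) ->
  (forall y, ball x d y -> forall v, 'D_v f y = 0) ->
  forall y, ball x d y -> f y = f x.
Proof.
move=> df Df y xy.
have seg (s : R) : 0 <= s <= 1 -> ball x d (x + toC s *: (y - x)).
  move=> /andP[s0 s1]; move: xy; rewrite -ball_normE /ball_/= => xy.
  rewrite opprD addNKr normrN normrZ norm_toC ger0_norm// distrC.
  by apply: le_lt_trans xy; apply: ler_piMl; rewrite ?lecR.
have := @increment_le f x (y - x) 0 0 (fun s hs => df _ (seg s hs)).
rewrite mul0rn subr0 [x + (y - x)]addrC subrK normr_le0 subr_eq0 => h; apply/eqP/h.
by move=> s s01; rewrite Df ?subr0 ?normr0//; exact: seg.
Qed.

Lemma derive0_ball_cst (F : normedModType K) (f : E -> F) x (d : K) : findim F ->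
  (forall y, ball x d y -> differentiable f y) ->
  (forall y, ball x d y -> forall v, 'D_v f y = 0) ->
  forall y, ball x d y -> f y = f x.
Proof.
move=> [I [e [l [cl hl]]]] df Df y xy; rewrite [LHS]hl [RHS]hl.
apply: eq_bigr => i _; congr (_ *: _).
apply: (@derive0_ball_cst_scalar (fun z => l i (f z)) x d) => // z xz.
  apply: (@differentiable_comp _ _ _ _ f (l i)); first exact: df.
  exact: linear_differentiable.
by move=> v; rewrite derive_lcomp// ?Df ?linear0//; exact/diff_derivable/df.
Qed.

End schwarz.

(** * Brackets of related vector fields *)

Section directional.
Variables (K : numFieldType).
Implicit Types (E F : normedModType K).

Lemma derive_slice1 E F (W : normedModType K) (H : E * F -> W) z w v :
  'D_v (fun y => H (y, w)) z = 'D_(v, 0) H (z, w).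
Proof.
rewrite /derive.
suff -> : (fun h : K => h^-1 *: ((H \o shift (z, w)) (h *: (v, 0 : F)) - H (z, w))) =
  (fun h : K => h^-1 *: (((fun y => H (y, w)) \o shift z) (h *: v) - H (z, w))) by [].
by apply/funext => h /=; congr (_ *: (H _ - _)); congr pair; rewrite /= scaler0 add0r.
Qed.

Lemma derive_slice2 E F (W : normedModType K) (H : E * F -> W) z w v :
  'D_v (fun y => H (z, y)) w = 'D_(0, v) H (z, w).
Proof.
rewrite /derive.
suff -> : (fun h : K => h^-1 *: ((H \o shift (z, w)) (h *: (0 : E, v)) - H (z, w))) =
  (fun h : K => h^-1 *: (((fun y => H (z, y)) \o shift w) (h *: v) - H (z, w))) by [].
by apply/funext => h /=; congr (_ *: (H _ - _)); congr pair; rewrite /= scaler0 add0r.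
Qed.

Lemma derive_chain E F (W : normedModType K) (f : F -> W) (g : E -> F) x v :
  differentiable g x -> differentiable f (g x) ->
  'D_v (fun y => f (g y)) x = 'D_('D_v g x) f (g x).
Proof.
move=> dg df; rewrite deriveE; last exact: differentiable_comp.
by rewrite diff_comp// /= -deriveE// -deriveE.
Qed.

Lemma derive_dirB E F (f : E -> F) x u v : differentiable f x ->
  'D_(u - v) f x = 'D_u f x - 'D_v f x.
Proof. by move=> df; rewrite !deriveE// linearB. Qed.

Definition Jac n m (F : 'rV[K]_n -> 'rV[K]_m) (z : 'rV[K]_n) : 'M[K]_(n, m) :=
  \matrix_(i, j) ('D_(basis_vec K i) F z) 0 j.

Lemma deriveJ n m (F : 'rV[K]_n -> 'rV[K]_m) z v : differentiable F z ->
  'D_v F z = v *m Jac F z.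
Proof.
move=> dF; rewrite [v in LHS]row_sum_delta derive_dir_sum//.
apply/rowP => j; rewrite summxE !mxE; apply: eq_bigr => i _.
by rewrite derive_dirZ// !mxE.
Qed.

Lemma hol_Jac n m (F : 'rV[K]_n -> 'rV[K]_m) z : hol F z -> hol (Jac F) z.
Proof.
move=> hF; rewrite (_ : Jac F = fun z => \matrix_(i, j) ('D_(basis_vec K i) F z) 0 j)//.
apply: (@hol_matrix _ _ _ _ (fun i j y => ('D_(basis_vec K i) F y) 0 j)) => i j.
exact: hol_entry (hol_derive _ hF).
Qed.

Lemma derive_cst_mulmx n m p (v : 'M[K]_(p, n)) E (A : E -> 'M[K]_(n, m)) z u :
  hol A z -> 'D_u (fun y => v *m A y) z = v *m 'D_u A z.
Proof.
move=> hA; rewrite derive_mulmx//; last exact: hol_cst.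
by rewrite derive_cst mul0mx add0r.
Qed.

(** The field enters through its value at z, where only F varies, and through
    its own derivative. *)
Lemma derive_along n m (F : 'rV[K]_n -> 'rV[K]_m) (X : 'rV[K]_n -> 'rV[K]_n) z u :
  hol F z -> hol X z ->
  'D_u (fun y => 'D_(X y) F y) z =
  'D_('D_u X z) F z + 'D_u (fun y => 'D_(X z) F y) z.
Proof.
move=> hF hX; have hJ := hol_Jac hF.
have E1 : 'D_u (fun y => 'D_(X y) F y) z = 'D_u (fun y => X y *m Jac F y) z.
  apply: near_eq_derive; have := hol_near hF; apply: filterS => y hy.
  by rewrite deriveJ//; exact: hol_differentiable.
have E2 : 'D_u (fun y => 'D_(X z) F y) z = 'D_u (fun y => X z *m Jac F y) z.
  apply: near_eq_derive; have := hol_near hF; apply: filterS => y hy.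
  by rewrite deriveJ//; exact: hol_differentiable.
rewrite E1 E2 (derive_mulmx u hX hJ) (derive_cst_mulmx _ _ hJ).
by rewrite (deriveJ _ (hol_differentiable hF)).
Qed.

Definition field_bracket n (X Y : 'rV[K]_n -> 'rV[K]_n) (z : 'rV[K]_n) : 'rV[K]_n :=
  'D_(X z) Y z - 'D_(Y z) X z.

End directional.

Section bracket_naturality.
Variables (R : realType) (n : nat).
Notation K := (Cplx R).
Notation V := 'rV[K]_n.

Lemma sub_eq (a b p q r t : V) : a = p + q -> b = r + t -> q = t -> a - b = p - r.
Proof. by move=> -> -> ->; rewrite opprD addrACA subrr addr0. Qed.

(** Differentiating the relations, the second derivatives of F that appear
    cancel by symmetry, and only the bracket remains. *)
Lemma field_bracket_natural (F X Y X' Y' : V -> V) z :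
  hol F z -> hol X z -> hol Y z -> hol X' (F z) -> hol Y' (F z) ->
  (\forall y \near z, 'D_(X y) F y = X' (F y)) ->
  (\forall y \near z, 'D_(Y y) F y = Y' (F y)) ->
  'D_(field_bracket X Y z) F z = field_bracket X' Y' (F z).
Proof.
move=> hF hX hY hX' hY' FX FY.
have main (A B A' B' : V -> V) : hol A z -> hol B z -> hol A' (F z) -> hol B' (F z) ->
    (\forall y \near z, 'D_(A y) F y = A' (F y)) ->
    (\forall y \near z, 'D_(B y) F y = B' (F y)) ->
    'D_(A' (F z)) B' (F z) = 'D_('D_(A z) B z) F z + 'D_(A z) (fun y => 'D_(B z) F y) z.
  move=> hA hB hA' hB' FA FB.
  rewrite -(derive_along _ hF hB) -(nbhs_singleton FA).
  rewrite -(derive_chain _ (hol_differentiable hF) (hol_differentiable hB')).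
  by apply: near_eq_derive; apply: filterS FB => y ->.
have M1 := main X Y X' Y' hX hY hX' hY' FX FY.
have M2 := main Y X Y' X' hY hX hY' hX' FY FX.
have sw := schwarz (Y z) (X z) (@findim_mx K 1 n) hF.
apply: etrans _ (esym (sub_eq M1 M2 sw)).
exact: derive_dirB (hol_differentiable hF).
Qed.

End bracket_naturality.

(** * Holomorphic maps to the group *)

Local Opaque derive.

Section manifold_charts.
Variables (R : realType) (n : nat) (M : complexManifoldType R n).
Notation K := (Cplx R).
Notation V := 'rV[K]_n.
Implicit Types (c d : chart M [set: V]) (g : M).

Lemma mem_chart_img c g : chart_dom c g -> chart_img c (c g).
Proof. by move=> cg; exists g. Qed.

Lemma chart_invK c z : chart_img c z -> c (chart_inv c z) = z.
Proof. by move=> [g cg <-]; rewrite chart_mapK. Qed.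

Lemma chart_inv_dom c z : chart_img c z -> chart_dom c (chart_inv c z).
Proof. by move=> [g cg <-]; rewrite chart_mapK. Qed.

Lemma near_chart_img c z : chart_img c z -> \forall w \near z, chart_img c w.
Proof. by move=> cz; apply: open_nbhs_nbhs; split=> //; exact: open_chart_imgT. Qed.

Lemma near_chart_dom c g : chart_dom c g -> \forall h \near g, chart_dom c h.
Proof. by move=> cg; apply: open_nbhs_nbhs; split=> //; exact: open_chart_dom. Qed.

Lemma chart_inv_continuous_at c z : chart_img c z ->
  {for z, continuous (chart_inv c)}.
Proof.
move=> cz; have := @chart_inv_continuous _ _ _ _ c.
rewrite continuous_open_subspace; last exact: open_chart_imgT.
by apply; apply/mem_set.
Qed.

Lemma chart_map_continuous_at c g : chart_dom c g -> {for g, continuous c}.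
Proof.
move=> cg; have := @chart_map_continuous _ _ _ _ c.
rewrite continuous_open_subspace; last exact: open_chart_dom.
by apply; apply/mem_set.
Qed.

Lemma hol_transition c d z : atlas c -> atlas d -> chart_img c z ->
  chart_dom d (chart_inv c z) -> hol (fun w => d (chart_inv c w)) z.
Proof.
move=> ac ad cz dz.
have [U [f [Uz [oU hf] fE]]] := atlas_compatible _ _ ac ad _ (chart_inv_dom cz) dz.
rewrite chart_invK// in Uz.
have hfz : hol f z by have /holomorphicP[_] := conj oU hf; exact.
apply: hol_ext hfz.
have near_d : \forall w \near z, chart_dom d (chart_inv c w).
  by have := near_chart_dom dz; apply: chart_inv_continuous_at.
have nU : nbhs z U by apply: open_nbhs_nbhs.
apply: filterS3 near_d (near_chart_img cz) nU => w dw cw Uw.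
by rewrite fE ?chart_invK//; exact: chart_inv_dom.
Qed.

End manifold_charts.

Section group_holomorphic.
Variables (R : realType) (n : nat) (G : complexLieGroupType R n).
Notation K := (Cplx R).
Notation V := 'rV[K]_n.
Notation gchart := (chart G [set: V]).
Implicit Types (c d : gchart) (g h : G) (E D : normedModType K).

(** Holomorphic maps from a normed space to the group. *)
Definition holG E (f : E -> G) (x : E) : Prop :=
  {for x, continuous f} /\
  forall c, atlas c -> chart_dom c (f x) -> hol (fun y => c (f y)) x.

Lemma holG_near_dom E (f : E -> G) x c : holG f x -> chart_dom c (f x) ->
  \forall y \near x, chart_dom c (f y).
Proof. by move=> [cf _] /near_chart_dom; exact: cf. Qed.

Lemma holG_hol E (f : E -> G) x c : holG f x -> atlas c -> chart_dom c (f x) ->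
  hol (fun y => c (f y)) x.
Proof. by move=> [_ hf]; exact: hf. Qed.

Lemma holG_cst E g (x : E) : holG (fun=> g) x.
Proof. by split; [exact: cvg_cst|move=> c _ _; exact: hol_cst]. Qed.

Lemma holG_chart_inv c z : atlas c -> chart_img c z -> holG (chart_inv c) z.
Proof.
move=> ac cz; split=> [|d ad dz]; first exact: chart_inv_continuous_at.
exact: hol_transition.
Qed.

Lemma holG_mul E (f h : E -> G) x : findim E ->
  holG f x -> holG h x -> holG (fun y => f y * h y)%g x.
Proof.
move=> fE hf hh; split=> [|d ad dx].
  apply: (@continuous_comp _ _ _ (fun y => (f y, h y)) (fun p : G * G => (p.1 * p.2)%g)).
    by apply: cvg_pair; [exact: hf.1|exact: hh.1].
  exact: mulg_continuous.
pose c1 : gchart := chart_at (f x); pose c2 : gchart := chart_at (h x).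
have m1 : chart_dom c1 (f x) := mem_chart_at (f x).
have m2 : chart_dom c2 (h x) := mem_chart_at (h x).
have /holomorphicP[_ hm] := mulg_holomorphic c1 c2 d (atlas_chart_at _) (atlas_chart_at _) ad.
apply: (@hol_ext _ _ _ (fun y =>
    (fun z : V * V => d (chart_inv c1 z.1 * chart_inv c2 z.2)%g) (c1 (f y), c2 (h y)))).
  apply: filterS2 (holG_near_dom hf m1) (holG_near_dom hh m2) => y d1 d2 /=.
  by rewrite !chart_mapK.
apply: (@hol_comp _ _ _ _ (fun z : V * V => d (chart_inv c1 z.1 * chart_inv c2 z.2)%g)
  (fun y => (c1 (f y), c2 (h y)))).
- by apply: findim_prod; exact: findim_mx.
- exact: findim_mx.
- by apply: hol_pair; apply: holG_hol => //; exact: atlas_chart_at.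
- by apply: hm; split=> /=; [exact: mem_chart_img|exact: mem_chart_img|rewrite !chart_mapK].
Qed.

Lemma holG_inv E (f : E -> G) x : holG f x -> holG (fun y => (f y)^-1)%g x.
Proof.
move=> hf; split=> [|d ad dx].
  by apply: (@continuous_comp _ _ _ f); [exact: hf.1|exact: invg_continuous].
pose c1 : gchart := chart_at (f x).
have m1 : chart_dom c1 (f x) := mem_chart_at (f x).
have /holomorphicP[_ hm] := invg_holomorphic c1 d (atlas_chart_at _) ad.
apply: (@hol_ext _ _ _ (fun y =>
    (fun z : V => d (chart_inv c1 z)^-1%g) (c1 (f y)))).
  by apply: filterS (holG_near_dom hf m1) => y d1 /=; rewrite chart_mapK.
apply: (@hol_comp _ _ _ _ (fun z : V => d (chart_inv c1 z)^-1%g) (fun y => c1 (f y))).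
- exact: findim_mx.
- exact: findim_mx.
- by apply: holG_hol => //; exact: atlas_chart_at.
- by apply: hm; split=> /=; [exact: mem_chart_img|rewrite chart_mapK].
Qed.

Lemma holG_comp E D (f : E -> G) (p : D -> E) x : findim E ->
  hol p x -> holG f (p x) -> holG (fun y => f (p y)) x.
Proof.
move=> fE hp [cf hf]; split=> [|c ac cx].
  by apply: (@continuous_comp _ _ _ p f) => //; exact: hol_continuous.
exact: (@hol_comp _ _ _ _ (fun z => c (f z)) p x fE (@findim_mx K 1 n) hp (hf c ac cx)).
Qed.

(** The two commuting right actions through which the half edges of an edge act
    on its factor: false for the source, true for the end. *)
Definition act (b : bool) (g h : G) : G := (if b then g * h else h^-1 * g)%g.

Lemma act1 b g : act b g 1%g = g.
Proof. by case: b; rewrite /act ?mulg1// invg1 mul1g. Qed.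

Lemma actM b g h k : act b g (h * k)%g = act b (act b g h) k.
Proof. by case: b; rewrite /act ?mulgA// invgM. Qed.

Lemma actC b g h k : act (~~ b) (act b g h) k = act b (act (~~ b) g k) h.
Proof. by case: b; rewrite /act /= mulgA. Qed.

(** The action act b is simply transitive; this is the element moving g to h. *)
Definition act_div (b : bool) (g h : G) : G := (if b then g^-1 * h else g * h^-1)%g.

Lemma act_divK b g h : act b g (act_div b g h) = h.
Proof. by case: b; rewrite /act /act_div ?mulVKg// invgM invgK mulgVK. Qed.

Lemma act_divgg b g : act_div b g g = 1%g.
Proof. by case: b; rewrite /act_div ?mulVg ?mulgV. Qed.

Lemma holG_act E b (f h : E -> G) x : findim E ->
  holG f x -> holG h x -> holG (fun y => act b (f y) (h y)) x.
Proof.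
by move=> fE hf hh; case: b; rewrite /act; apply: holG_mul => //; exact: holG_inv.
Qed.

Lemma holG_act_div E b (f h : E -> G) x : findim E ->
  holG f x -> holG h x -> holG (fun y => act_div b (f y) (h y)) x.
Proof.
by move=> fE hf hh; case: b; rewrite /act_div; apply: holG_mul => //; exact: holG_inv.
Qed.

End group_holomorphic.

(** * Fundamental fields of the translation actions *)

Section invariant_fields.
Variables (R : realType) (n : nat) (G : complexLieGroupType R n).
Notation K := (Cplx R).
Notation V := 'rV[K]_n.
Notation gchart := (chart G [set: V]).
Notation e_ := (@basis_vec K n).
Implicit Types (c d : gchart) (g h : G) (b : bool) (x y z w : V).

Let fV : findim V := @findim_mx K 1 n.
Let fVV : findim (V * V)%type := findim_prod fV fV.

Definition chart1 : gchart := chart_at (1%g : G).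
Definition origin : V := chart1 1%g.
Notation o := origin.

Lemma atlas_chart1 : atlas chart1. Proof. exact: atlas_chart_at. Qed.
Lemma dom_chart1 : chart_dom chart1 1%g. Proof. exact: mem_chart_at. Qed.
Lemma origin_img : chart_img chart1 o. Proof. exact: mem_chart_img dom_chart1. Qed.
Lemma chart1_invo : chart_inv chart1 o = 1%g.
Proof. by rewrite chart_mapK//; exact: dom_chart1. Qed.

Definition orbit_map b c (p : V * V) : V :=
  c (act b (chart_inv c p.1) (chart_inv chart1 p.2)).

Definition fund_mx b c z : 'M[K]_n :=
  \matrix_(i, j) ('D_(0, e_ i) (orbit_map b c) (z, o)) 0 j.

(** The coordinates in c of the fundamental vector field of x for the action
    act b: the left invariant field for true, minus the right invariant one
    for false. *)
Definition fund b c x z : V := x *m fund_mx b c z.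

Lemma hol_orbit_map b c z : atlas c -> chart_img c z -> hol (orbit_map b c) (z, o).
Proof.
move=> ac cz.
have gh1 : holG (fun p : V * V => chart_inv c p.1) (z, o).
  by apply: (holG_comp fV (hol_fst _)) => /=; exact: holG_chart_inv.
have gh2 : holG (fun p : V * V => chart_inv chart1 p.2) (z, o).
  apply: (holG_comp fV (hol_snd _)) => /=.
  exact: (holG_chart_inv atlas_chart1 origin_img).
apply: (holG_hol (holG_act b fVV gh1 gh2) ac) => /=.
by rewrite chart1_invo act1; exact: chart_inv_dom.
Qed.

Lemma holG_orbit b g w : chart_img chart1 w ->
  holG (fun w : V => act b g (chart_inv chart1 w)) w.
Proof.
by move=> w1; apply: holG_act => //; [exact: holG_cst|exact: (holG_chart_inv atlas_chart1)].
Qed.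

Lemma hol_orbit b c g : atlas c -> chart_dom c g ->
  hol (fun w => c (act b g (chart_inv chart1 w))) o.
Proof.
move=> ac cg; apply: (holG_hol (holG_orbit b g origin_img) ac).
by rewrite chart1_invo act1.
Qed.

Lemma hol_fund_mx b c z : atlas c -> chart_img c z -> hol (fund_mx b c) z.
Proof.
move=> ac cz.
rewrite (_ : fund_mx b c = fun z => \matrix_(i, j) ('D_(0, e_ i) (orbit_map b c) (z, o)) 0 j)//.
apply: (@hol_matrix _ _ _ _ (fun i j z => ('D_(0, e_ i) (orbit_map b c) (z, o)) 0 j)).
move=> i j; apply: hol_entry.
apply: (@hol_comp _ _ _ _ (fun p => 'D_(0, e_ i) (orbit_map b c) p) (fun z => (z, o))).
- exact: fVV.
- exact: fV.
- by apply: hol_pair; [exact: hol_id|exact: hol_cst].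
- exact: hol_derive (hol_orbit_map b ac cz).
Qed.

Lemma hol_fund b c x z : atlas c -> chart_img c z -> hol (fund b c x) z.
Proof.
by move=> ac cz; apply: hol_mulmx; [exact: hol_cst|exact: hol_fund_mx].
Qed.

Lemma fund_mxE b c g : chart_dom c g ->
  fund_mx b c (c g) = Jac (fun w => c (act b g (chart_inv chart1 w))) o.
Proof.
move=> cg.
have E i : 'D_(0, e_ i) (orbit_map b c) (c g, o) =
    'D_(e_ i) (fun w => c (act b g (chart_inv chart1 w))) o.
  apply: etrans (esym (derive_slice2 (orbit_map b c) (c g) o (e_ i))) _.
  by rewrite /orbit_map /= chart_mapK.
by apply/matrixP => i j; rewrite [LHS]mxE [RHS]mxE E.
Qed.

Lemma fundE b c x g : atlas c -> chart_dom c g ->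
  fund b c x (c g) = 'D_x (fun w => c (act b g (chart_inv chart1 w))) o.
Proof.
move=> ac cg; rewrite (deriveJ _ (hol_differentiable (hol_orbit b ac cg))).
by rewrite /fund fund_mxE.
Qed.

(** An equivariant map carries the orbit map of g to the one of Phi g, so it
    relates the fundamental fields of x, which are their derivatives. *)
Lemma fund_equivariant (Phi : G -> G) b b' c d x g :
  (forall h k, Phi (act b h k) = act b' (Phi h) k) ->
  atlas c -> atlas d -> chart_dom c g -> chart_dom d (Phi g) ->
  hol (fun z => d (Phi (chart_inv c z))) (c g) ->
  'D_(fund b c x (c g)) (fun z => d (Phi (chart_inv c z))) (c g) = fund b' d x (d (Phi g)).
Proof.
move=> PhiE ac ad cg dg hF.
rewrite (fundE _ _ ac cg) (fundE _ _ ad dg).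
pose F z := d (Phi (chart_inv c z)).
pose O w := c (act b g (chart_inv chart1 w)).
have Oo : O o = c g by rewrite /O chart1_invo act1.
have dO : differentiable O o := hol_differentiable (hol_orbit b ac cg).
have dF : differentiable F (O o) by rewrite Oo; exact: hol_differentiable hF.
rewrite -[X in 'D_(_) _ X = _]Oo -[LHS](derive_chain _ dO dF).
apply: near_eq_derive.
have c1g : chart_dom c (act b g (chart_inv chart1 o)) by rewrite chart1_invo act1.
apply: filterS (holG_near_dom (holG_orbit b g origin_img) c1g) => w cw.
by rewrite /F /O chart_mapK// PhiE.
Qed.

Lemma fund_chart_change b c d x g : atlas c -> atlas d -> chart_dom c g -> chart_dom d g ->
  'D_(fund b c x (c g)) (fun z => d (chart_inv c z)) (c g) = fund b d x (d g).
Proof.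
move=> ac ad cg dg.
apply: (@fund_equivariant id) => //.
apply: (holG_hol (holG_chart_inv ac (mem_chart_img cg)) ad).
by rewrite chart_mapK.
Qed.

End invariant_fields.

(** * Brackets of fundamental fields *)

Section brackets.
Variables (R : realType) (n : nat) (G : complexLieGroupType R n).
Notation K := (Cplx R).
Notation V := 'rV[K]_n.
Notation gchart := (chart G [set: V]).
Notation e_ := (@basis_vec K n).
Notation o := (origin G).
Notation c1 := (chart1 G).
Implicit Types (c d : gchart) (g h : G) (b : bool) (x y z w : V).

Let fV : findim V := @findim_mx K 1 n.
Let fVV : findim (V * V)%type := findim_prod fV fV.

Lemma left_invariant_at x g :
  left_invariant_field (x : tangent (1%g : G)) g =
  fund true (chart_at g : gchart) x ((chart_at g : gchart) g).
Proof.
pose d : gchart := chart_at g.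
have ad : atlas d := atlas_chart_at _.
have dg : chart_dom d g := mem_chart_at g.
rewrite /left_invariant_field /mdiff mulg1.
rewrite (fundE _ _ ad dg) deriveE//; apply: hol_differentiable.
exact: (hol_orbit true ad dg).
Qed.

Lemma left_invariant_fieldE c x z : atlas c -> chart_img c z ->
  vector_field_coords c (left_invariant_field (x : tangent (1%g : G))) z = fund true c x z.
Proof.
move=> ac cz; rewrite /vector_field_coords /tangent_coords left_invariant_at.
set g := chart_inv c z.
have cg : chart_dom c g := chart_inv_dom cz.
pose d : gchart := chart_at g.
have ad : atlas d := atlas_chart_at _.
have dg : chart_dom d g := mem_chart_at g.
have hF : hol (fun w => c (chart_inv d w)) (d g).
  apply: (holG_hol (holG_chart_inv ad (mem_chart_img dg)) ac).
  by rewrite chart_mapK.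
rewrite -deriveE; last exact: hol_differentiable hF.
by rewrite (fund_chart_change _ _ ad ac dg cg) chart_invK.
Qed.

Lemma lie_bracketE x y :
  lie_bracket (x : tangent (1%g : G)) y = field_bracket (fund true c1 x) (fund true c1 y) o.
Proof.
rewrite /lie_bracket /vector_field_bracket !left_invariant_at -/c1 -/o.
have E (t u : V) : 'D_u (vector_field_coords c1 (left_invariant_field (t : tangent (1%g : G)))) o
    = 'D_u (fund true c1 t) o.
  apply: near_eq_derive; apply: filterS (near_chart_img (origin_img G)) => w cw.
  exact: (left_invariant_fieldE t (atlas_chart1 G) cw).
by apply: etrans (congr2 (fun p q => p - q) (E y _) (E x _)) _.
Qed.

(** The orbit map of g is equivariant from the right translation action to
    act b. *)
Lemma fund_orbit b c g x w : atlas c -> chart_img c1 w ->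
  chart_dom c (act b g (chart_inv c1 w)) ->
  'D_(fund true c1 x w) (fun w => c (act b g (chart_inv c1 w))) w =
  fund b c x (c (act b g (chart_inv c1 w))).
Proof.
move=> ac w1 cg.
rewrite -{1 2}(chart_invK w1).
apply: (@fund_equivariant _ _ _ (act b g)) => //.
- by move=> h k; rewrite -actM.
- exact: atlas_chart1.
- exact: chart_inv_dom.
- by rewrite (chart_invK w1); exact: (holG_hol (holG_orbit b g w1) ac).
Qed.

(** At the identity and for left invariant fields this is the definition of the
    Lie bracket; the orbit map of g carries it to g, for either action. *)
Lemma fund_bracket b c x y z : atlas c -> chart_img c z ->
  field_bracket (fund b c x) (fund b c y) z = fund b c (lie_bracket (x : tangent (1%g : G)) y) z.
Proof.
move=> ac cz; set g := chart_inv c z.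
have cg : chart_dom c g := chart_inv_dom cz.
pose F w := c (act b g (chart_inv c1 w)).
have Fo : F o = z by rewrite /F chart1_invo act1 chart_invK.
have hF : hol F o := hol_orbit b ac cg.
have hY t : hol (fund true c1 t) o := hol_fund _ _ (atlas_chart1 G) (origin_img G).
have hY' t : hol (fund b c t) (F o) by rewrite Fo; exact: hol_fund.
have nF t : \forall w \near o, 'D_(fund true c1 t w) F w = fund b c t (F w).
  have cg1 : chart_dom c (act b g (chart_inv c1 o)) by rewrite chart1_invo act1.
  apply: filterS2 (near_chart_img (origin_img G))
    (holG_near_dom (holG_orbit b g (origin_img G)) cg1) => w w1 cw.
  exact: fund_orbit.
have E := field_bracket_natural hF (hY x) (hY y) (hY' x) (hY' y) (nF x) (nF y).
apply: etrans (congr1 (field_bracket (fund b c x) (fund b c y)) (esym Fo)) _.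
apply: etrans (esym E) _.
apply: etrans (congr1 (fun t => 'D_t F o) (esym (lie_bracketE x y))) _.
apply: etrans (esym (fundE b _ ac cg)) _.
by rewrite (chart_invK cz).
Qed.

(** Each of the two actions preserves the fundamental fields of the other. This
    invariance, differentiated at the identity, equates the two terms of the
    bracket, both being second derivatives of the orbit map. *)
Lemma fund_commute b c x y z : atlas c -> chart_img c z ->
  field_bracket (fund b c x) (fund (~~ b) c y) z = 0.
Proof.
move=> ac cz; set g := chart_inv c z.
have cg : chart_dom c g := chart_inv_dom cz.
pose M := orbit_map (~~ b) c; pose v := fund b c x z.
have hM : hol M (z, o) := hol_orbit_map (~~ b) ac cz.
have zE : c g = z := chart_invK cz.
have Mo : M (z, o) = z by rewrite /M /orbit_map /= chart1_invo act1.
have gho := holG_orbit (~~ b) g (origin_img G).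
have cgo : chart_dom c (act (~~ b) g (chart_inv c1 o)) by rewrite chart1_invo act1.
(* For each w, the action ~~ b by w is equivariant for act b. *)
have E1 : \forall w \near o, 'D_(v, 0) M (z, w) = fund b c x (M (z, w)).
  apply: filterS2 (near_chart_img (origin_img G)) (holG_near_dom gho cgo) => w w1 cw.
  apply: etrans (esym (derive_slice1 M z w v)) _.
  rewrite /M /orbit_map /= -/g /v -zE.
  apply: (@fund_equivariant _ _ _ (fun h => act (~~ b) h (chart_inv c1 w))) => //.
    by move=> h k; rewrite actC.
  have ghz : holG (fun z => act (~~ b) (chart_inv c z) (chart_inv c1 w)) (c g).
    apply: holG_act => //; last exact: holG_cst.
    by apply: holG_chart_inv => //; exact: mem_chart_img.
  by apply: (holG_hol ghz ac); rewrite chart_mapK.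
have dM w : 'D_y (fun w => M (z, w)) w = 'D_(0, y) M (z, w).
  exact: derive_slice2.
have L1 : 'D_y (fun w => 'D_(v, 0) M (z, w)) o = 'D_v (fund (~~ b) c y) z.
  apply: etrans (derive_slice2 (fun p => 'D_(v, 0) M p) z o y) _.
  apply: etrans (schwarz (v, 0) (0, y) fV hM) _.
  apply: etrans (esym (derive_slice1 (fun p => 'D_(0, y) M p) z o v)) _.
  apply: near_eq_derive; apply: filterS (near_chart_img cz) => u cu.
  apply: etrans (esym (derive_slice2 M u o y)) _.
  apply: etrans (esym (fundE (~~ b) y ac (chart_inv_dom cu))) _.
  by rewrite (chart_invK cu).
have L2 : 'D_y (fun w => 'D_(v, 0) M (z, w)) o = 'D_(fund (~~ b) c y z) (fund b c x) z.
  apply: etrans (near_eq_derive _ E1) _.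
  have hMz : hol (fun w => M (z, w)) o.
    exact: (hol_orbit (~~ b) ac cg).
  have dX : differentiable (fund b c x) (M (z, o)).
    by rewrite Mo; exact: hol_differentiable (hol_fund _ _ ac cz).
  apply: etrans (derive_chain _ (hol_differentiable hMz) dX) _.
  apply: etrans (congr1 (fun t => 'D_t (fund b c x) (M (z, o))) (esym (fundE (~~ b) y ac cg))) _.
  exact: (congr2 (fun p q => 'D_(fund (~~ b) c y p) (fund b c x) q) zE Mo).
apply: etrans (congr2 (fun p q => p - q) (esym L1) (esym L2)) _.
exact: subrr.
Qed.

End brackets.

(** * Invariant symmetric tensors *)

Lemma connected_locally_constant (T : topologicalType) (P : T -> Prop) (t : T) :
  connected [set: T] -> P t -> (forall u, \forall v \near u, P u <-> P v) ->
  forall u, P u.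
Proof.
move=> Tconn Pt nP.
have oP : open [set u | P u].
  by rewrite openE => u Pu; apply: filterS (nP u) => v [+ _]; exact.
have oNP : open (~` [set u | P u]).
  by rewrite openE => u Pu; apply: filterS (nP u) => v [_ vP] Pv; apply: Pu; exact: vP.
have PT : [set u | P u] = setT.
  apply: Tconn; first by exists t.
    by exists [set u | P u] => //; rewrite setTI.
  by exists [set u | P u]; [rewrite -[X in closed X]setCK; exact: open_closedC|rewrite setTI].
by move=> u; have : [set u | P u] u by rewrite PT.
Qed.

Section symmetric_part.
Variables (R : realType) (n : nat) (G : complexLieGroupType R n).
Notation K := (Cplx R).
Notation V := 'rV[K]_n.
Notation gchart := (chart G [set: V]).
Notation e_ := (@basis_vec K n).
Notation o := (origin G).
Notation c1 := (chart1 G).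
Notation br := (@lie_bracket R n G).
Implicit Types (c d : gchart) (g h : G) (b : bool) (x y z w : V).

Let fV : findim V := @findim_mx K 1 n.
Let fVV : findim (V * V)%type := findim_prod fV fV.

Lemma mulmx_ext m p (A B : 'M[K]_(m, p)) : (forall v : 'rV[K]_m, v *m A = v *m B) -> A = B.
Proof. by move=> h; apply/row_matrixP => i; rewrite !rowE h. Qed.

Definition div_map b c (p : V * V) : V :=
  c1 (act_div b (chart_inv c p.1) (chart_inv c p.2)).

(** The inverse of fund_mx, obtained by differentiating the inverse of the orbit
    map, which shows that it is holomorphic. *)
Definition fund_inv b c z : 'M[K]_n :=
  \matrix_(i, j) ('D_(0, e_ i) (div_map b c) (z, z)) 0 j.

Lemma hol_div_map b c z : atlas c -> chart_img c z -> hol (div_map b c) (z, z).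
Proof.
move=> ac cz.
have gh1 : holG (fun p : V * V => chart_inv c p.1) (z, z).
  by apply: (holG_comp fV (hol_fst _)) => /=; exact: holG_chart_inv.
have gh2 : holG (fun p : V * V => chart_inv c p.2) (z, z).
  by apply: (holG_comp fV (hol_snd _)) => /=; exact: holG_chart_inv.
apply: (holG_hol (holG_act_div b fVV gh1 gh2) (atlas_chart1 G)) => /=.
by rewrite act_divgg; exact: dom_chart1.
Qed.

Lemma hol_fund_inv b c z : atlas c -> chart_img c z -> hol (fund_inv b c) z.
Proof.
move=> ac cz.
rewrite (_ : fund_inv b c = fun z => \matrix_(i, j) ('D_(0, e_ i) (div_map b c) (z, z)) 0 j)//.
apply: (@hol_matrix _ _ _ _ (fun i j z => ('D_(0, e_ i) (div_map b c) (z, z)) 0 j)).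
move=> i j; apply: hol_entry.
apply: (@hol_comp _ _ _ _ (fun p => 'D_(0, e_ i) (div_map b c) p) (fun z => (z, z))).
- exact: fVV.
- exact: fV.
- by apply: hol_pair; exact: hol_id.
- exact: hol_derive (hol_div_map b ac cz).
Qed.

Lemma mul_fund_inv_fund_mx b c z : atlas c -> chart_img c z ->
  fund_inv b c z *m fund_mx b c z = 1%:M.
Proof.
move=> ac cz; set g := chart_inv c z.
have cg : chart_dom c g := chart_inv_dom cz.
have zE : c g = z := chart_invK cz.
pose N u := c1 (act_div b g (chart_inv c u)).
pose F w := c (act b g (chart_inv c1 w)).
have ghN : holG (fun u => act_div b g (chart_inv c u)) z.
  by apply: holG_act_div => //; [exact: holG_cst|exact: holG_chart_inv].
have N1 : chart_dom c1 (act_div b g (chart_inv c z)) by rewrite act_divgg; exact: dom_chart1.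
have FN : \forall u \near z, F (N u) = u.
  apply: filterS2 (holG_near_dom ghN N1) (near_chart_img cz) => u u1 cu.
  by rewrite /F /N (chart_mapK u1) act_divK (chart_invK cu).
have hN : hol N z := holG_hol ghN (atlas_chart1 G) N1.
have No : N z = o by rewrite /N act_divgg.
have JN : fund_inv b c z = Jac N z.
  have E i : 'D_(0, e_ i) (div_map b c) (z, z) = 'D_(e_ i) N z.
    exact: esym (derive_slice2 (div_map b c) z z (e_ i)).
  by apply/matrixP => i j; rewrite [LHS]mxE [RHS]mxE E.
have YF : fund_mx b c z = Jac F o := etrans (congr1 (fund_mx b c) (esym zE)) (fund_mxE b cg).
have hF : hol F o := hol_orbit b ac cg.
apply: mulmx_ext => v; rewrite mulmxA mulmx1 JN YF.
rewrite -(deriveJ _ (hol_differentiable hN)) -(deriveJ _ (hol_differentiable hF)).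
have dFN : differentiable F (N z) by rewrite No; exact: hol_differentiable hF.
apply: etrans (congr1 (fun p => 'D_('D_v N z) F p) (esym No)) _.
apply: etrans (esym (derive_chain v (hol_differentiable hN) dFN)) _.
apply: etrans (near_eq_derive v FN) _.
exact: derive_id.
Qed.

Lemma mul_fund_mx_fund_inv b c z : atlas c -> chart_img c z ->
  fund_mx b c z *m fund_inv b c z = 1%:M.
Proof. by move=> ac cz; apply: mulmx1C; exact: mul_fund_inv_fund_mx. Qed.

Lemma fund_mx_chart_change b c d g : atlas c -> atlas d -> chart_dom c g -> chart_dom d g ->
  fund_mx b d (d g) = fund_mx b c (c g) *m Jac (fun z => d (chart_inv c z)) (c g).
Proof.
move=> ac ad cg dg; apply: mulmx_ext => x; rewrite mulmxA.
apply: etrans (esym (fund_chart_change b x ac ad cg dg)) _.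
apply: deriveJ; apply: hol_differentiable.
apply: (holG_hol (holG_chart_inv ac (mem_chart_img cg)) ad).
by rewrite chart_mapK.
Qed.

Lemma derive_fund b c x z u : atlas c -> chart_img c z ->
  'D_u (fund b c x) z = x *m 'D_u (fund_mx b c) z.
Proof. by move=> ac cz; exact: derive_cst_mulmx (hol_fund_mx b ac cz). Qed.

Lemma derive_fund_along b c x z v : atlas c -> chart_img c z ->
  'D_v (fund b c x) z = v *m Jac (fund b c x) z.
Proof. by move=> ac cz; apply: deriveJ; exact: hol_differentiable (hol_fund b x ac cz). Qed.

(** Commutation, in matrix form: along the left invariant field of x, the frame
    of right invariant fields is transported by the linearised flow. *)
Lemma derive_fund_mx_false c x z : atlas c -> chart_img c z ->
  'D_(fund true c x z) (fund_mx false c) z = fund_mx false c z *m Jac (fund true c x) z.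
Proof.
move=> ac cz; apply: mulmx_ext => y; rewrite mulmxA.
apply: etrans (esym (derive_fund false y _ ac cz)) _.
apply: etrans _ (derive_fund_along true x (fund false c y z) ac cz).
exact: subr0_eq (fund_commute true x y ac cz).
Qed.

Lemma derive_fund_mx_true c x y z : atlas c -> chart_img c z ->
  y *m ('D_(fund true c x z) (fund_mx true c) z - fund_mx true c z *m Jac (fund true c x) z) =
  br x y *m fund_mx true c z.
Proof.
move=> ac cz; rewrite mulmxBr mulmxA.
apply: etrans _ (fund_bracket true x y ac cz).
apply: etrans _ (congr2 (fun p q => p - q) (esym (derive_fund true y _ ac cz))
  (esym (derive_fund_along true x (fund true c y z) ac cz))).
by [].
Qed.

(** The matrix of the bracket with x, read off from left invariant fields at the
    identity. It exhibits the linearity of the bracket. *)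
Definition ad_mx x : 'M[K]_n :=
  ('D_(fund true c1 x o) (fund_mx true c1) o - fund_mx true c1 o *m Jac (fund true c1 x) o)
    *m fund_inv true c1 o.

Lemma lie_bracket_ad x y : br x y = y *m ad_mx x.
Proof.
rewrite mulmxA (derive_fund_mx_true x y (atlas_chart1 G) (origin_img G)) -mulmxA.
by rewrite (mul_fund_mx_fund_inv true (atlas_chart1 G) (origin_img G)) mulmx1.
Qed.

Local Opaque lie_bracket ad_mx.

Lemma lie_bracketC x y : br x y = - br y x.
Proof. by rewrite !lie_bracketE /field_bracket opprB. Qed.

(** The frame of left invariant fields is transported by the same flow up to the
    rotation by ad x. *)
Lemma derive_fund_mx_true_ad c x z : atlas c -> chart_img c z ->
  'D_(fund true c x z) (fund_mx true c) z =
  fund_mx true c z *m Jac (fund true c x) z + ad_mx x *m fund_mx true c z.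
Proof.
move=> ac cz.
have E : 'D_(fund true c x z) (fund_mx true c) z - fund_mx true c z *m Jac (fund true c x) z =
    ad_mx x *m fund_mx true c z.
  apply: mulmx_ext => y; apply: etrans (derive_fund_mx_true x y ac cz) _.
  exact: etrans (congr1 (mulmx^~ (fund_mx true c z)) (lie_bracket_ad x y)) (esym (mulmxA _ _ _)).
apply: etrans (esym (subrK (fund_mx true c z *m Jac (fund true c x) z) _)) _.
exact: etrans (congr1 (fun t => t + _) E) (addrC _ _).
Qed.

Variable s : 'M[K]_n.
Hypothesis s_inv : invariant_sym2 br s.

(** The coordinates in c of the invariant tensor field generated by s under
    act b. *)
Definition inv_tensor b c z : 'M[K]_n := (fund_mx b c z)^T *m s *m fund_mx b c z.

Lemma ad_invariant x : (ad_mx x)^T *m s + s *m ad_mx x = 0.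
Proof.
have [_ /(_ x) <-] := s_inv.
rewrite (eq_bigr (fun i => \sum_j s i j *: tens2 (br x (e_ i)) (e_ j)
   + \sum_j s i j *: tens2 (e_ i) (br x (e_ j)))); last first.
  by move=> i _; rewrite -big_split; apply: eq_bigr => j _; rewrite scalerDr.
rewrite big_split /=; congr (_ + _).
  apply/matrixP => a b; rewrite !mxE summxE; apply: eq_bigr => i _.
  rewrite summxE (bigD1 b)//= big1 ?addr0.
    by rewrite lie_bracket_ad /tens2 /basis_vec -rowE !mxE big_ord1 !mxE !eqxx mulr1 mulrC.
  by move=> j jb; rewrite /tens2 /basis_vec !mxE big_ord1 !mxE (eq_sym b) (negPf jb) andbF !mulr0.
apply/matrixP => a b; rewrite !mxE summxE [RHS](bigD1 a)//= [X in _ + X]big1 ?addr0.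
  rewrite summxE; apply: eq_bigr => j _.
  by rewrite lie_bracket_ad /tens2 /basis_vec -rowE !mxE big_ord1 !mxE !eqxx mul1r.
move=> i ia; rewrite summxE big1// => j _.
by rewrite /tens2 /basis_vec !mxE big_ord1 !mxE (eq_sym a) (negPf ia) andbF mul0r mulr0.
Qed.

(** The coefficients of the left invariant tensor field in the frame of right
    invariant fields; s is invariant under the adjoint group exactly if they
    equal s everywhere. *)
Definition mixed_coeffs c z : 'M[K]_n :=
  (fund_inv false c z)^T *m inv_tensor true c z *m fund_inv false c z.

Lemma inv_tensor_mixed_coeffs c z : atlas c -> chart_img c z ->
  inv_tensor true c z = (fund_mx false c z)^T *m mixed_coeffs c z *m fund_mx false c z.
Proof.
move=> ac cz; rewrite /mixed_coeffs.
move: (inv_tensor true c z) (mul_fund_inv_fund_mx false ac cz) => S.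
move: (fund_inv false c z) (fund_mx false c z) => T A TA.
by rewrite !mulmxA -trmx_mul TA trmx1 mul1mx -mulmxA TA mulmx1.
Qed.

Lemma hol_inv_tensor b c z : atlas c -> chart_img c z -> hol (inv_tensor b c) z.
Proof.
move=> ac cz; have hY := hol_fund_mx b ac cz.
by apply: hol_mulmx => //; apply: hol_mulmx; [exact: hol_trmx|exact: hol_cst].
Qed.

Lemma hol_mixed_coeffs c z : atlas c -> chart_img c z -> hol (mixed_coeffs c) z.
Proof.
move=> ac cz; have hT := hol_fund_inv false ac cz.
apply: hol_mulmx => //; apply: hol_mulmx; first exact: hol_trmx.
exact: hol_inv_tensor.
Qed.

Lemma derive_congruence (A B : V -> 'M[K]_n) z u : hol A z -> hol B z ->
  'D_u (fun z => (A z)^T *m B z *m A z) z =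
  ('D_u A z)^T *m B z *m A z + (A z)^T *m 'D_u B z *m A z + (A z)^T *m B z *m 'D_u A z.
Proof.
move=> hA hB; have hAt := hol_trmx hA; have hAB := hol_mulmx hAt hB.
apply: etrans (derive_mulmx u hAB hA) _.
apply: etrans (congr1 (fun t => t *m A z + (A z)^T *m B z *m 'D_u A z) (derive_mulmx u hAt hB)) _.
by rewrite mulmxDl (derive_trmx u hA).
Qed.

(** A is the left invariant frame, J the linearised flow and B the rotation by
    ad x: the rotation disappears from the derivative of A^T *m s *m A. *)
Lemma congruence_flow (A DA J B Z : 'M[K]_n) : Z = 0 -> DA = A *m J + B *m A ->
  B^T *m s + s *m B = 0 ->
  DA^T *m s *m A + A^T *m Z *m A + A^T *m s *m DA =
  J^T *m (A^T *m s *m A) + (A^T *m s *m A) *m J.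
Proof.
move=> -> -> Bs; rewrite mulmx0 mul0mx addr0 linearD /= !trmx_mul.
rewrite !mulmxDl !mulmxDr !mulmxA -!addrA; congr (_ + _).
rewrite addrCA -[RHS]addr0; congr (_ + _).
rewrite -[A^T *m _ *m s]mulmxA -[A^T *m s *m B]mulmxA -mulmxDl -mulmxDr.
by rewrite Bs mulmx0 mul0mx.
Qed.

Lemma congruence_frame (A DA J S Q DQ : 'M[K]_n) : DA = A *m J -> S = A^T *m Q *m A ->
  DA^T *m Q *m A + A^T *m DQ *m A + A^T *m Q *m DA =
  J^T *m S + S *m J + A^T *m DQ *m A.
Proof. by move=> -> ->; rewrite trmx_mul !mulmxA addrAC. Qed.

Lemma congruence_inj (A T Q : 'M[K]_n) : A *m T = 1%:M -> A^T *m Q *m A = 0 -> Q = 0.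
Proof.
move=> AT /(congr1 (fun B => T^T *m B *m T)).
rewrite mulmx0 mul0mx !mulmxA -trmx_mul AT trmx1 mul1mx.
by rewrite -mulmxA AT mulmx1.
Qed.

(** The tensor field and the right invariant frame are transported by the same
    flow, so the coefficients of one in the other do not change. *)
Lemma derive_mixed_coeffs c x z : atlas c -> chart_img c z ->
  'D_(fund true c x z) (mixed_coeffs c) z = 0.
Proof.
move=> ac cz; pose u := fund true c x z; pose J := Jac (fund true c x) z.
pose Yf := fund_mx false c z; pose Yt := fund_mx true c z.
have E1 : 'D_u (inv_tensor true c) z = J^T *m inv_tensor true c z + inv_tensor true c z *m J.
  apply: etrans (derive_congruence u (hol_fund_mx true ac cz) (hol_cst s z)) _.
  exact: congruence_flow (derive_cst s z u) (derive_fund_mx_true_ad x ac cz) (ad_invariant x).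
have E2 : 'D_u (inv_tensor true c) z = J^T *m inv_tensor true c z + inv_tensor true c z *m J
    + Yf^T *m 'D_u (mixed_coeffs c) z *m Yf.
  have nE : \forall w \near z, inv_tensor true c w =
      (fund_mx false c w)^T *m mixed_coeffs c w *m fund_mx false c w.
    by apply: filterS (near_chart_img cz) => w; exact: inv_tensor_mixed_coeffs.
  apply: etrans (near_eq_derive u nE) _.
  apply: etrans (derive_congruence u (hol_fund_mx false ac cz) (hol_mixed_coeffs ac cz)) _.
  exact: congruence_frame (derive_fund_mx_false x ac cz) (inv_tensor_mixed_coeffs ac cz).
have E3 : Yf^T *m 'D_u (mixed_coeffs c) z *m Yf = 0.
  exact: (addrI _ (etrans (esym E2) (etrans E1 (esym (addr0 _))))).
exact: congruence_inj (mul_fund_mx_fund_inv false ac cz) E3.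
Qed.

(** Left invariant fields span all directions. *)
Lemma derive_mixed_coeffs0 c z v : atlas c -> chart_img c z -> 'D_v (mixed_coeffs c) z = 0.
Proof.
move=> ac cz; apply: etrans _ (derive_mixed_coeffs (v *m fund_inv true c z) ac cz).
apply: (congr1 (fun t => 'D_t (mixed_coeffs c) z)).
by rewrite /fund -mulmxA (mul_fund_inv_fund_mx true ac cz) mulmx1.
Qed.

Lemma mixed_coeffs_near_cst c z : atlas c -> chart_img c z ->
  \forall w \near z, mixed_coeffs c w = mixed_coeffs c z.
Proof.
move=> ac cz; have /nbhs_ballP[d d0 hd] := near_chart_img cz.
apply: filterS (nbhsx_ballx z d d0) => w zw.
exact: (@derive0_ball_cst R V _ (mixed_coeffs c) z d (@findim_mx K n n)
  (fun y zy => hol_differentiable (hol_mixed_coeffs ac (hd _ zy)))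
  (fun y zy v => derive_mixed_coeffs0 v ac (hd _ zy)) w zw).
Qed.

Lemma fund_mx_true1 : fund_mx true c1 o = 1%:M.
Proof.
apply: mulmx_ext => x; rewrite mulmx1.
apply: etrans (fundE true x (atlas_chart1 G) (dom_chart1 G)) _.
have nM : \forall w \near o, c1 (act true 1%g (chart_inv c1 w)) = id w.
  apply: filterS (near_chart_img (origin_img G)) => w w1.
  by rewrite /act mul1g (chart_invK w1).
exact: etrans (near_eq_derive x nM) (derive_id o x).
Qed.

(** Differentiating w^-1 * w = 1 at the identity. *)
Lemma fund_mx_false1 : fund_mx false c1 o = - 1%:M.
Proof.
pose M (p : V * V) := c1 ((chart_inv c1 p.1)^-1 * chart_inv c1 p.2)%g.
have hM : hol M (o, o).
  have gho := holG_chart_inv (atlas_chart1 G) (origin_img G).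
  have gh1 : holG (fun p : V * V => chart_inv c1 p.1) (o, o).
    by apply: (holG_comp fV (hol_fst _)).
  have gh2 : holG (fun p : V * V => chart_inv c1 p.2) (o, o).
    by apply: (holG_comp fV (hol_snd _)).
  apply: (holG_hol (holG_mul fVV (holG_inv gh1) gh2) (atlas_chart1 G)) => /=.
  by rewrite mulVg; exact: dom_chart1.
have dM := hol_differentiable hM.
apply: mulmx_ext => x; rewrite mulmxN mulmx1.
have E1 : 'D_(x, 0) M (o, o) = fund false c1 x o.
  apply: etrans (esym (derive_slice1 M o o x)) _.
  apply: etrans _ (esym (fundE false x (atlas_chart1 G) (dom_chart1 G))).
  apply: near_eq_derive; apply: filterS (near_chart_img (origin_img G)) => w _.
  by rewrite /M /act /= chart1_invo.
have E2 : 'D_(0, x) M (o, o) = x.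
  apply: etrans (esym (derive_slice2 M o o x)) _.
  have nM : \forall w \near o, M (o, w) = id w.
    apply: filterS (near_chart_img (origin_img G)) => w w1.
    by rewrite /M /= chart1_invo invg1 mul1g (chart_invK w1).
  exact: etrans (near_eq_derive x nM) (derive_id o x).
have hD : hol (fun w : V => (w, w)) o by apply: hol_pair; exact: hol_id.
(* M is constant on the diagonal. *)
have E3 : 'D_(x, x) M (o, o) = 0.
  have DD : 'D_x (fun w : V => (w, w)) o = (x, x).
    rewrite (deriveE _ (hol_differentiable hD)) diff_pair; last 2 first.
    - exact: hol_differentiable (hol_id o).
    - exact: hol_differentiable (hol_id o).
    by rewrite -!deriveE ?derive_id//; exact: hol_differentiable (hol_id o).
  rewrite -DD; apply: etrans (esym (derive_chain x (hol_differentiable hD) dM)) _.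
  have nM : \forall w \near o, M (w, w) = cst o w.
    apply: filterS (near_chart_img (origin_img G)) => w _.
    by rewrite /M /= mulVg.
  exact: etrans (near_eq_derive x nM) (derive_cst o o x).
have E4 : 'D_(x, x) M (o, o) = 'D_(x, 0) M (o, o) + 'D_(0, x) M (o, o).
  apply: etrans _ (derive_dirD (x, 0) (0, x) dM).
  by congr ('D_ _ M (o, o)); congr pair; rewrite /= ?addr0 ?add0r.
apply: etrans (esym E1) _; apply: (addIr x).
by rewrite addNr -{2}E2 -[LHS]E4 E3.
Qed.

Lemma congruenceN (A : 'M[K]_n) : (- A)^T *m s *m (- A) = A^T *m s *m A.
Proof. by rewrite mulmxN [(- A)^T]linearN /= !mulNmx opprK. Qed.

Lemma inv_tensor_chart_change b c d g : atlas c -> atlas d -> chart_dom c g -> chart_dom d g ->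
  let J := Jac (fun z => d (chart_inv c z)) (c g) in
  inv_tensor b d (d g) = J^T *m inv_tensor b c (c g) *m J.
Proof.
move=> ac ad cg dg J; rewrite /inv_tensor (fund_mx_chart_change b ac ad cg dg) -/J.
by rewrite trmx_mul !mulmxA.
Qed.

Lemma inv_tensor_eq_charts c g : atlas c -> chart_dom c g ->
  inv_tensor true c (c g) = inv_tensor false c (c g) ->
  forall d, atlas d -> chart_dom d g -> inv_tensor true d (d g) = inv_tensor false d (d g).
Proof.
move=> ac cg E d ad dg.
apply: etrans (inv_tensor_chart_change true ac ad cg dg) _.
apply: etrans _ (esym (inv_tensor_chart_change false ac ad cg dg)).
exact: (congr1 (fun S => _^T *m S *m _) E).
Qed.

Lemma mixed_coeffs_eq c z : atlas c -> chart_img c z ->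
  (inv_tensor true c z = inv_tensor false c z) <-> mixed_coeffs c z = s.
Proof.
move=> ac cz; split=> [E|E]; last first.
  apply: etrans (inv_tensor_mixed_coeffs ac cz) _.
  exact: (congr1 (fun S => (fund_mx false c z)^T *m S *m fund_mx false c z) E).
apply: etrans (congr1 (fun S => (fund_inv false c z)^T *m S *m fund_inv false c z) E) _.
rewrite /inv_tensor; move: (mul_fund_mx_fund_inv false ac cz).
move: (fund_inv false c z) (fund_mx false c z) => T A TA.
by rewrite !mulmxA -trmx_mul TA trmx1 mul1mx -mulmxA TA mulmx1.
Qed.

(** Ad-invariance of s. The components of one invariant tensor in a frame of
    the other kind are locally constant, and equal to s at the identity;
    connectedness spreads this over the group. *)
Lemma inv_tensor_eq : connected [set: G] -> forall c g, atlas c -> chart_dom c g ->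
  inv_tensor true c (c g) = inv_tensor false c (c g).
Proof.
move=> Gconn.
pose P := [set g : G | forall c, atlas c -> chart_dom c g ->
  inv_tensor true c (c g) = inv_tensor false c (c g)].
(* In a chart at g, the property P says that mixed_coeffs is equal to s. *)
have nearP g : \forall h \near g, P g <-> P h.
  pose c : gchart := chart_at g.
  have ac : atlas c := atlas_chart_at _.
  have cg : chart_dom c g := mem_chart_at g.
  have nq : \forall h \near g, mixed_coeffs c (c h) = mixed_coeffs c (c g).
    exact: (chart_map_continuous_at cg (mixed_coeffs_near_cst ac (mem_chart_img cg))).
  apply: filterS2 nq (near_chart_dom cg) => h qh ch.
  have Pq k : chart_dom c k -> P k <-> mixed_coeffs c (c k) = s.
    move=> ck; split=> [Pk|qk].
      exact: (mixed_coeffs_eq ac (mem_chart_img ck)).1 (Pk c ac ck).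
    have Sk := (mixed_coeffs_eq ac (mem_chart_img ck)).2 qk.
    exact: inv_tensor_eq_charts ac ck Sk.
  split=> [Pg|Ph].
    exact: (Pq h ch).2 (etrans qh ((Pq g cg).1 Pg)).
  exact: (Pq g cg).2 (etrans (esym qh) ((Pq h ch).1 Ph)).
have So : inv_tensor true c1 o = inv_tensor false c1 o.
  by rewrite /inv_tensor fund_mx_true1 fund_mx_false1 congruenceN.
have P1 : P 1%g := inv_tensor_eq_charts (atlas_chart1 G) (dom_chart1 G) So.
by move=> c g; exact: (connected_locally_constant Gconn P1 nearP g c).
Qed.

End symmetric_part.

(** * Fundamental fields on a power of the group *)

Local Opaque lie_bracket ad_mx.

Section power_fields.
Variables (R : realType) (n : nat) (G : complexLieGroupType R n) (E : finType).
Notation K := (Cplx R).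
Notation V := 'rV[K]_n.
Notation N := (#|E| * n)%N.
Notation W := 'rV[K]_N.
Notation gchart := (chart G [set: V]).
Notation e_ := (@basis_vec K n).
Notation o := (origin G).
Notation c1 := (chart1 G).
Notation br := (@lie_bracket R n G).
Notation H := (E * bool)%type.
Implicit Types (x y : V) (z : W) (h : H).

Let fV : findim V := @findim_mx K 1 n.
Let fW : findim W := @findim_mx K 1 N.

Lemma coords_at_single (e e' : E) x :
  coords_at e' (single_coords e x : W) = if e' == e then x else 0.
Proof. by rewrite /single_coords join_coordsK. Qed.

Lemma single_coords0 (e : E) : single_coords e 0 = 0 :> W.
Proof. exact: linear0. Qed.

Lemma single_coordsB (e : E) x y :
  single_coords e (x - y) = single_coords e x - single_coords e y :> W.
Proof. exact: linearB. Qed.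

Definition single_mx (e : E) : 'M[K]_(n, N) := lin1_mx (@single_coords R n E e).

Lemma single_mxE e x : x *m single_mx e = single_coords e x.
Proof. exact: mul_rV_lin1. Qed.

Lemma hol_coords_at e z : hol (@coords_at R n E e) z.
Proof. by apply: hol_linear; exact: rV_linear_continuous. Qed.

Variable ce : E -> gchart.

(** The matrix whose rows are the coordinates, in the chart power_chart ce, of
    the vector fields induced by a basis of the copy of the Lie algebra
    attached to h. *)
Definition frame h z : 'M[K]_(n, N) :=
  fund_mx h.2 (ce h.1) (coords_at h.1 z) *m single_mx h.1.

Definition edge_field h x z : W := x *m frame h z.

Lemma edge_fieldE h x z : edge_field h x z =
  single_coords h.1 (fund h.2 (ce h.1) x (coords_at h.1 z)).
Proof. by rewrite /edge_field /frame mulmxA single_mxE. Qed.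

Hypothesis ace : forall e, atlas (ce e).

Lemma hol_frame h z : chart_img (ce h.1) (coords_at h.1 z) -> hol (frame h) z.
Proof.
move=> cz; apply: hol_mulmx; last exact: hol_cst.
have hY := hol_fund_mx h.2 (ace h.1) cz.
exact: (@hol_comp _ _ _ _ (fund_mx h.2 (ce h.1)) _ z fV (@findim_mx K n n)
  (hol_coords_at h.1 z) hY).
Qed.

Lemma hol_edge_field h x z : chart_img (ce h.1) (coords_at h.1 z) -> hol (edge_field h x) z.
Proof. by move=> cz; apply: hol_mulmx; [exact: hol_cst|exact: hol_frame]. Qed.

Lemma derive_edge_field h x z v : chart_img (ce h.1) (coords_at h.1 z) ->
  'D_v (edge_field h x) z =
  single_coords h.1 ('D_(coords_at h.1 v) (fund h.2 (ce h.1) x) (coords_at h.1 z)).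
Proof.
move=> cz; have hY := hol_fund h.2 x (ace h.1) cz.
have cL : continuous (@single_coords R n E h.1) := @rV_linear_continuous _ _ _ _.
have hYc : hol (fun z => fund h.2 (ce h.1) x (coords_at h.1 z)) z.
  exact: (@hol_comp _ _ _ _ (fund h.2 (ce h.1) x) _ z fV fV (hol_coords_at h.1 z) hY).
have -> : edge_field h x = fun z => single_coords h.1 (fund h.2 (ce h.1) x (coords_at h.1 z)).
  by apply/funext => w; exact: edge_fieldE.
apply: etrans (derive_lcomp cL (hol_derivable v hYc)) _.
apply: (congr1 (single_coords h.1)).
apply: etrans (derive_chain v (hol_differentiable (hol_coords_at h.1 z)) (hol_differentiable hY)) _.
apply: (congr1 (fun t => 'D_t (fund h.2 (ce h.1) x) (coords_at h.1 z))).
by apply: derive_linear; exact: rV_linear_continuous.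
Qed.

(** On distinct edges the fields depend on distinct coordinates; on the same
    edge this is fund_bracket or fund_commute. *)
Lemma edge_field_bracket h h' x y z : (forall e, chart_img (ce e) (coords_at e z)) ->
  field_bracket (edge_field h x) (edge_field h' y) z =
  if h == h' then edge_field h (br x y) z else 0.
Proof.
move=> cz; case: h h' => [e b] [e' b'].
apply: etrans (congr2 (fun p q => p - q)
   (@derive_edge_field (e', b') y z (edge_field (e, b) x z) (cz e'))
   (@derive_edge_field (e, b) x z (edge_field (e', b') y z) (cz e))) _.
rewrite !edge_fieldE /= !coords_at_single xpair_eqE.
have [<-|ne] := eqVneq e e'; last first.
  apply: etrans (congr2 (fun p q => single_coords e' p - single_coords e q)
    (derive0 _ _) (derive0 _ _)) _.
  by rewrite !single_coords0 subrr.
rewrite -single_coordsB.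
have [<-|nb] := eqVneq b b' => /=.
  exact: (congr1 (single_coords e) (fund_bracket b x y (ace e) (cz e))).
have -> : b' = ~~ b by case: b b' nb => [] [].
apply: etrans (congr1 (single_coords e) (fund_commute b x y (ace e) (cz e))) _.
exact: single_coords0.
Qed.

End power_fields.

(** * The infinitesimal action in coordinates *)

Section sigma_coordinates.
Variables (R : realType) (n : nat) (G : complexLieGroupType R n) (E : finType).
Notation K := (Cplx R).
Notation V := 'rV[K]_n.
Notation N := (#|E| * n)%N.
Notation W := 'rV[K]_N.
Notation gchart := (chart G [set: V]).
Notation P := {ptws E -> G}.
Notation o := (origin G).
Notation c1 := (chart1 G).
Notation H := (E * bool)%type.
Variable expG : tangent (1%g : G) -> G.
Hypothesis expP : exponential_map expG.
Implicit Types (c : gchart) (g : G) (a : P) (b : bool) (x y : V) (h : H).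

Let fV : findim V := @findim_mx K 1 n.
Let fW : findim W := @findim_mx K 1 N.
Let fK : findim K := @findim_K K.

Lemma exp0 : expG (0 : V) = 1%g.
Proof.
have [/(_ 0 0) + _ _ _] := expP (0 : V); rewrite addr0 scale0r => E0.
by apply: (mulgI (expG (0 : V))); rewrite mulg1 -E0.
Qed.

Lemma holG_exp x : holG (fun t : K => expG (t *: x)) 0.
Proof.
have [_ cx hx _] := expP x; split; first exact: cx.
by move=> c ac c0; have /holomorphicP[_] := hx c ac; exact.
Qed.

Lemma derive_exp x : 'D_1 (fun t : K => c1 (expG (t *: x))) 0 = x.
Proof. by have [_ _ _ vx] := expP x; exact: etrans (esym (derive1E _ _)) vx. Qed.

Lemma holG_act_exp b g x : holG (fun t : K => act b g (expG (t *: x))) 0.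
Proof. by apply: (holG_act b fK); [exact: holG_cst|exact: holG_exp]. Qed.

Lemma act_exp0 b g x : act b g (expG ((0 : K) *: x)) = g.
Proof. by rewrite scale0r exp0 act1. Qed.

Lemma hol_act_exp b c g x : atlas c -> chart_dom c g ->
  hol (fun t : K => c (act b g (expG (t *: x)))) 0.
Proof. by move=> ac cg; apply: (holG_hol (holG_act_exp b g x) ac); rewrite act_exp0. Qed.

Lemma derive_act_exp b c g x : atlas c -> chart_dom c g ->
  'D_1 (fun t : K => c (act b g (expG (t *: x)))) 0 = fund b c x (c g).
Proof.
move=> ac cg.
pose F w := c (act b g (chart_inv c1 w)).
pose u (t : K) := c1 (expG (t *: x)).
have e1 : chart_dom c1 (expG ((0 : K) *: x)) by rewrite scale0r exp0; exact: dom_chart1.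
have hu : hol u 0 := holG_hol (holG_exp x) (atlas_chart1 G) e1.
have u0 : u 0 = o by rewrite /u scale0r exp0.
have nE : \forall t \near (0 : K), c (act b g (expG (t *: x))) = F (u t).
  apply: filterS (holG_near_dom (holG_exp x) e1) => t t1.
  by rewrite /F /u (chart_mapK t1).
pose F' (t : K) := F (u t).
have dF : differentiable F (u 0).
  by rewrite u0; exact: hol_differentiable (hol_orbit b ac cg).
apply: etrans (@near_eq_derive K K _ _ F' 0 (1 : K) nE) _.
apply: etrans (@derive_chain K K V V F u 0 1 (hol_differentiable hu) dF) _.
have Eu : 'D_1 u 0 = x := derive_exp x.
rewrite Eu u0.
exact: esym (fundE b x ac cg).
Qed.

Definition sigma_curve h x a (t : K) : P :=
  sigma_group a (fun k : H => expG (t *: inj1 h x k)).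

Lemma sigma_curveE e b x a t e' : sigma_curve (e, b) x a t e' =
  if e' == e then act b (a e) (expG (t *: x)) else a e'.
Proof.
rewrite /sigma_curve /sigma_group !ffunE !xpair_eqE.
have [->|ne] := eqVneq e' e => /=; last by rewrite scaler0 exp0 invg1 mul1g mulg1.
by case: b => /=; rewrite /act scaler0 exp0 ?invg1 ?mul1g ?mulg1.
Qed.

Lemma sigma_curve0 h x a : sigma_curve h x a 0 = a.
Proof.
case: h => e b; apply/funext => e'; rewrite sigma_curveE act_exp0.
by case: eqVneq => [->|].
Qed.

Variable ce : E -> gchart.
Hypothesis ace : forall e, atlas (ce e).
Notation c := (power_chart ce).

Lemma power_atlas_chart : atlas (c : chart P [set: W]).
Proof. by exists ce. Qed.

Lemma power_map_curve e b x a t : c (sigma_curve (e, b) x a t) =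
  \sum_(e' | e' != e) single_coords e' (ce e' (a e'))
  + single_coords e (ce e (act b (a e) (expG (t *: x)))).
Proof.
rewrite /= /power_map join_coords_sum (bigD1 e)//= addrC sigma_curveE eqxx.
congr (_ + _); apply: eq_bigr => e' ne.
by rewrite sigma_curveE (negPf ne).
Qed.

Lemma derive_sigma_curve h x a : power_dom ce a ->
  hol (fun t : K => c (sigma_curve h x a t)) 0 /\
  'D_1 (fun t : K => c (sigma_curve h x a t)) 0 = edge_field ce h x (c a).
Proof.
case: h => e b ca.
have -> : (fun t : K => c (sigma_curve (e, b) x a t)) = (fun t : K =>
    \sum_(e' | e' != e) single_coords e' (ce e' (a e'))
    + single_coords e (ce e (act b (a e) (expG (t *: x))))).
  by apply/funext => t; exact: power_map_curve.
move: (\sum_(e' | _) _) => k.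
have cL : continuous (@single_coords R n E e) := @rV_linear_continuous _ _ _ _.
have h1 := hol_act_exp b x (ace e) (ca e).
have h2 : hol (fun t : K => single_coords e (ce e (act b (a e) (expG (t *: x)))) : W) 0.
  exact: hol_lcomp cL h1.
split; first by apply: hol_add => //; exact: hol_cst.
pose phi (t : K) : V := ce e (act b (a e) (expG (t *: x))).
pose psi (t : K) : W := single_coords e (phi t).
have D1 : 'D_1 (fun t : K => k + psi t) 0 = 'D_1 (fun _ : K => k) 0 + 'D_1 psi 0.
  exact: (@deriveD K K W (fun=> k) psi 0 1 (@derivable_cst K K W k 0 1) (hol_derivable (1 : K) h2)).
apply: etrans D1 _.
apply: etrans (congr1 (fun p => p + 'D_1 psi 0) (@derive_cst K K W k 0 1)) _.
apply: etrans (add0r _) _.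
apply: etrans (@derive_lcomp K K V W _ phi 0 1 cL (hol_derivable (1 : K) h1)) _.
apply: etrans (congr1 (single_coords e) (derive_act_exp b x (ace e) (ca e))) _.
by rewrite edge_fieldE /= join_coordsK.
Qed.

Lemma near_sigma_curve h x a (ce' : E -> gchart) : power_dom ce' a ->
  \forall t \near (0 : K), power_dom ce' (sigma_curve h x a t).
Proof.
case: h => e b ca.
have ca0 : chart_dom (ce' e) (act b (a e) (expG ((0 : K) *: x))) by rewrite act_exp0.
apply: filterS (holG_near_dom (holG_act_exp b (a e) x) ca0) => t ct e'.
by rewrite sigma_curveE; have [->|] := eqVneq e' e.
Qed.

End sigma_coordinates.

Section sigma_field_coordinates.
Variables (R : realType) (n : nat) (G : complexLieGroupType R n) (E : finType).
Notation K := (Cplx R).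
Notation V := 'rV[K]_n.
Notation N := (#|E| * n)%N.
Notation W := 'rV[K]_N.
Notation gchart := (chart G [set: V]).
Notation P := {ptws E -> G}.
Notation H := (E * bool)%type.
Variable expG : tangent (1%g : G) -> G.
Hypothesis expP : exponential_map expG.
Implicit Types (a : P) (x : V) (h : H).

Lemma sigma_field_at a h x (ce := fun e => chart_at (a e) : gchart) :
  sigma_field expG (inj1 h x) a = edge_field ce h x (power_chart ce a).
Proof.
have ace e : atlas (ce e) by exact: atlas_chart_at.
have ca : power_dom ce a by move=> e; exact: mem_chart_at.
have [_ <-] := derive_sigma_curve expP ace h x ca.
by rewrite /sigma_field /velocity derive1E.
Qed.

Lemma sigma_field_coords a h x (ce : E -> gchart) : (forall e, atlas (ce e)) ->
  power_dom ce a ->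
  tangent_coords (power_chart ce : chart P [set: W]) (sigma_field expG (inj1 h x) a)
  = edge_field ce h x (power_chart ce a).
Proof.
move=> ace ca; pose da e : gchart := chart_at (a e).
have ada e : atlas (da e) by exact: atlas_chart_at.
have daa : power_dom da a by move=> e; exact: mem_chart_at.
rewrite sigma_field_at /tangent_coords.
pose d : chart P [set: W] := power_chart da.
pose c : chart P [set: W] := power_chart ce.
have hT : hol (fun z => c (chart_inv d z)) (d a).
  apply: hol_transition; [exact: power_atlas_chart|exact: power_atlas_chart|exact: mem_chart_img|].
  by rewrite (chart_mapK (c := d)).
have [hd Dd] := derive_sigma_curve expP ada h x daa.
have [hc Dc] := derive_sigma_curve expP ace h x ca.
have d0 : d (sigma_curve expG h x a 0) = d a by rewrite sigma_curve0.
have nE : \forall t \near (0 : K), c (sigma_curve expG h x a t) =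
    (fun z => c (chart_inv d z)) (d (sigma_curve expG h x a t)).
  apply: filterS (near_sigma_curve expP h x daa) => t dt.
  by rewrite (chart_mapK (c := d)).
have dT : differentiable (fun z => c (chart_inv d z)) (d (sigma_curve expG h x a 0)).
  by rewrite d0; exact: hol_differentiable hT.
rewrite -(deriveE _ (hol_differentiable hT)).
apply: etrans (congr1 (fun v => 'D_v (fun z => c (chart_inv d z)) (d a)) (esym Dd)) _.
apply: etrans (congr1 (fun q => derive (fun z => c (chart_inv d z)) q _) (esym d0)) _.
apply: etrans (esym (@derive_chain K K W W (fun z => c (chart_inv d z))
  (fun t => d (sigma_curve expG h x a t)) 0 1 (hol_differentiable hd) dT)) _.
exact: etrans (esym (@near_eq_derive K K W _ _ 0 1 nE)) Dc.
Qed.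
End sigma_field_coordinates.

(** * The Yang-Baxter equation with signs *)

Section rmatrix_components.
Variables (K : numFieldType) (n : nat) (br : 'rV[K]_n -> 'rV[K]_n -> 'rV[K]_n).
Variable ad : 'rV[K]_n -> 'M[K]_n.
Hypothesis br_ad : forall x y, br x y = y *m ad x.
Hypothesis brC : forall x y, br x y = - br y x.
Notation e_ := (@basis_vec K n).
Implicit Types (A B s L : 'M[K]_n) (p q r t u : 'I_n).

Definition str_const q r t : K := br (e_ q) (e_ r) 0 t.

Lemma str_constC q r t : str_const q r t = - str_const r q t.
Proof. by rewrite /str_const brC mxE. Qed.

Lemma str_const_ad q r t : str_const q r t = ad (e_ q) r t.
Proof. by rewrite /str_const br_ad /basis_vec -rowE mxE. Qed.

Lemma br_str_const (x y : 'rV[K]_n) t :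
  br x y 0 t = \sum_q \sum_r x 0 q * y 0 r * str_const q r t.
Proof.
have brr (v w : 'rV[K]_n) : br v w 0 t = \sum_r w 0 r * br v (e_ r) 0 t.
  rewrite br_ad mxE; apply: eq_bigr => r _.
  by rewrite br_ad /basis_vec -rowE mxE.
rewrite brr exchange_big /=; apply: eq_bigr => r _.
rewrite brC mxE brr mulrN -mulNr mulr_sumr; apply: eq_bigr => q _.
by rewrite -/(str_const r q t) (str_constC r q); ring.
Qed.

(** The (p, t, u) component of [A_12, B_23]. *)
Definition br12_23 A B p t u : K := \sum_q \sum_r A p q * B r u * str_const q r t.

(** The (p, t, u) component of [A_12, A_13]. *)
Definition br12_13 A p t u : K := \sum_q \sum_r A q t * A r u * str_const q r p.

Lemma sum2_swap (F : 'I_n -> 'I_n -> K) : \sum_q \sum_r F q r = \sum_q \sum_r F r q.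
Proof. exact: exchange_big. Qed.

Lemma br12_13_swap A p t u : br12_13 A p t u = - br12_13 A p u t.
Proof.
rewrite /br12_13 sum2_swap -sumrN; apply: eq_bigr => q _; rewrite -sumrN.
by apply: eq_bigr => r _; rewrite str_constC mulrN [A r t * _]mulrC.
Qed.

Lemma br12_23_skew L p t u : L^T = - L -> br12_23 L L p t u = br12_13 L t u p.
Proof.
move=> Lsk; rewrite br12_13_swap -sumrN; apply: eq_bigr => q _.
rewrite -sumrN; apply: eq_bigr => r _.
have -> : L p q = - L q p by rewrite -[L in RHS]opprK -Lsk !mxE opprK.
by rewrite !mulNr.
Qed.

Lemma br12_23DZ A B A' B' (a b : K) p t u : br12_23 (A + a *: A') (B + b *: B') p t u =
  br12_23 A B p t u + b * br12_23 A B' p t u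
  + (a * br12_23 A' B p t u + a * b * br12_23 A' B' p t u).
Proof.
rewrite /br12_23 !mulr_sumr -!big_split /=; apply: eq_bigr => q _.
rewrite !mulr_sumr -!big_split /=; apply: eq_bigr => r _.
by rewrite !mxE; ring.
Qed.

Section invariance.
Variable s : 'M[K]_n.
Hypothesis s_sym : s^T = s.
Hypothesis s_ad : forall x, (ad x)^T *m s + s *m ad x = 0.

Lemma s_symE p q : s p q = s q p. Proof. by rewrite -[in LHS]s_sym mxE. Qed.

Lemma invariant_str_const r p t :
  \sum_q s p q * str_const q r t + \sum_q s q t * str_const q r p = 0.
Proof.
have /matrixP/(_ p t) := s_ad (e_ r); rewrite !mxE => E.
apply: oppr_inj; rewrite oppr0 -[RHS]E opprD [LHS]addrC -!sumrN; congr (_ + _).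
  by apply: eq_bigr => q _; rewrite ?mxE str_constC mulrN opprK str_const_ad mulrC.
by apply: eq_bigr => q _; rewrite str_constC mulrN opprK str_const_ad.
Qed.

(** By invariance, the bracket with a leg of the second factor moves from one
    leg of the first factor to the other. *)
Lemma br12_23_sym p t u : br12_23 s s p t u = - br12_13 s p t u.
Proof.
rewrite /br12_23 /br12_13 sum2_swap [in RHS]sum2_swap -sumrN; apply: eq_bigr => r _.
have E := invariant_str_const r p t.
rewrite (eq_bigr (fun q => s r u * (s p q * str_const q r t))); last by move=> q _; ring.
have {}E : \sum_q s p q * str_const q r t = - \sum_q s q t * str_const q r p.
  by rewrite -(addr0_eq E) opprK.
rewrite -mulr_sumr E mulrN mulr_sumr; congr (- _); apply: eq_bigr => q _.
by ring.
Qed.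

Lemma br12_23_sym_cyclic p t u : br12_23 s s p t u = br12_23 s s t u p.
Proof.
rewrite [RHS]br12_23_sym br12_13_swap opprK /br12_23 /br12_13; apply: eq_bigr => q _.
by apply: eq_bigr => r _; rewrite (s_symE p).
Qed.

(** By invariance again, the bracket with a leg of L moves from one leg of s to
    the other. *)
Lemma br12_23_mixed L p t u : L^T = - L -> br12_23 s L p t u + br12_23 L s u p t = 0.
Proof.
move=> Lsk.
have LE a b : L a b = - L b a by rewrite -[L in RHS]opprK -Lsk !mxE opprK.
have -> : br12_23 L s u p t = \sum_q \sum_r L r u * (s q t * str_const q r p).
  rewrite /br12_23 sum2_swap; apply: eq_bigr => q _; apply: eq_bigr => r _.
  by rewrite (LE u r) (str_constC r q); ring.
have -> : br12_23 s L p t u = \sum_q \sum_r L r u * (s p q * str_const q r t).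
  by apply: eq_bigr => q _; apply: eq_bigr => r _; ring.
rewrite sum2_swap [X in _ + X]sum2_swap -big_split big1// => r _ /=.
by rewrite -!mulr_sumr -mulrDr invariant_str_const mulr0.
Qed.

(** The terms in L alone are given by the Yang-Baxter equation for s + L, the
    mixed terms cancel in pairs, and the terms in s alone are all equal to
    [s_12, s_23]. *)
Lemma yang_baxter_signs L (ab bc ca : K) p t u : L^T = - L ->
  br12_13 L p t u + br12_13 L t u p + br12_13 L u p t + br12_13 s p t u = 0 ->
  br12_23 (L + ab *: s) (L + bc *: s) p t u + br12_23 (L + bc *: s) (L + ca *: s) t u p
    + br12_23 (L + ca *: s) (L + ab *: s) u p t
  = (1 + ab * bc + bc * ca + ca * ab) * br12_23 s s p t u.
Proof.
move=> Lsk CYB; rewrite !br12_23DZ.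
have c1 := br12_23_mixed p t u Lsk; have c2 := br12_23_mixed t u p Lsk.
have c3 := br12_23_mixed u p t Lsk.
have d1 := br12_23_sym_cyclic p t u; have d2 := br12_23_sym_cyclic t u p.
have LL : br12_23 L L p t u + br12_23 L L t u p + br12_23 L L u p t = br12_23 s s p t u.
  rewrite !(br12_23_skew _ _ _ Lsk) br12_23_sym; apply/eqP; rewrite -addr_eq0 -CYB.
  by apply/eqP; ring.
rewrite -d2 -d1 -LL.
have -> : br12_23 L s u p t = - br12_23 s L p t u := esym (addr0_eq c1).
have -> : br12_23 L s p t u = - br12_23 s L t u p := esym (addr0_eq c2).
have -> : br12_23 L s t u p = - br12_23 s L u p t := esym (addr0_eq c3).
by ring.
Qed.

End invariance.
End rmatrix_components.

Section quasitriangular_components.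
Variables (K : numFieldType) (n : nat) (br : 'rV[K]_n -> 'rV[K]_n -> 'rV[K]_n).
Variable ad : 'rV[K]_n -> 'M[K]_n.
Hypothesis br_ad : forall x y, br x y = y *m ad x.
Hypothesis brC : forall x y, br x y = - br y x.
Notation e_ := (@basis_vec K n).
Notation str_const := (str_const br).
Notation br12_13 := (br12_13 br).
Variable L : 'M[K]_n.
Hypothesis Lsk : L^T = - L.

Lemma skewE a b : L a b = - L b a.
Proof. by rewrite -[L in RHS]opprK -Lsk !mxE opprK. Qed.

Lemma sum_lt_half (F : 'I_n -> 'I_n -> K) : (forall a b, F a b = F b a) ->
  (forall a, F a a = 0) ->
  (\sum_(a < n) \sum_(b < n | (a < b)%N) F a b) *+ 2 = \sum_a \sum_b F a b.
Proof.
move=> FC F0; rewrite mulr2n [X in _ + X](exchange_big_dep xpredT)//= -big_split /=.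
apply: eq_bigr => a _; rewrite [RHS](bigID (fun b : 'I_n => (a < b)%N)) /=; congr (_ + _).
rewrite [RHS](bigID (fun b : 'I_n => (b < a)%N)) /= [X in _ = _ + X]big1 ?addr0.
  apply: eq_big => [b|b _]; last exact: FC.
  by rewrite -leqNgt andbC; case: (ltnP b a) => //= ba; rewrite (ltnW ba).
move=> b; rewrite -!leqNgt => /andP[ba ab].
by have -> : b = a by apply/val_inj/eqP; rewrite eqn_leq ba ab.
Qed.

Lemma sum_delta (F : 'I_n -> K) j : \sum_b F b * (j == b)%:R = F j.
Proof.
rewrite (bigD1 j)//= eqxx mulr1 big1 ?addr0// => b bj.
by rewrite eq_sym (negPf bj) mulr0.
Qed.

Lemma sum4_delta (f : 'I_n -> 'I_n -> K) j k :
  \sum_a \sum_b \sum_c \sum_d L a b * L c d * (f a c * (j == b)%:R * (k == d)%:R)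
  = \sum_a \sum_c L a j * L c k * f a c.
Proof.
apply: eq_bigr => a _; rewrite exchange_big /=; apply: eq_bigr => c _.
rewrite (eq_bigr (fun b => (L a b * L c k * f a c) * (j == b)%:R)) ?sum_delta// => b _.
rewrite (eq_bigr (fun d => (L a b * L c d * f a c * (j == b)%:R) * (k == d)%:R)).
  by rewrite sum_delta.
by move=> d _; ring.
Qed.

Lemma basis_vecE b j : e_ b 0 j = (j == b)%:R.
Proof. by rewrite /basis_vec mxE eqxx. Qed.

(** By skewness the sum over i < j and k < l is a quarter of the sum over all
    indices, in which the four terms of the bracket contribute equally; a
    wedge then has three pairs of equal terms. *)
Lemma schouten2_br12_13 i j k :
  schouten2 br L L (i, j, k) = (br12_13 L i j k + br12_13 L j k i + br12_13 L k i j) *+ 2.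
Proof.
pose M a b c d := wedge3 (br (e_ a) (e_ c)) (e_ b) (e_ d) (i, j, k).
pose S a b c d := schouten_decomposable br (e_ a) (e_ b) (e_ c) (e_ d) (i, j, k).
have SE a b c d : S a b c d = M a b c d - M a b d c - M b a c d + M b a d c.
  by rewrite /S /M /schouten_decomposable !ffunE.
have -> : schouten2 br L L (i, j, k) = \sum_(a < n) \sum_(b < n | (a < b)%N)
    \sum_(c < n) \sum_(d < n | (c < d)%N) L a b * L c d * S a b c d by rewrite ffunE.
pose T := \sum_a \sum_b \sum_c \sum_d L a b * L c d * M a b c d.
have sum_all : (\sum_(a < n) \sum_(b < n | (a < b)%N)
    \sum_(c < n) \sum_(d < n | (c < d)%N) L a b * L c d * S a b c d) *+ 2 *+ 2 = T *+ 2 *+ 2.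
  rewrite sum_lt_half; last 2 first.
  - move=> a b; apply: eq_bigr => c _; apply: eq_bigr => d _.
    by rewrite !SE (skewE a b); ring.
  - move=> a; apply: big1 => c _; apply: big1 => d _.
    by rewrite SE; ring.
  have -> : (\sum_a \sum_b \sum_(c < n) \sum_(d < n | (c < d)%N) L a b * L c d * S a b c d) *+ 2 =
     \sum_a \sum_b \sum_c \sum_d L a b * L c d * S a b c d.
    rewrite -sumrMnl; apply: eq_bigr => a _; rewrite -sumrMnl; apply: eq_bigr => b _.
    apply: sum_lt_half => [c d|c]; first by rewrite !SE (skewE c d); ring.
    by rewrite SE; ring.
  have T2 : \sum_a \sum_b \sum_c \sum_d L a b * L c d * M a b d c = - T.
    rewrite /T -sumrN; apply: eq_bigr => a _; rewrite -sumrN; apply: eq_bigr => b _.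
    rewrite exchange_big -sumrN; apply: eq_bigr => c _; rewrite -sumrN /=.
    by apply: eq_bigr => d _; rewrite (skewE d c); ring.
  have T3 : \sum_a \sum_b \sum_c \sum_d L a b * L c d * M b a c d = - T.
    rewrite /T exchange_big -sumrN; apply: eq_bigr => a _; rewrite -sumrN /=.
    apply: eq_bigr => b _; rewrite -sumrN; apply: eq_bigr => c _; rewrite -sumrN.
    by apply: eq_bigr => d _; rewrite (skewE b a); ring.
  have contracted12_23 : \sum_a \sum_b \sum_c \sum_d L a b * L c d * M b a d c = T.
    rewrite -[T]opprK -T3 -sumrN; apply: eq_bigr => a _; rewrite -sumrN.
    apply: eq_bigr => b _; rewrite exchange_big -sumrN; apply: eq_bigr => c _.
    by rewrite -sumrN /=; apply: eq_bigr => d _; rewrite (skewE d c); ring.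
  have -> : T *+ 2 *+ 2 = T - (- T) - (- T) + T by rewrite !mulr2n; ring.
  rewrite -{1}T2 -{1}T3 -{2}contracted12_23 /T -!sumrN -!big_split; apply: eq_bigr => a _.
  rewrite -!sumrN -!big_split; apply: eq_bigr => b _.
  rewrite -!sumrN -!big_split; apply: eq_bigr => c _.
  rewrite -!sumrN -!big_split; apply: eq_bigr => d _ /=.
  by rewrite SE; ring.
have TW : T = (br12_13 L i j k + br12_13 L j k i + br12_13 L k i j) *+ 2.
  have -> : T = br12_13 L i j k + br12_13 L k i j + br12_13 L j k i
      - br12_13 L j i k - br12_13 L i k j - br12_13 L k j i.
    have D p t u : br12_13 L p t u = \sum_a \sum_b \sum_c \sum_d
        L a b * L c d * (str_const a c p * (t == b)%:R * (u == d)%:R).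
      by rewrite sum4_delta.
    rewrite !D /T -!sumrN -!big_split; apply: eq_bigr => a _.
    rewrite -!sumrN -!big_split; apply: eq_bigr => b _.
    rewrite -!sumrN -!big_split; apply: eq_bigr => c _.
    rewrite -!sumrN -!big_split; apply: eq_bigr => d _ /=.
    rewrite /M /wedge3 /tens3 !ffunE /= !basis_vecE.
    rewrite -!/(str_const _ _ _); ring.
  rewrite (br12_13_swap brC L j i k) (br12_13_swap brC L i k j) (br12_13_swap brC L k j i).
  by rewrite mulr2n; ring.
rewrite -TW; apply: (mulIf (x := 4%:R)); first by rewrite pnatr_eq0.
by rewrite !mulr_natr -[4%N]/(2 * 2)%N !mulrnA sum_all.
Qed.

Lemma phi_br12_13 s i j k : s^T = s -> phi br s (i, j, k) = br12_13 s i j k *+ 2.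
Proof.
move=> s_sym; rewrite ffunE /= (br_str_const br_ad brC) mulr_natl; congr (_ *+ 2).
apply: eq_bigr => q _; apply: eq_bigr => r _.
rewrite /sharp /basis_vec -!rowE !mxE.
by rewrite -[in LHS]s_sym !mxE.
Qed.

Lemma quasitriangular_br12_13 s p t u : s^T = s -> schouten2 br L L + phi br s = 0 ->
  br12_13 L p t u + br12_13 L t u p + br12_13 L u p t + br12_13 s p t u = 0.
Proof.
move=> s_sym /ffunP/(_ (p, t, u)); rewrite ffunE schouten2_br12_13 phi_br12_13// !ffunE.
by rewrite -mulrnDl => /eqP; rewrite mulrn_eq0 /= => /eqP.
Qed.

End quasitriangular_components.

(** * The Jacobi identity for contractions of fundamental fields *)

Section jacobi_identity.
Variables (K : numFieldType) (N : nat) (I : finType).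
Notation W := 'rV[K]_N.
Variables (X : I -> W -> W) (z : W).
Hypothesis hX : forall p, hol (X p) z.
Implicit Types (A S : I -> I -> K) (i j k : 'I_N) (p q r u t : I).

Let x p i : K := X p z 0 i.
Let B q r j : K := ('D_(X q z) (X r) z) 0 j.

Lemma bracket_B q r j : field_bracket (X q) (X r) z 0 j = B q r j - B r q j.
Proof. by rewrite /field_bracket !mxE. Qed.

Lemma B_direction q r j : B q r j = \sum_l x q l * ('D_(basis_vec K l) (X r) z) 0 j.
Proof.
have dX := hol_differentiable (hX r).
rewrite /B (deriveJ _ dX) mxE; apply: eq_bigr => l _.
by rewrite /Jac mxE.
Qed.

Lemma derive_bilinear A (f : W -> K) v j k :
  (\forall w \near z, f w = \sum_p \sum_q A p q * X p w 0 j * X q w 0 k) ->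
  'D_v f z = \sum_p \sum_q A p q *
    (('D_v (X p) z) 0 j * x q k + x p j * ('D_v (X q) z) 0 k).
Proof.
move=> fE; apply: etrans (near_eq_derive v fE) _.
have hx p i : hol (fun w => X p w 0 i) z by exact: hol_entry (hX p).
have hpq p q : hol (fun w => A p q * X p w 0 j * X q w 0 k) z.
  by apply: hol_mul => //; apply: hol_mul => //; exact: hol_cst.
rewrite pair_bigA /=.
(* The double sum is indexed by an ordinal for the sake of derive_sum. *)
have E : 'D_v (\sum_(c < #|{: I * I}|) (fun w : W => A (enum_val c).1 (enum_val c).2 *
    X (enum_val c).1 w 0 j * X (enum_val c).2 w 0 k)) z =
   \sum_(c < #|{: I * I}|) 'D_v (fun w : W => A (enum_val c).1 (enum_val c).2 *
    X (enum_val c).1 w 0 j * X (enum_val c).2 w 0 k) z.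
  by apply: derive_sum => c; exact: hol_derivable v (hpq _ _).
have -> : (fun w => \sum_p \sum_q A p q * X p w 0 j * X q w 0 k) =
   \sum_(c < #|{: I * I}|) (fun w : W => A (enum_val c).1 (enum_val c).2 *
    X (enum_val c).1 w 0 j * X (enum_val c).2 w 0 k).
  apply/funext => w; rewrite fct_sumE pair_bigA /=.
  rewrite (reindex_onto (@enum_val _ (mem {: I * I})) enum_rank) /=; last first.
    by move=> c _; rewrite enum_rankK.
  by apply: eq_bigl => c; rewrite enum_valK eqxx.
apply: etrans E _.
rewrite [RHS](reindex_onto (@enum_val _ (mem {: I * I})) enum_rank) /=; last first.
  by move=> c _; rewrite enum_rankK.
apply: eq_big => [c|c _]; first by rewrite enum_valK eqxx.
move: (enum_val c) => [p q] /=.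
pose f1 (w : W) := A p q * X p w 0 j; pose f2 (w : W) := X q w 0 k.
have h1 : hol f1 z by apply: hol_mul => //; exact: hol_cst.
apply: etrans (@deriveM _ _ f1 f2 z v (hol_derivable v h1) (hol_derivable v (hx q k))) _.
have -> : 'D_v f1 z = A p q * 'D_v (fun w => X p w 0 j) z.
  exact: (@deriveMl _ _ (fun w => X p w 0 j) (A p q) z v (hol_derivable v (hx p j))).
rewrite (derive_entry _ _ (hol_derivable v (hX p))) (derive_entry _ _ (hol_derivable v (hX q))).
rewrite /f1 /f2 /x -![_ *: _]/(_ * _).
by ring.
Qed.

Let sum4 (F : I -> I -> I -> I -> K) : K := \sum_p \sum_q \sum_r \sum_u F p q r u.

Lemma eq_sum4 F F' : (forall p q r u, F p q r u = F' p q r u) -> sum4 F = sum4 F'.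
Proof.
by move=> h; do 4 (apply: eq_bigr => ? _); exact: h.
Qed.

Lemma sum4D F F' : sum4 (fun p q r u => F p q r u + F' p q r u) = sum4 F + sum4 F'.
Proof. by rewrite /sum4 -big_split; do 4 (apply: eq_bigr => ? _; rewrite -?big_split). Qed.

Lemma sum4N F : sum4 (fun p q r u => - F p q r u) = - sum4 F.
Proof. by rewrite /sum4 -sumrN; do 4 (apply: eq_bigr => ? _; rewrite -?sumrN). Qed.

Lemma sum4_rot F : sum4 F = sum4 (fun p q r u => F u r p q).
Proof.
rewrite /sum4 pair_bigA /=.
under eq_bigr do rewrite pair_bigA /=.
rewrite exchange_big /= -(pair_bigA _ (fun p q => \sum_i F i.1 i.2 p q)) /=.
apply: eq_bigr => p _; apply: eq_bigr => q _.
by rewrite -(pair_bigA _ (fun u r => F u r p q)) /= exchange_big.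
Qed.

(** The contraction of [A_12, A_23] with the fields X. *)
Definition contracted12_23 A i j k : K :=
  sum4 (fun p q r u => A p q * A r u * (x p i * (B q r j - B r q j) * x u k)).

(** Each half of the bracket differentiates one field only, so one of the two
    factors S is contracted with the values of the fields. *)
Lemma contracted12_23_symmetric S i j k :
  (forall i j, \sum_p \sum_q S p q * x p i * x q j = 0) -> contracted12_23 S i j k = 0.
Proof.
move=> S0; rewrite /contracted12_23.
rewrite (@eq_sum4 _ (fun p q r u => S p q * S r u * (x p i * B q r j * x u k)
   + - (S p q * S r u * (x p i * B r q j * x u k)))); last by move=> p q r u; ring.
rewrite sum4D sum4N.
suff [-> ->] : sum4 (fun p q r u => S p q * S r u * (x p i * B q r j * x u k)) = 0 /\
    sum4 (fun p q r u => S p q * S r u * (x p i * B r q j * x u k)) = 0 by rewrite subr0.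
split.
  rewrite /sum4 pair_bigA /=; under eq_bigr do rewrite pair_bigA /=.
  (* Summing over p and q first contracts the first factor S. *)
  rewrite exchange_big big1// => -[r u] _ /=.
  rewrite (eq_bigr (fun c => \sum_l S r u * x u k * ('D_(basis_vec K l) (X r) z) 0 j *
      (S c.1 c.2 * x c.1 i * x c.2 l))); last first.
    move=> [p q] _ /=; rewrite B_direction mulr_sumr mulr_suml mulr_sumr.
    by apply: eq_bigr => l _; ring.
  rewrite exchange_big big1// => l _ /=.
  by rewrite -mulr_sumr -(pair_bigA _ (fun p q => S p q * x p i * x q l)) /= S0 mulr0.
(* Here the sum over r and u contracts the second factor. *)
rewrite /sum4 big1// => p _; rewrite big1// => q _.
rewrite pair_bigA /= (eq_bigr (fun c => \sum_l S p q * x p i * ('D_(basis_vec K l) (X q) z) 0 j *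
    (S c.1 c.2 * x c.1 l * x c.2 k))); last first.
  move=> [r u] _ /=; rewrite B_direction mulr_sumr mulr_suml mulr_sumr.
  by apply: eq_bigr => l _; ring.
rewrite exchange_big big1// => l _ /=.
by rewrite -mulr_sumr -(pair_bigA _ (fun r u => S r u * x r l * x u k)) /= S0 mulr0.
Qed.

Variables (A S : I -> I -> K) (C : I -> I -> I -> K) (Pi : W -> 'M[K]_N).
Hypothesis A_skew : forall p q, A p q = - A q p.
Hypothesis S_zero : forall i j, \sum_p \sum_q S p q * x p i * x q j = 0.
Hypothesis X_bracket : forall q r, field_bracket (X q) (X r) z = \sum_t C q r t *: X t z.
Hypothesis PiE : forall i j,
  \forall w \near z, Pi w i j = \sum_p \sum_q A p q * X p w 0 i * X q w 0 j.

(** The components of [A_12, A_23] for the structure constants C. *)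
Definition coeff12_23 A p t u : K := \sum_q \sum_r A p q * A r u * C q r t.

Lemma contracted12_23_coeff12_23 A' i j k :
  contracted12_23 A' i j k = \sum_p \sum_t \sum_u coeff12_23 A' p t u * (x p i * x t j * x u k).
Proof.
rewrite /contracted12_23 /sum4; apply: eq_bigr => p _.
have E q r : B q r j - B r q j = \sum_t C q r t * x t j.
  rewrite -bracket_B X_bracket summxE; apply: eq_bigr => t _.
  by rewrite !mxE.
transitivity (\sum_q \sum_r \sum_u \sum_t A' p q * A' r u * C q r t * (x p i * x t j * x u k)).
  do 3 (apply: eq_bigr => ? _); rewrite E mulr_sumr mulr_suml mulr_sumr.
  by apply: eq_bigr => t _; ring.
rewrite pair_bigA /=; under eq_bigr do rewrite exchange_big /=.
rewrite exchange_big /=; apply: eq_bigr => t _.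
rewrite exchange_big /=; apply: eq_bigr => u _.
by rewrite /coeff12_23 pair_bigA mulr_suml.
Qed.

Lemma contraction i j k :
  \sum_l Pi z i l * 'D_(basis_vec K l) (fun w => Pi w j k) z =
  sum4 (fun p q r u => A p q * A r u * (x p i * B q r j * x u k))
  + sum4 (fun p q r u => A p q * A r u * (x p i * x r j * B q u k)).
Proof.
rewrite -sum4D.
transitivity (\sum_l \sum_p \sum_q \sum_r \sum_u A p q * A r u * x p i * (x q l *
   (('D_(basis_vec K l) (X r) z) 0 j * x u k + x r j * ('D_(basis_vec K l) (X u) z) 0 k))).
  apply: eq_bigr => l _.
  rewrite (nbhs_singleton (PiE i l)) (derive_bilinear _ (PiE j k)).
  rewrite mulr_suml; apply: eq_bigr => p _; rewrite mulr_suml; apply: eq_bigr => q _.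
  rewrite mulr_sumr; apply: eq_bigr => r _; rewrite mulr_sumr; apply: eq_bigr => u _.
  by rewrite -/(x p i) -/(x q l); ring.
rewrite exchange_big; apply: eq_bigr => p _.
rewrite exchange_big; apply: eq_bigr => q _.
rewrite exchange_big; apply: eq_bigr => r _.
rewrite exchange_big; apply: eq_bigr => u _ /=.
rewrite -mulr_sumr !B_direction.
transitivity (A p q * A r u * x p i * ((\sum_l x q l * ('D_(basis_vec K l) (X r) z) 0 j) * x u k
   + x r j * (\sum_l x q l * ('D_(basis_vec K l) (X u) z) 0 k))).
  congr (_ * _); rewrite mulr_suml mulr_sumr -big_split; apply: eq_bigr => l _ /=.
  by ring.
by ring.
Qed.

(** Exchanging the roles of the two factors of A turns the terms that
    differentiate the second leg into the missing halves of the brackets. *)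
Lemma contracted12_23_split i j k : contracted12_23 A i j k =
  sum4 (fun p q r u => A p q * A r u * (x p i * B q r j * x u k))
  + sum4 (fun p q r u => A p q * A r u * (x p k * x r i * B q u j)).
Proof.
rewrite [X in _ = _ + X]sum4_rot -sum4D; apply: eq_sum4 => p q r u.
by rewrite (A_skew u r); ring.
Qed.

(** The cyclic sum D consists of six terms: three differentiate the first leg of
    the second factor of A and three its second leg. By skewness of A they pair
    up into the contractions of [A_12, A_23] and its rotations. *)
Lemma cyclic_contraction_zero i j k :
  (forall p t u, coeff12_23 A p t u + coeff12_23 A t u p + coeff12_23 A u p t =
    coeff12_23 S p t u) ->
  let D i j k := \sum_l Pi z i l * 'D_(basis_vec K l) (fun w => Pi w j k) z in
  D i j k + D j k i + D k i j = 0.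
Proof.
move=> QE D.
have T0 : contracted12_23 A i j k + contracted12_23 A j k i + contracted12_23 A k i j = 0.
  rewrite -(contracted12_23_symmetric i j k S_zero) !contracted12_23_coeff12_23.
  have -> : \sum_p \sum_t \sum_u coeff12_23 A p t u * (x p j * x t k * x u i) =
      \sum_p \sum_t \sum_u coeff12_23 A t u p * (x p i * x t j * x u k).
    rewrite exchange_big /=; under eq_bigr do rewrite exchange_big /=.
    rewrite exchange_big /=; apply: eq_bigr => p _; rewrite exchange_big /=.
    apply: eq_bigr => t _; apply: eq_bigr => u _; by ring.
  have -> : \sum_p \sum_t \sum_u coeff12_23 A p t u * (x p k * x t i * x u j) =
      \sum_p \sum_t \sum_u coeff12_23 A u p t * (x p i * x t j * x u k).
    rewrite exchange_big /=; apply: eq_bigr => p _; rewrite exchange_big /=.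
    apply: eq_bigr => t _; apply: eq_bigr => u _; by ring.
  rewrite -!big_split; apply: eq_bigr => p _; rewrite -!big_split.
  apply: eq_bigr => t _; rewrite -!big_split; apply: eq_bigr => u _ /=.
  by rewrite -!mulrDl QE.
rewrite /D !contraction -T0 !contracted12_23_split.
move: (sum4 (fun p q r u => A p q * A r u * (x p i * B q r j * x u k))) => a.
move: (sum4 (fun p q r u => A p q * A r u * (x p j * B q r k * x u i))) => b.
move: (sum4 (fun p q r u => A p q * A r u * (x p k * B q r i * x u j))) => c.
by ring.
Qed.

End jacobi_identity.

(** * Components of the fused tensor *)

Section r_power_components.
Variables (K : fieldType) (n : nat).
Notation e_ := (@basis_vec K n).

Lemma sum_tens2 (r : 'M[K]_n) : \sum_p \sum_q r p q *: tens2 (e_ p) (e_ q) = r.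
Proof.
rewrite [RHS]matrix_sum_delta; apply: eq_bigr => p _; apply: eq_bigr => q _.
congr (_ *: _); apply/matrixP => a b.
by rewrite /tens2 /basis_vec !mxE big_ord1 !mxE !eqxx /= -natrM mulnb.
Qed.

Lemma sum_tens2_tr (r : 'M[K]_n) : \sum_p \sum_q r p q *: tens2 (e_ q) (e_ p) = r^T.
Proof.
rewrite exchange_big -[RHS]sum_tens2 /=; apply: eq_bigr => q _.
by apply: eq_bigr => p _; rewrite mxE.
Qed.

Lemma sum_wedge_entry (S : finType) (r : 'M[K]_n) (j' k' j k : S) :
  (\sum_p \sum_q r p q *: wedge_pow (inj1 j' (e_ q)) (inj1 k' (e_ p))) (j, k) =
  (if (j == j') && (k == k') then r^T else 0) - (if (j == k') && (k == j') then r else 0).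
Proof.
transitivity (\sum_p \sum_q r p q *: (if (j == j') && (k == k') then tens2 (e_ q) (e_ p) else 0)
   - \sum_p \sum_q r p q *: (if (j == k') && (k == j') then tens2 (e_ p) (e_ q) else 0)).
  rewrite -sumrB sum_ffunE; apply: eq_bigr => p _; rewrite -sumrB sum_ffunE.
  apply: eq_bigr => q _; rewrite -scalerBr !ffunE /=; congr (_ *: (_ - _)).
    by case: (j == j') (k == k') => [] [] //=; rewrite /tens2 ?mulmx0// trmx0 mul0mx.
  by case: (j == k') (k == j') => [] [] //=; rewrite /tens2 ?mulmx0// trmx0 mul0mx.
congr (_ - _).
  case: ifP => _; first exact: sum_tens2_tr.
  by rewrite big1// => p _; rewrite big1// => q _; rewrite scaler0.
case: ifP => _; first exact: sum_tens2.
by rewrite big1// => p _; rewrite big1// => q _; rewrite scaler0.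
Qed.

Lemma Mix_entry m (r : 'M[K]_n) (j k : 'I_m) : Mix m r (j, k) =
  (if (j < k)%N then r^T else 0) - (if (k < j)%N then r else 0).
Proof.
transitivity (\sum_(j' < m) \sum_(k' < m | (j' < k')%N)
    ((if (j == j') && (k == k') then r^T else 0)
     - (if (j == k') && (k == j') then r else 0))).
  rewrite /Mix sum_ffunE; apply: eq_bigr => j' _; rewrite sum_ffunE.
  by apply: eq_bigr => k' _; rewrite sum_wedge_entry.
under eq_bigr do rewrite sumrB.
rewrite sumrB; congr (_ - _).
  rewrite (bigD1 j)//= [X in _ + X]big1 ?addr0; last first.
    by move=> j' jj; rewrite big1// => k' _; rewrite eq_sym (negPf jj).
  rewrite big_mkcond (bigD1 k)//= [X in _ + X]big1 ?addr0 ?eqxx//.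
  by move=> k' kk; rewrite ?eqxx /= (eq_sym k) (negPf kk) if_same.
rewrite (bigD1 k)//= [X in _ + X]big1 ?addr0; last first.
  by move=> j' jj; rewrite big1// => k' _; rewrite (eq_sym k) (negPf jj) andbF.
rewrite big_mkcond (bigD1 j)//= [X in _ + X]big1 ?addr0 ?eqxx//.
by move=> k' kk; rewrite (eq_sym j) (negPf kk) if_same.
Qed.

Lemma r_pow_entry m (eps : 'I_m -> bool) (s L : 'M[K]_n) (j k : 'I_m) :
  s^T = s -> L^T = - L ->
  r_pow eps s L (j, k) = (L + ((k < j)%N%:R - (j < k)%N%:R) *: s)
    + (if j == k then (-1) ^+ eps j *: s else 0).
Proof.
move=> s_sym L_skew; rewrite /r_pow ffunE sum_ffunE ffunE Mix_entry.
have -> : \sum_i (inj2 i ((-1) ^+ eps i *: s) + inj2 i L) (j, k) =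
    if j == k then (-1) ^+ eps j *: s + L else 0.
  rewrite (bigD1 j)//= big1 ?addr0.
    rewrite !ffunE xpair_eqE eqxx /= eq_sym; by case: ifP; rewrite ?addr0.
  move=> i ij; rewrite !ffunE xpair_eqE eq_sym (negPf ij) /=; exact: addr0.
rewrite [(s + L)^T]linearD /= s_sym L_skew.
case: (ltngtP j k) => [jk|kj|/val_inj jk] /=.
- rewrite -[j == k]/(j == k :> nat) (ltn_eqF jk).
  by rewrite subr0 sub0r !add0r addr0 opprB scaleN1r.
- rewrite -[j == k]/(j == k :> nat) (gtn_eqF kj).
  by rewrite !sub0r subr0 opprK addr0 scale1r addrC.
- by rewrite jk eqxx !subr0 scale0r addr0 addrC.
Qed.

End r_power_components.

Section r_Gamma_components.
Variables (R : realType) (n : nat) (S : borderedRiemannSurfaceType R).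
Notation K := (Cplx R).
Variables (V : {fset S}) (Gamma : skeleton V) (s : 'M[K]_n) (L : V -> 'M[K]_n).
Hypothesis s_sym : s^T = s.
Hypothesis L_skew : forall v, (L v)^T = - L v.
Notation H := (edge Gamma * bool)%type.
Implicit Types (a b : H).

Definition vertex_of a : V := if a.2 then target a.1 else source a.1.
Definition position a : nat := index a (half_edges_at Gamma (vertex_of a)).

Lemma mem_half_edges_vertex v a : (a \in half_edges_at Gamma v) = (vertex_of a == v).
Proof. exact: mem_half_edges_at. Qed.

Lemma position_inj a b : vertex_of a = vertex_of b -> position a = position b -> a = b.
Proof.
move=> vab; rewrite /position vab => iab.
have ma : a \in half_edges_at Gamma (vertex_of b) by rewrite mem_half_edges_vertex vab.
have mb : b \in half_edges_at Gamma (vertex_of b) by rewrite mem_half_edges_vertex.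
by rewrite -(nth_index a ma) iab nth_index.
Qed.

(** The sign with which the mixed product couples two half edges at a vertex. *)
Definition order_sign a b : K :=
  (position b < position a)%N%:R - (position a < position b)%N%:R.

Definition skew_part (p : H * H) : 'M[K]_n :=
  if vertex_of p.1 == vertex_of p.2
  then L (vertex_of p.1) + order_sign p.1 p.2 *: s else 0.

Definition sym_part (p : H * H) : 'M[K]_n :=
  if p.1 == p.2 then (-1) ^+ p.1.2 *: s else 0.

Lemma r_Gamma_entry p : r_Gamma Gamma s L p = skew_part p + sym_part p.
Proof.
case: p => a b; rewrite /r_Gamma sum_ffunE.
rewrite (bigD1 (vertex_of a))//= [X in _ + X]big1 ?addr0; last first.
  move=> v va; rewrite ffunE big1// => -[j k] /=.
  rewrite xpair_eqE => /andP[/eqP ja _]; case/eqP: va; apply/esym/eqP.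
  by rewrite -mem_half_edges_vertex -ja mem_tnth.
rewrite ffunE /skew_part /sym_part /=.
set hs := half_edges_at Gamma (vertex_of a).
have hinj : injective (tnth (in_tuple hs)).
  by apply/tuple_uniqP; exact: half_edges_at_uniq.
have [vab|vab] := eqVneq (vertex_of a) (vertex_of b); last first.
  rewrite big1 ?add0r; last first.
    move=> -[j k] /=; rewrite xpair_eqE => /andP[_ /eqP kb]; case/eqP: vab; apply/esym/eqP.
    by rewrite -mem_half_edges_vertex -kb mem_tnth.
  by case: eqP => // ab; rewrite ab eqxx in vab.
have ma : a \in hs by rewrite mem_half_edges_vertex.
have mb : b \in hs by rewrite mem_half_edges_vertex vab.
have pa : (position a < size hs)%N by rewrite /position index_mem.
have pb : (position b < size hs)%N by rewrite /position -vab index_mem.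
have ha : tnth (in_tuple hs) (Ordinal pa) = a by rewrite (tnth_nth a) /= nth_index.
have hb : tnth (in_tuple hs) (Ordinal pb) = b.
  by rewrite (tnth_nth b) /= /position -vab nth_index.
rewrite (big_pred1 (Ordinal pa, Ordinal pb)); last first.
  move=> [j k] /=; rewrite !xpair_eqE -{1}ha -{1}hb.
  by rewrite !(inj_eq hinj).
rewrite r_pow_entry// ha; congr (_ + _).
by rewrite -(inj_eq hinj) ha hb.
Qed.

Lemma order_sign_skew a b : order_sign a b = - order_sign b a.
Proof. by rewrite /order_sign opprB. Qed.

Lemma skew_partC a b : (skew_part (a, b))^T = - skew_part (b, a).
Proof.
rewrite /skew_part /= eq_sym; case: eqP => [<-|_]; last by rewrite trmx0 oppr0.
by rewrite linearD linearZ /= L_skew s_sym (order_sign_skew a) scaleNr opprD.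
Qed.

(** Around three distinct positions of a linear order the three signs are not
    all equal, so the products add up to -1; if exactly two positions coincide,
    only one product is nonzero, and it is -1. *)
Lemma order_sign_transitive a b c : vertex_of a = vertex_of b -> vertex_of b = vertex_of c ->
  1 + order_sign a b * order_sign b c + order_sign b c * order_sign c a
    + order_sign c a * order_sign a b = ((a == b) && (b == c))%:R.
Proof.
move=> vab vbc.
have eq_pos x y : vertex_of x = vertex_of y -> (x == y) = (position x == position y).
  by move=> vxy; apply/eqP/eqP => [->//|]; exact: position_inj.
rewrite (eq_pos _ _ vab) (eq_pos _ _ vbc) /order_sign.
move: (position a) (position b) (position c) => x y z.
case: (ltngtP x y) => xy; case: (ltngtP y z) => yz; case: (ltngtP x z) => xz;
  rewrite /=; by [exfalso; lia|ring].
Qed.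

End r_Gamma_components.

(** * Contractions as tensor fields *)

Section tensor_fields.
Variables (R : realType) (n : nat) (G : complexLieGroupType R n) (E : finType).
Notation K := (Cplx R).
Notation V := 'rV[K]_n.
Notation N := (#|E| * n)%N.
Notation W := 'rV[K]_N.
Notation gchart := (chart G [set: V]).
Notation P := {ptws E -> G}.
Notation H := (E * bool)%type.
Notation e_ := (@basis_vec K n).
Implicit Types (r : H * H -> 'M[K]_n) (ce : E -> gchart) (z : W) (h : H).

Definition frame_tensor ce r z : 'M[K]_N :=
  \sum_p (frame ce p.1 z)^T *m r p *m frame ce p.2 z.

Lemma sum_tens2_mulmx (t : 'M[K]_n) (A B : 'M[K]_(n, N)) :
  \sum_i \sum_j t i j *: tens2 (e_ i *m A) (e_ j *m B) = A^T *m t *m B.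
Proof.
rewrite -[in RHS](sum_tens2 t) mulmx_sumr mulmx_suml; apply: eq_bigr => i _.
rewrite mulmx_sumr mulmx_suml; apply: eq_bigr => j _.
by rewrite -scalemxAr -scalemxAl /tens2 trmx_mul !mulmxA.
Qed.

Lemma map_tens2_mx m (f : {linear W -> 'rV[K]_m}) (t : 'M[K]_N) :
  map_tens2 f t = (lin1_mx f)^T *m t *m lin1_mx f.
Proof.
rewrite -[in RHS](sum_tens2 t) mulmx_sumr mulmx_suml; apply: eq_bigr => i _.
rewrite mulmx_sumr mulmx_suml; apply: eq_bigr => j _.
by rewrite -scalemxAr -scalemxAl /tens2 !mulmxA -trmx_mul -mulmxA !mul_rV_lin1.
Qed.

Lemma congruence_comp (t : 'M[K]_n) (A B A' B' : 'M[K]_(n, N)) (J : 'M[K]_N) :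
  A *m J = A' -> B *m J = B' -> J^T *m (A^T *m t *m B) *m J = A'^T *m t *m B'.
Proof. by move=> <- <-; rewrite trmx_mul !mulmxA. Qed.

Lemma frame_tensorD ce (r1 r2 r : H * H -> 'M[K]_n) z :
  (forall p, r p = r1 p + r2 p) ->
  frame_tensor ce r z = frame_tensor ce r1 z + frame_tensor ce r2 z.
Proof.
move=> rE; rewrite -big_split; apply: eq_bigr => p _.
by rewrite rE mulmxDr mulmxDl.
Qed.

Lemma frame_tensor_skew ce r z : (forall a b, (r (a, b))^T = - r (b, a)) ->
  (frame_tensor ce r z)^T = - frame_tensor ce r z.
Proof.
move=> rsk; rewrite /frame_tensor linear_sum -sumrN /=.
pose swap (p : H * H) := (p.2, p.1).
rewrite (reindex_inj (h := swap)); last by move=> [a b] [c d] [-> ->].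
apply: eq_bigr => -[a b] _ /=.
move: (frame ce a z) (frame ce b z) => A B.
by rewrite !trmx_mul trmxK rsk mulNmx mulmxN mulmxA.
Qed.

Lemma hol_frame_tensor ce r z : (forall e, atlas (ce e)) ->
  (forall e, chart_img (ce e) (coords_at e z)) -> hol (frame_tensor ce r) z.
Proof.
move=> ace cz.
apply: (@hol_sum _ _ _ _ (fun p z => (frame ce p.1 z)^T *m r p *m frame ce p.2 z)) => p.
have h1 := hol_frame ace (cz p.1.1); have h2 := hol_frame ace (cz p.2.1).
by apply: hol_mulmx => //; apply: hol_mulmx; [exact: hol_trmx|exact: hol_cst].
Qed.

Lemma congruence_sum_entry r (F : H -> 'M[K]_(n, N)) i j :
  (\sum_p (F p.1)^T *m r p *m F p.2) i j =
  \sum_(a : H * 'I_n) \sum_(b : H * 'I_n)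
    r (a.1, b.1) a.2 b.2 * F a.1 a.2 i * F b.1 b.2 j.
Proof.
transitivity (\sum_a \sum_b \sum_k \sum_l r (a, b) k l * F a k i * F b l j).
  rewrite summxE pair_bigA; apply: eq_bigr => -[a b] _ /=.
  rewrite exchange_big mxE /=; apply: eq_bigr => l _.
  by rewrite mxE mulr_suml; apply: eq_bigr => k _; rewrite mxE [F a k i * _]mulrC.
under eq_bigr do rewrite exchange_big /=.
rewrite pair_bigA /=; apply: eq_bigr => -[a k] _ /=.
by rewrite pair_bigA.
Qed.

Lemma edge_field_basis ce h k z i : edge_field ce h (e_ k) z 0 i = frame ce h z k i.
Proof. by rewrite /edge_field /basis_vec -rowE mxE. Qed.

Lemma frame_tensorE ce r z i j : frame_tensor ce r z i j =
  \sum_(a : H * 'I_n) \sum_(b : H * 'I_n) r (a.1, b.1) a.2 b.2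
    * edge_field ce a.1 (e_ a.2) z 0 i * edge_field ce b.1 (e_ b.2) z 0 j.
Proof.
rewrite [LHS](congruence_sum_entry r (fun h => frame ce h z)).
by apply: eq_bigr => a _; apply: eq_bigr => b _; rewrite !edge_field_basis.
Qed.

Lemma diagonal_sum r (s : 'M[K]_n) (F : H -> 'M[K]_(n, N)) :
  (forall p, r p = if p.1 == p.2 then (-1) ^+ p.1.2 *: s else 0) ->
  \sum_p (F p.1)^T *m r p *m F p.2 =
  \sum_(e : E) ((F (e, false))^T *m s *m F (e, false) - (F (e, true))^T *m s *m F (e, true)).
Proof.
move=> rE.
transitivity (\sum_(a : H) (-1) ^+ a.2 *: ((F a)^T *m s *m F a)).
  transitivity (\sum_a \sum_b (F a)^T *m r (a, b) *m F b).
    by rewrite pair_bigA; apply: eq_bigr => -[a b].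
  apply: eq_bigr => a _; rewrite (bigD1 a)//= big1 ?addr0.
    by rewrite rE eqxx -scalemxAr -scalemxAl.
  by move=> b ba; rewrite rE /= eq_sym (negPf ba) mulmx0 mul0mx.
transitivity (\sum_(e : E) \sum_(b : bool) (-1) ^+ b *: ((F (e, b))^T *m s *m F (e, b))).
  by rewrite pair_bigA; apply: eq_bigr => -[e b].
by apply: eq_bigr => e _; rewrite big_bool /= expr0 expr1 scale1r scaleN1r addrC.
Qed.

(** Each edge contributes the difference of the two invariant tensor fields
    generated by s. *)
Lemma sym_tensor_zero ce (r : H * H -> 'M[K]_n) (s : 'M[K]_n) z :
  invariant_sym2 (@lie_bracket R n G) s -> connected [set: G] ->
  (forall e, atlas (ce e)) -> (forall e, chart_img (ce e) (coords_at e z)) ->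
  (forall p, r p = if p.1 == p.2 then (-1) ^+ p.1.2 *: s else 0) ->
  frame_tensor ce r z = 0.
Proof.
move=> s_inv Gconn ace cz rE.
rewrite [LHS](diagonal_sum (fun h => frame ce h z) rE); apply: big1 => e _.
have Fb b : (frame ce (e, b) z)^T *m s *m frame ce (e, b) z =
    (single_mx R n e)^T *m inv_tensor s b (ce e) (coords_at e z) *m single_mx R n e.
  rewrite /frame /inv_tensor /=; move: (fund_mx b _ _) (single_mx R n e) => A B.
  by rewrite trmx_mul !mulmxA.
have S0 := inv_tensor_eq s_inv Gconn (ace e) (chart_inv_dom (cz e)).
rewrite (chart_invK (cz e)) in S0.
apply: etrans (congr2 (fun p q => p - q) (Fb false) (Fb true)) _.
apply: etrans (congr1 (fun S => (single_mx R n e)^T *m _ *m single_mx R n e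
  - (single_mx R n e)^T *m S *m single_mx R n e) S0) _.
exact: subrr.
Qed.

Variable expG : tangent (1%g : G) -> G.
Hypothesis expP : exponential_map expG.

Lemma sigma_tensor_at (r : {ffun H * H -> 'M[K]_n}) (a : P)
    (ce := fun e => chart_at (a e) : gchart) :
  sigma_tensor expG r a = frame_tensor ce r (power_chart ce a).
Proof.
rewrite /sigma_tensor /frame_tensor; apply: eq_bigr => p _.
rewrite -sum_tens2_mulmx; apply: eq_bigr => i _; apply: eq_bigr => j _.
by rewrite !(sigma_field_at expP).
Qed.

Lemma sigma_tensor_coords (r : {ffun H * H -> 'M[K]_n}) ce z :
  (forall e, atlas (ce e)) -> chart_img (power_chart ce) z ->
  tensor2_coords (power_chart ce : chart P [set: W]) (sigma_tensor expG r) z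
  = frame_tensor ce r z.
Proof.
move=> ace cz; pose c : chart P [set: W] := power_chart ce.
pose a : P := chart_inv c z.
have ca : power_dom ce a by exact: (chart_inv_dom (c := c)).
have zE : c a = z := chart_invK (c := c) cz.
pose da e : gchart := chart_at (a e).
pose T : {linear W -> W} := 'd (fun w => c (chart_inv (chart_at a) w)) (chart_at a a).
have TE : @tangent_coords R N P c a = T by [].
rewrite /tensor2_coords -/c -/a TE map_tens2_mx sigma_tensor_at -/da.
rewrite /frame_tensor mulmx_sumr mulmx_suml; apply: eq_bigr => p _.
have F h : frame da h (power_chart da a) *m lin1_mx T = frame ce h z.
  apply: mulmx_ext => v; rewrite mulmxA mul_rV_lin1 -zE.
  apply: etrans _ (sigma_field_coords expP h v ace ca).
  exact: (congr1 T (esym (sigma_field_at expP a h v))).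
exact: congruence_comp (F p.1) (F p.2).
Qed.

End tensor_fields.

(** * The Poisson property *)

Section yang_baxter.
Variables (R : realType) (n : nat) (G : complexLieGroupType R n).
Notation K := (Cplx R).
Notation br := (@lie_bracket R n G).
Variables (S : borderedRiemannSurfaceType R) (V : {fset S}) (Gamma : skeleton V).
Variables (s : 'M[K]_n) (L : V -> 'M[K]_n).
Hypothesis s_inv : invariant_sym2 br s.
Hypothesis L_qt : forall v, quasitriangular br s (L v).
Notation H := (edge Gamma * bool)%type.

Lemma br12_23_0l A p t u : br12_23 br 0 A p t u = 0.
Proof. by apply: big1 => q _; apply: big1 => r _; rewrite mxE !mul0r. Qed.

Lemma br12_23_0r A p t u : br12_23 br A 0 p t u = 0.
Proof. by apply: big1 => q _; apply: big1 => r _; rewrite mxE mulr0 mul0r. Qed.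

Lemma br12_23_scale (a b : K) A B p t u :
  br12_23 br (a *: A) (b *: B) p t u = a * b * br12_23 br A B p t u.
Proof.
rewrite /br12_23 mulr_sumr; apply: eq_bigr => q _; rewrite mulr_sumr; apply: eq_bigr => r _.
by rewrite !mxE; ring.
Qed.

Notation A := (skew_part (Gamma := Gamma) s L).
Notation B := (sym_part (Gamma := Gamma) s).

Lemma br12_23_sym_part (a b c : H) p t u :
  br12_23 br (B (a, b)) (B (b, c)) p t u = ((a == b) && (b == c))%:R * br12_23 br s s p t u.
Proof.
rewrite /sym_part /=; case: eqP => [<-|_]; last by rewrite br12_23_0l mul0r.
case: eqP => [_|_]; last by rewrite br12_23_0r mul0r.
by rewrite br12_23_scale -expr2 sqrr_sign.
Qed.

(** Away from triples at a common vertex all terms vanish, because in each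
    product one factor joins distinct vertices. *)
Lemma mixed_yang_baxter (a b c : H) p t u :
  br12_23 br (A (a, b)) (A (b, c)) p t u + br12_23 br (A (b, c)) (A (c, a)) t u p
    + br12_23 br (A (c, a)) (A (a, b)) u p t = br12_23 br (B (a, b)) (B (b, c)) p t u.
Proof.
rewrite br12_23_sym_part /skew_part /=.
have [vab|vab] := eqVneq (vertex_of a) (vertex_of b); last first.
  have -> : (a == b) = false by apply: contra_neqF vab => /eqP ->.
  have [vbc|vbc] := eqVneq (vertex_of b) (vertex_of c).
    by rewrite -vbc eq_sym (negPf vab) !(br12_23_0l, br12_23_0r) mul0r !addr0.
  by rewrite !(br12_23_0l, br12_23_0r) mul0r !addr0.
have [vbc|vbc] := eqVneq (vertex_of b) (vertex_of c); last first.
  have -> : (b == c) = false by apply: contra_neqF vbc => /eqP ->.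
  by rewrite vab eq_sym (negPf vbc) !(br12_23_0l, br12_23_0r) andbF mul0r !addr0.
rewrite vab -vbc eqxx.
have [[s_sym _] L_skew L_cyb] := L_qt (vertex_of b).
rewrite -(order_sign_transitive vab vbc).
apply: (@yang_baxter_signs K n br (@ad_mx R n G) (@lie_bracket_ad R n G)
  (@lie_bracketC R n G) s s_sym (ad_invariant s_inv) _ _ _ _ _ _ _ L_skew).
exact: (@quasitriangular_br12_13 K n br (@ad_mx R n G) (@lie_bracket_ad R n G)
  (@lie_bracketC R n G)).
Qed.

End yang_baxter.

Section poisson.
Variables (R : realType) (n : nat) (G : complexLieGroupType R n).
Notation K := (Cplx R).
Notation br := (@lie_bracket R n G).
Variable expG : tangent (1%g : G) -> G.
Variables (S : borderedRiemannSurfaceType R) (V : {fset S}) (Gamma : skeleton V).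
Variables (s : 'M[K]_n) (L : V -> 'M[K]_n).
Hypothesis Gconn : connected [set: G].
Hypothesis expP : exponential_map expG.
Hypothesis s_inv : invariant_sym2 br s.
Hypothesis L_qt : forall v, quasitriangular br s (L v).
Notation E := (edge Gamma).
Notation H := (E * bool)%type.
Notation N := (#|E| * n)%N.
Notation W := 'rV[K]_N.
Notation gchart := (chart G [set: 'rV[K]_n]).
Notation P := {ptws E -> G}.
Notation A := (skew_part (Gamma := Gamma) s L).
Notation B := (sym_part (Gamma := Gamma) s).
Notation e_ := (@basis_vec K n).
Implicit Types (ce : E -> gchart) (z : W).

Let s_sym : s^T = s := s_inv.1.
Let L_skew v : (L v)^T = - L v. Proof. by have [_] := L_qt v. Qed.

Lemma power_chart_imgP ce z : chart_img (power_chart ce) z ->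
  forall e, chart_img (ce e) (coords_at e z).
Proof. by rewrite /chart_img power_img. Qed.

Lemma frame_tensor_r_Gamma ce z : (forall e, atlas (ce e)) ->
  (forall e, chart_img (ce e) (coords_at e z)) ->
  frame_tensor ce (r_Gamma Gamma s L) z = frame_tensor ce A z.
Proof.
move=> ace cz.
rewrite (@frame_tensorD _ _ _ _ ce A B); last exact: r_Gamma_entry s_sym L_skew.
by rewrite (@sym_tensor_zero _ _ _ _ ce B s z s_inv Gconn ace cz) ?addr0.
Qed.

Lemma bivector_sigma : bivector_field (sigma_tensor expG (r_Gamma Gamma s L)).
Proof.
split=> [a|c [ce ace <-]].
  pose ce e : gchart := chart_at (a e).
  have ace e : atlas (ce e) by exact: atlas_chart_at.
  have cz := power_chart_imgP (mem_chart_img (c := power_chart ce) (fun e => mem_chart_at (a e))).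
  rewrite (sigma_tensor_at expP) -/ce (frame_tensor_r_Gamma ace cz).
  by apply: frame_tensor_skew => x y; exact: skew_partC.
apply/holomorphicP; split=> [|z cz]; first exact: open_chart_imgT.
apply: (@hol_ext _ _ _ (frame_tensor ce (r_Gamma Gamma s L))).
  apply: filterS (near_chart_img cz) => w cw.
  by rewrite (sigma_tensor_coords expP).
by apply: hol_frame_tensor => //; exact: power_chart_imgP.
Qed.

Lemma edge_field_sum ce (h : H) (x : 'rV[K]_n) z :
  edge_field ce h x z = \sum_t x 0 t *: edge_field ce h (e_ t) z.
Proof.
rewrite /edge_field {1}[x]row_sum_delta mulmx_suml; apply: eq_bigr => t _.
by rewrite -scalemxAl.
Qed.

(** Brackets are nonzero only inside one copy of the Lie algebra, which forces
    both middle half edges to be t.1. *)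
Lemma coeff12_23_structure (T : H * H -> 'M[K]_n) (a t u : H * 'I_n) :
  \sum_(b : H * 'I_n) \sum_(c : H * 'I_n)
    T (a.1, b.1) a.2 b.2 * T (c.1, u.1) c.2 u.2 *
    (if (b.1 == c.1) && (b.1 == t.1) then str_const br b.2 c.2 t.2 else 0)
  = br12_23 br (T (a.1, t.1)) (T (t.1, u.1)) a.2 t.2 u.2.
Proof.
transitivity (\sum_(b : H) \sum_q \sum_(c : H) \sum_r
    T (a.1, b) a.2 q * T (c, u.1) r u.2 *
    (if (b == c) && (b == t.1) then str_const br q r t.2 else 0)).
  pose F (b : H) (q : 'I_n) (c : H) (r : 'I_n) : K := T (a.1, b) a.2 q * T (c, u.1) r u.2 *
    (if (b == c) && (b == t.1) then str_const br q r t.2 else 0).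
  rewrite -/(\sum_b \sum_q \sum_c \sum_r F b q c r).
  rewrite (pair_bigA _ (fun b q => \sum_c \sum_r F b q c r)).
  by apply: eq_bigr => -[b q] _ /=; rewrite pair_bigA; apply: eq_bigr => -[c r].
rewrite (bigD1 t.1)//= [X in _ + X]big1 ?addr0; last first.
  move=> b bt; apply: big1 => q _; apply: big1 => c _; apply: big1 => r _.
  by rewrite (negPf bt) andbF mulr0.
apply: eq_bigr => q _; rewrite (bigD1 t.1)//= [X in _ + X]big1 ?addr0; last first.
  by move=> c ct; apply: big1 => r _; rewrite eq_sym (negPf ct) mulr0.
by apply: eq_bigr => r _; rewrite !eqxx.
Qed.

Lemma frame_bracket ce z (h h' : H) (q r : 'I_n) : (forall e, atlas (ce e)) ->
  (forall e, chart_img (ce e) (coords_at e z)) ->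
  field_bracket (edge_field ce h (e_ q)) (edge_field ce h' (e_ r)) z =
  \sum_(t : H * 'I_n) (if (h == h') && (h == t.1) then str_const br q r t.2 else 0)
    *: edge_field ce t.1 (e_ t.2) z.
Proof.
move=> ace cz; apply: etrans (edge_field_bracket ace h h' (e_ q) (e_ r) cz) _.
case: eqP => [_|_] /=; last by rewrite big1// => t _; rewrite scale0r.
transitivity (\sum_d \sum_t (if h == d then str_const br q r t else 0) *: edge_field ce d (e_ t) z);
  last by rewrite pair_bigA /=; apply: eq_bigr => -[d t].
rewrite (bigD1 h)//= [X in _ = _ + X]big1 ?addr0; last first.
  by move=> d dh; apply: big1 => t _; rewrite eq_sym (negPf dh) scale0r.
rewrite eqxx; exact: edge_field_sum.
Qed.

Lemma schouten_sigma c : atlas c -> forall z, chart_img c z -> forall i j k,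
  schouten_coords (tensor2_coords c (sigma_tensor expG (r_Gamma Gamma s L)))
    (tensor2_coords c (sigma_tensor expG (r_Gamma Gamma s L))) z i j k = 0.
Proof.
move=> [ce ace <-] z cz i j k; have cz' := power_chart_imgP cz.
pose X (a : H * 'I_n) (w : W) : W := edge_field ce a.1 (e_ a.2) w.
pose A' (a b : H * 'I_n) : K := A (a.1, b.1) a.2 b.2.
pose B' (a b : H * 'I_n) : K := B (a.1, b.1) a.2 b.2.
(* The structure constants of the direct sum over all half edges. *)
pose C (a b t : H * 'I_n) : K :=
  if (a.1 == b.1) && (a.1 == t.1) then str_const br a.2 b.2 t.2 else 0.
have hX a : hol (X a) z := hol_edge_field ace (e_ a.2) (cz' a.1.1).
have A'sk a b : A' a b = - A' b a.
  by have /matrixP/(_ b.2 a.2) := skew_partC s_sym L_skew a.1 b.1; rewrite !mxE.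
have B'0 i' j' : \sum_a \sum_b B' a b * X a z 0 i' * X b z 0 j' = 0.
  by rewrite -(frame_tensorE ce B) (sym_tensor_zero s_inv Gconn ace cz')// mxE.
have Xbr a b : field_bracket (X a) (X b) z = \sum_t C a b t *: X t z.
  exact: frame_bracket.
have PiE i' j' : \forall w \near z,
    tensor2_coords (power_chart ce) (sigma_tensor expG (r_Gamma Gamma s L)) w i' j'
    = \sum_a \sum_b A' a b * X a w 0 i' * X b w 0 j'.
  apply: filterS (near_chart_img cz) => w cw.
  rewrite (sigma_tensor_coords expP)// (frame_tensor_r_Gamma ace (power_chart_imgP cw)).
  exact: frame_tensorE.
have QE a t u : coeff12_23 C A' a t u + coeff12_23 C A' t u a + coeff12_23 C A' u a t =
    coeff12_23 C B' a t u.
  rewrite /coeff12_23 !coeff12_23_structure.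
  exact: mixed_yang_baxter.
have D0 := cyclic_contraction_zero hX A'sk B'0 Xbr PiE i j k QE.
exact: etrans (congr2 (fun p q : K => p + q) D0 D0) (addr0 (0 : K)).
Qed.

End poisson.

Theorem theorem4p2 (R : realType) (n : nat) (G : complexLieGroupType R n)
    (expG : tangent (1%g : G) -> G)
    (S : borderedRiemannSurfaceType R) (V : {fset S}) (Gamma : skeleton V)
    (s : 'M[Cplx R]_n) (L : V -> 'M[Cplx R]_n) :
  connected [set: G] ->
  exponential_map expG ->
  marked_surface V ->
  invariant_sym2 (@lie_bracket R n G) s ->
  (forall v : V, quasitriangular (@lie_bracket R n G) s (L v)) ->
  let pi_Gamma := sigma_tensor expG (r_Gamma Gamma s L) in
  bivector_field pi_Gamma /\ poisson_structure pi_Gamma.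
Proof.
move=> Gconn expP _ s_inv L_qt pi_Gamma.
have pi_bivector := bivector_sigma Gamma Gconn expP s_inv L_qt.
split; first exact: pi_bivector.
split; first exact: pi_bivector.
exact: schouten_sigma Gconn expP s_inv L_qt.
Qed.
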